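(* Let $\{a_n\}_{n=0}^\infty$ be i.i.d. standard complex Gaussian random variables and let $\Upsilon_{\mathbb{D}}$ be the point process on the unit disc $\mathbb{D}=\{z\in\mathbb{C}:|z|<1\}$ (viewed as the hyperbolic plane) whose support is the set of zeros in $\mathbb{D}$ of the random analytic function $g(z)=\sum_{n=0}^\infty a_nz^n$. Then $\Upsilon_{\mathbb{D}}$ is both insertion-tolerant and deletion-tolerant.
   Context: A standard complex Gaussian random variable has density $\pi^{-1}\exp(-|z|^2)$ with respect to Lebesgue measure on $\mathbb{C}$. The disc $\mathbb{D}$ is endowed with the hyperbolic metric $|dz|/(1-|z|^2)$, the group $G$ of symmetries $z\mapsto(az+b)/(\bar bz+\bar a)$, $a,b\in\mathbb{C}$, $|a|^2-|b|^2=1$, and the associated $G$-invariant measure $m(dz)=dx\,dy/(1-|z|^2)^2$, $z=x+iy$, which plays the role of Lebesgue measure. Point processes are always simple and locally finite, i.e. random elements of the space of simple locally finite point measures on $\mathbb{D}$, equipped with the $\sigma$-field generated by the evaluations $\mu\mapsto\mu(A)$, $A$ Borel. The support of $\mu$ is $[\mu]=\{y:\mu(\{y\})=1\}$. For random variables $X,Y$ with values in the same measurable space, $X\prec Y$ means that $\mathbb{P}(Y\in\mathcal{A})=0$ implies $\mathbb{P}(X\in\mathcal{A})=0$ for all measurable $\mathcal{A}$. $\delta_x$ is the point measure at $x$. A point process $\Pi$ on $\mathbb{D}$ is insertion-tolerant if for every Borel set $S\subseteq\mathbb{D}$ with $m(S)\in(0,\infty)$, if $U$ has law $m(\cdot\cap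 S)/m(S)$ and is independent of $\Pi$, then $\Pi+\delta_U\prec\Pi$. A $\Pi$-point is a $\mathbb{D}$-valued random variable $Z$ with $Z\in[\Pi]$ almost surely; $\Pi$ is deletion-tolerant if $\Pi-\delta_Z\prec\Pi$ for every $\Pi$-point $Z$. *)

(* Defs.v *)
From HB Require Import structures.
From mathcomp Require Import all_boot all_order all_algebra.
From mathcomp Require Import finmap complex.
From mathcomp Require Import all_classical all_reals all_analysis.
From mathcomp Require Import measurable_realfun.
Set Implicit Arguments.
Unset Strict Implicit.
Unset Printing Implicit Defensive.
Import Order.TTheory GRing.Theory Num.Theory.
Import numFieldNormedType.Exports.
Local Open Scope classical_set_scope.
Local Open Scope ring_scope.

Section complex_measurable.
Context (R : realType).

Definition Re_Im (z : R[i]) : R * R := (complex.Re z, complex.Im z).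

Definition of_Re_Im (p : R * R) : R[i] := Complex p.1 p.2.

HB.instance Definition _ := isPointed.Build R[i] 0.

(* The Borel sigma-field of C is that of R^2, through z |-> (Re z, Im z). *)
HB.instance Definition _ :=
  Measurable.copy R[i] (g_sigma_algebra_preimageType Re_Im).

Lemma measurable_of_Re_Im : measurable_fun [set: R * R] of_Re_Im.
Proof.
move=> _ _ [B mB <-]; rewrite !setTI.
suff -> : of_Re_Im @^-1` (Re_Im @^-1` B) = B by [].
by apply/seteqP; split=> -[].
Qed.

Definition lebesgue_complex : set R[i] -> \bar R :=
  pushforward (@lebesgue_measure R \x @lebesgue_measure R)%E of_Re_Im.

Let lebesgue_complex0 : lebesgue_complex set0 = 0%E.
Proof. by rewrite /lebesgue_complex /pushforward preimage_set0 measure0. Qed.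

Let lebesgue_complex_ge0 A : (0 <= lebesgue_complex A)%E.
Proof. by rewrite /lebesgue_complex /pushforward; exact: measure_ge0. Qed.

Let lebesgue_complex_sigma_additive : semi_sigma_additive lebesgue_complex.
Proof.
move=> F mF tF mUF; rewrite /lebesgue_complex /pushforward preimage_bigcup.
apply: measure_semi_sigma_additive.
- by move=> n; rewrite -[X in measurable X]setTI; exact: measurable_of_Re_Im.
- apply/trivIsetP => /= i j _ _ ij; rewrite -preimage_setI.
  by move/trivIsetP : tF => /(_ _ _ _ _ ij) ->//; rewrite preimage_set0.
- rewrite -preimage_bigcup -[X in measurable X]setTI.
  exact: measurable_of_Re_Im.
Qed.

HB.instance Definition _ := isMeasure.Build _ _ _ lebesgue_complex
  lebesgue_complex0 lebesgue_complex_ge0 lebesgue_complex_sigma_additive.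

End complex_measurable.

(* Mutual independence: the product rule over every finite subfamily. *)
Definition mutually_independent {d d'} {T : measurableType d}
    {T' : measurableType d'} {R : realType} (P : probability T R)
    (X : nat -> {RV P >-> T'}) : Prop :=
  forall (J : {fset nat}) (B : nat -> set T'),
    (forall n, n \in J -> measurable (B n)) ->
    P (\bigcap_(n in [set` J]) (X n @^-1` B n)) =
    (\prod_(n <- J) P (X n @^-1` B n))%E.

Definition independent {d d1 d2} {T : measurableType d}
    {T1 : measurableType d1} {T2 : measurableType d2} {R : realType}
    (P : probability T R) (X : {RV P >-> T1}) (Y : {RV P >-> T2}) : Prop :=
  forall A B, measurable A -> measurable B ->
    P (X @^-1` A `&` Y @^-1` B) = (P (X @^-1` A) * P (Y @^-1` B))%E.

Definition standard_complex_gaussian {d} {T : measurableType d} {R : realType}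
    (P : probability T R) (X : {RV P >-> R[i]}) : Prop :=
  forall A : set R[i], measurable A ->
    distribution P X A =
    (\int[@lebesgue_complex R]_(z in A)
       (pi^-1 * expR (- Normc.normc z ^+ 2))%:E)%E.

Section disc.
Context (R : realType).

Definition disc : Type := {z : R[i] | `|z| < 1}.

Definition disc_val (z : disc) : R[i] := sval z.

HB.instance Definition _ := Choice.on disc.

Let normr0_lt1 : `|0 : R[i]| < 1.
Proof. by rewrite normr0 ltr01. Qed.

HB.instance Definition _ := isPointed.Build disc (exist _ 0 normr0_lt1).

HB.instance Definition _ :=
  Measurable.copy disc (g_sigma_algebra_preimageType disc_val).

Definition hyperbolic_measure (A : set disc) : \bar R :=
  (\int[@lebesgue_complex R]_(z in disc_val @` A)
     (((1 - Normc.normc z ^+ 2) ^- 2)%:E))%E.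

(* [R[i]^o] is C with the topology of its modulus. *)
Definition disc_compact (K : set disc) : Prop :=
  compact (disc_val @` K : set R[i]^o).

(* A locally finite set S of points, each with mass one. *)
Definition is_point_measure (mu : {measure set disc -> \bar R}) : Prop :=
  exists S : set disc,
    (forall K, disc_compact K -> finite_set (S `&` K)) /\
    (forall A, measurable A -> mu A = counting (S `&` A)).

Record point_measure : Type := PointMeasure {
  point_measure_val :> {measure set disc -> \bar R} ;
  point_measureP : is_point_measure point_measure_val }.

Lemma is_point_measure0 : is_point_measure mzero.
Proof.
exists set0; split=> [K _|A _]; first by rewrite set0I.
by rewrite set0I /mzero /counting asboolT// fset_set0.
Qed.

HB.instance Definition _ := gen_eqMixin point_measure.
HB.instance Definition _ := gen_choiceMixin point_measure.
HB.instance Definition _ :=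
  isPointed.Build point_measure (PointMeasure is_point_measure0).

(* The sigma-field generated by the evaluations mu |-> mu A. *)
Definition point_measure_measurable : set (set point_measure) :=
  <<s \bigcup_(A in @measurable _ disc)
        preimage_set_system [set: point_measure] (fun mu => mu A) measurable >>.

Let point_measure_measurable0 : point_measure_measurable set0.
Proof. exact: sigma_algebra0. Qed.

Let point_measure_measurableC U :
  point_measure_measurable U -> point_measure_measurable (~` U).
Proof. exact: sigma_algebraC. Qed.

Let point_measure_measurableU (F : (set point_measure)^nat) :
  (forall i, point_measure_measurable (F i)) ->
  point_measure_measurable (\bigcup_i F i).
Proof. exact: sigma_algebra_bigcup. Qed.

Definition point_measure_display : measure_display.
Proof. by constructor. Qed.

HB.instance Definition _ :=
  @isMeasurable.Build point_measure_display point_measure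
    point_measure_measurable point_measure_measurable0
    point_measure_measurableC point_measure_measurableU.

Definition point_support (mu : point_measure) : set disc :=
  [set y | mu [set y] = 1%E].

Lemma measurable_disc1 (x : disc) : measurable [set x].
Proof.
exists [set disc_val x]; last first.
  rewrite setTI; apply/seteqP; split=> y /=; last by move=> ->.
  by move=> xy; apply: val_inj.
exists [set Re_Im (disc_val x)]; last first.
  rewrite setTI; apply/seteqP; split=> y /=; last by move=> ->.
  by case: y (disc_val x) => [a b] [a' b'] [-> ->].
rewrite [X in measurable X](_ : _ =
  [set complex.Re (disc_val x)] `*` [set complex.Im (disc_val x)]).
  by apply: measurableX.
by apply/seteqP; split=> -[a b] /= [-> ->].
Qed.

Lemma countingU1 (S : set disc) (x : disc) : ~ S x ->
  (counting (x |` S) = counting S + 1 :> \bar R)%E.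
Proof.
move=> Sx; rewrite /counting.
case: (pselect (finite_set S)) => fS; last first.
  rewrite !asboolF//; apply: contra_not fS => /sub_finite_set; apply.
  exact: subsetUr.
have fSx : finite_set (x |` S) by rewrite finite_setU; split.
rewrite !asboolT// fset_setU1// cardfsU1 in_fset_set// memNset//=.
by rewrite natrD EFinD addeC.
Qed.

Lemma counting_dirac (S : set disc) (x : disc) A : ~ S x ->
  (counting ((x |` S) `&` A) = counting (S `&` A) + \d_x A :> \bar R)%E.
Proof.
move=> Sx; rewrite setIUl diracE; case: (pselect (A x)) => Ax.
- rewrite (_ : [set x] `&` A = [set x]); last first.
    by apply/seteqP; split=> y /= => [[]//|->].
  by rewrite countingU1 ?mem_set//; case.
- rewrite (_ : [set x] `&` A = set0); last first.
    by apply/seteqP; split=> y //= [->].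
  by rewrite set0U memNset//= adde0.
Qed.

Lemma counting1I (S : set disc) (x : disc) :
  (counting (S `&` [set x]) = 1 :> \bar R)%E <-> S x.
Proof.
split=> [|Sx].
  apply: contraPP => Sx; rewrite (_ : S `&` [set x] = set0).
    rewrite /counting asboolT// fset_set0/= => /eqP.
    by rewrite eqe eq_sym oner_eq0.
  by apply/seteqP; split=> y //= [Sy yx]; apply: Sx; rewrite -yx.
rewrite (_ : S `&` [set x] = [set x]); last first.
  by apply/seteqP; split=> y /= => [[]//|->].
by rewrite /counting asboolT ?fset_set1 ?cardfs1//; exact: finite_set1.
Qed.

Lemma is_point_measure_add (mu : point_measure) (x : disc) :
  ~ point_support mu x -> is_point_measure (measure_add mu \d_x).
Proof.
case: mu => mu [S [Sfin Smu]]; rewrite /point_support /= => mux.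
have Sx : ~ S x.
  by move=> Sx; apply: mux; rewrite Smu; [exact/counting1I|exact: measurable_disc1].
exists (x |` S); split=> [K cK|A mA].
  rewrite setIUl finite_setU; split; last exact: Sfin.
  by apply: sub_finite_set (finite_set1 x) => y [].
by rewrite counting_dirac// -Smu//; exact: measure_addE.
Qed.

Let measurable_discC1 (x : disc) : measurable (~` [set x]).
Proof. by apply: measurableC; exact: measurable_disc1. Qed.

Lemma is_point_measure_remove (mu : point_measure) (x : disc) :
  is_point_measure (mrestr mu (measurable_discC1 x)).
Proof.
case: mu => mu [S [Sfin Smu]].
exists (S `\ x); split=> [K cK|A mA].
  by apply: sub_finite_set (Sfin _ cK) => y [[? _]].
transitivity (mu (A `&` ~` [set x])); first by [].
rewrite Smu; last exact: measurableI.
by rewrite setDE setIA setIAC.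
Qed.

(* mu + delta_x as a simple point measure; it is mu itself when x already
   carries a point of mu. *)
Definition add_point (mu : point_measure) (x : disc) : point_measure :=
  match pselect (point_support mu x) with
  | left _ => mu
  | right xmu => PointMeasure (is_point_measure_add xmu)
  end.

Lemma add_pointE (mu : point_measure) (x : disc) (A : set disc) :
  ~ point_support mu x -> add_point mu x A = (mu A + \d_x A)%E.
Proof. by rewrite /add_point; case: pselect => //= ? _; exact: measure_addE. Qed.

(* mu - delta_x, that is, mu restricted to the complement of {x}; it is mu
   itself when x carries no point of mu. *)
Definition remove_point (mu : point_measure) (x : disc) : point_measure :=
  PointMeasure (is_point_measure_remove mu x).

Lemma remove_pointE (mu : point_measure) (x : disc) (A : set disc) :
  measurable A -> point_support mu x -> remove_point mu x A = (mu A - \d_x A)%E.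
Proof.
move=> mA mux; rewrite diracE; transitivity (mu (A `\` [set x])).
  by rewrite setDE.
have -> : (mu A = mu (A `\` [set x]) + mu (A `&` [set x]))%E.
  by apply: measureDI => //; exact: measurable_disc1.
case: (pselect (A x)) => Ax.
  have -> : mu (A `&` [set x]) = 1%E.
    rewrite -[RHS]mux; congr (_ _).
    by apply/seteqP; split=> y /= => [[]//|->].
  by rewrite mem_set// addeK.
have -> : mu (A `&` [set x]) = 0%E.
  rewrite -[RHS](measure0 mu); congr (_ _).
  by apply/seteqP; split=> y //= [Ay yx]; apply: Ax; rewrite -yx.
by rewrite adde0 memNset//= sube0.
Qed.

Lemma remove_point_notin (mu : point_measure) (x : disc) (A : set disc) :
  measurable A -> ~ point_support mu x -> remove_point mu x A = mu A.
Proof.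
case: mu => mu [S [Sfin Smu]] mA; rewrite /point_support/= => mux.
have Sx : ~ S x.
  by move=> Sx; apply: mux; rewrite Smu; [exact/counting1I|exact: measurable_disc1].
transitivity (mu (A `&` ~` [set x])); first by [].
rewrite !Smu//; last exact: measurableI.
congr counting; apply/seteqP; split=> y /= [Sy]; first by case.
by move=> Ay; split=> //; split=> // yx; apply: Sx; rewrite -yx.
Qed.

End disc.
Arguments disc_val {R}.

(* X \prec Y for random variables X and Y with values in the same measurable
   space. When X is measurable, negligibility of [X @^-1` A] means that this
   event has probability zero; Y is always a random variable below. *)
Definition abs_continuous {d1 d2 d} {T1 : measurableType d1}
    {T2 : measurableType d2} {V : measurableType d} {R : realType}
    (P1 : probability T1 R) (X : T1 -> V)
    (P2 : probability T2 R) (Y : T2 -> V) : Prop :=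
  forall A : set V, measurable A ->
    P2 (Y @^-1` A) = 0%E -> P1.-negligible (X @^-1` A).

Definition same_law {d1 d2 d} {T1 : measurableType d1}
    {T2 : measurableType d2} {V : measurableType d} {R : realType}
    (P1 : probability T1 R) (X : {RV P1 >-> V})
    (P2 : probability T2 R) (Y : {RV P2 >-> V}) : Prop :=
  forall A : set V, measurable A -> distribution P1 X A = distribution P2 Y A.

(* Auxiliary random variables such as U may need a richer probability space
   than the one carrying Pi, so both properties below range over all
   probability spaces (Omega', P') carrying a copy Pi' of Pi; taking
   Omega' = Omega and Pi' = Pi is one of the instances. *)
Definition insertion_tolerant {d} {Omega : measurableType d} {R : realType}
    (P : probability Omega R) (Pi : {RV P >-> point_measure R}) : Prop :=
  forall S : set (disc R), measurable S ->
  (0 < hyperbolic_measure S)%E -> (hyperbolic_measure S < +oo)%E ->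
  forall d' (Omega' : measurableType d') (P' : probability Omega' R)
    (Pi' : {RV P' >-> point_measure R}) (U : {RV P' >-> disc R}),
  same_law Pi' Pi ->
  (forall B : set (disc R), measurable B ->
    distribution P' U B =
    (hyperbolic_measure (B `&` S) / hyperbolic_measure S)%E) ->
  independent Pi' U ->
  abs_continuous P' (fun w => add_point (Pi' w) (U w)) P Pi.

Definition deletion_tolerant {d} {Omega : measurableType d} {R : realType}
    (P : probability Omega R) (Pi : {RV P >-> point_measure R}) : Prop :=
  forall d' (Omega' : measurableType d') (P' : probability Omega' R)
    (Pi' : {RV P' >-> point_measure R}) (Z : {RV P' >-> disc R}),
  same_law Pi' Pi ->
  {ae P', forall w, point_support (Pi' w) (Z w)} ->
  abs_continuous P' (fun w => remove_point (Pi' w) (Z w)) P Pi.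

Definition power_series {R : realType} (c : nat -> R[i]) (z : R[i]) : R[i]^o :=
  limn (series (fun n => c n * z ^+ n : R[i]^o)).

(* Main.v *)
Require Import Defs.
From HB Require Import structures.
From mathcomp Require Import all_boot all_order all_algebra.
From mathcomp Require Import finmap complex.
From mathcomp Require Import all_classical all_reals all_analysis.
From mathcomp Require Import measurable_realfun.
From mathcomp Require Import ring lra.
Set Implicit Arguments.
Unset Strict Implicit.
Unset Printing Implicit Defensive.
Import Order.TTheory GRing.Theory Num.Theory.
Import numFieldNormedType.Exports.
Local Open Scope classical_set_scope.
Local Open Scope ring_scope.

(** Multiplication by the Blaschke factor [B_u(z) = (z - u) / (1 - conj u * z)]
    adds the zero [u] to a power series, and division by it removes a zero [u].
    The theorem holds because, for an added [u] with a density and for any choice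
    of the removed zero [u], the Gaussian power series is mapped to a series
    whose law charges no null event of the original law.

    Fix [u] in the disc and put [k = sqrt (1 - |u|^2)]. If [s] and the
    coefficients of [x] are independent standard Gaussians, so are those of
      [b(z) = k * s / (1 - conj u * z) + B_u(z) * x(z)]
    ([filter_out_law]): they are the output of a lattice filter, each step of
    which rotates the pair of its state and the next coefficient of [x], and a
    pair of independent Gaussians is invariant under rotations
    ([gauss_rotation]). Moreover [b(u) = s / k] ([power_series_filter_out]).
    The tail [b] of the coefficients of [B_u * a] is the output of this filter
    with state [k * a 0] and input the tail of [a]; since [u] is a zero, the
    first coefficient is [zero_head b u = - u * b(u)]. Thus, up to a rescaling
    of [a 0], adding the zero [u] to a Gaussian series replaces it by a series
    with Gaussian tail [b] and head [zero_head b u].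

    For insertion, keep [b] and let [u] vary: [zero_head b] is analytic, so the
    preimage of a null set is null away from the critical points, which are
    almost surely negligible. As the head of a Gaussian series has a positive
    density, Fubini gives [core_insertion]. For deletion, if a series with tail
    [b] has a zero [u] whose removal leads to a null event, then its head lies
    in the image under [zero_head b] of a set of points [u] which is null for
    almost every [b]; the image is null, whence [core_deletion]. Both facts
    about images and preimages come from [lipschitz_null], proved by covering
    null sets with dyadic cells.

    It remains to pass from coefficients to configurations. Any event on
    configurations is, for zero sets, a measurable event on the coefficients
    ([detectable_event]), since zeros in compact sets are detected by values at
    rational points. The inserted or deleted point is isolated from the rest of
    the configuration by one of countably many sets ([separatorP]), which turns
    deletion into an event on the configuration alone ([removable_null]), and
    insertion into an event on an independent pair ([insertable_null]). *)

(** * Complex numbers as a measurable space *)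

Lemma measurable_fun_pair_in d d1 d2 (T : measurableType d)
    (T1 : measurableType d1) (T2 : measurableType d2) (D : set T)
    (f : T -> T1) (g : T -> T2) :
  measurable_fun D f -> measurable_fun D g ->
  measurable_fun D (fun x => (f x, g x)).
Proof.
move=> mf mg mD.
pose G := preimage_set_system setT (@fst T1 T2) measurable `|`
          preimage_set_system setT (@snd T1 T2) measurable.
apply: (@measurability _ _ _ _ D _ G) (mD) => // _ [_ [] [B mB <-] <-].
  by rewrite setTI; exact: mf.
by rewrite setTI; exact: mg.
Qed.

Section complex_measurability.
Context (R : realType).
Local Notation C := (R[i]).
Local Notation normc := (@Normc.normc R).

Lemma measurable_Re_Im : measurable_fun [set: C] (@Re_Im R).
Proof. by move=> _ B mB; exists B. Qed.

Lemma measurable_Re : measurable_fun [set: C] (@complex.Re R).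
Proof. exact: (measurableT_comp measurable_fst measurable_Re_Im). Qed.

Lemma measurable_Im : measurable_fun [set: C] (@complex.Im R).
Proof. exact: (measurableT_comp measurable_snd measurable_Re_Im). Qed.

Lemma measurable_Complex d (T : measurableType d) (D : set T) (f g : T -> R) :
  measurable_fun D f -> measurable_fun D g ->
  measurable_fun D (fun x => Complex (f x) (g x)).
Proof.
move=> mf mg.
have -> : (fun x => Complex (f x) (g x)) =
          @of_Re_Im R \o (fun x => (f x, g x)) by [].
apply: measurableT_comp; first exact: measurable_of_Re_Im.
exact: measurable_fun_pair_in.
Qed.

Lemma measurable_complexP d (T : measurableType d) (D : set T) (f : T -> C) :
  measurable_fun D f <->
  measurable_fun D (@complex.Re R \o f) /\ measurable_fun D (@complex.Im R \o f).
Proof.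
split=> [mf|[mr mi]].
  by split; [exact: (measurableT_comp measurable_Re)
            |exact: (measurableT_comp measurable_Im)].
have -> : f = fun x => Complex (complex.Re (f x)) (complex.Im (f x)).
  by apply/funext => x; case: (f x).
exact: measurable_Complex.
Qed.

Section operations.
Context d (T : measurableType d) (D : set T).
Implicit Types f g : T -> C.

Lemma measurable_fun_addc f g : measurable_fun D f -> measurable_fun D g ->
  measurable_fun D (fun x => f x + g x).
Proof.
move=> /measurable_complexP[fr fi] /measurable_complexP[gr gi].
apply/measurable_complexP; split.
  apply: (eq_measurable_fun (fun x => complex.Re (f x) + complex.Re (g x))).
    by move=> x _ /=; case: (f x) (g x) => ? ? [].
  exact: measurable_funD.
apply: (eq_measurable_fun (fun x => complex.Im (f x) + complex.Im (g x))).
  by move=> x _ /=; case: (f x) (g x) => ? ? [].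
exact: measurable_funD.
Qed.

Lemma measurable_fun_mulc f g : measurable_fun D f -> measurable_fun D g ->
  measurable_fun D (fun x => f x * g x).
Proof.
move=> /measurable_complexP[fr fi] /measurable_complexP[gr gi].
apply/measurable_complexP; split.
  apply: (eq_measurable_fun (fun x => complex.Re (f x) * complex.Re (g x) -
                                      complex.Im (f x) * complex.Im (g x))).
    by move=> x _ /=; case: (f x) (g x) => ? ? [].
  by apply: measurable_funB; exact: measurable_funM.
apply: (eq_measurable_fun (fun x => complex.Re (f x) * complex.Im (g x) +
                                    complex.Im (f x) * complex.Re (g x))).
  by move=> x _ /=; case: (f x) (g x) => ? ? [].
by apply: measurable_funD; exact: measurable_funM.
Qed.

Lemma measurable_fun_oppc f : measurable_fun D f ->
  measurable_fun D (fun x => - f x).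
Proof.
move=> mf; under eq_fun do rewrite -mulN1r.
exact: (measurable_fun_mulc (measurable_cst _)).
Qed.

Lemma measurable_fun_subc f g : measurable_fun D f -> measurable_fun D g ->
  measurable_fun D (fun x => f x - g x).
Proof.
by move=> mf mg; apply: measurable_fun_addc => //; exact: measurable_fun_oppc.
Qed.

Lemma measurable_fun_conjc f : measurable_fun D f ->
  measurable_fun D (fun x => conjc (f x)).
Proof.
move=> /measurable_complexP[fr fi]; apply/measurable_complexP; split.
  by apply: (eq_measurable_fun (@complex.Re R \o f)) => // x _ /=; case: (f x).
apply: (eq_measurable_fun (fun x => - complex.Im (f x))).
  by move=> x _ /=; case: (f x).
exact: measurable_funN.
Qed.

Lemma measurable_fun_expc f n : measurable_fun D f ->
  measurable_fun D (fun x => f x ^+ n).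
Proof.
move=> mf; elim: n => [|n IHn]; first exact: measurable_cst.
by under eq_fun do rewrite exprS; exact: measurable_fun_mulc.
Qed.

Lemma measurable_fun_sumc (F : nat -> T -> C) n :
  (forall k, measurable_fun D (F k)) ->
  measurable_fun D (fun x => \sum_(0 <= k < n) F k x).
Proof.
move=> mF; elim: n => [|n IHn].
  by under eq_fun do rewrite big_nil; exact: measurable_cst.
under eq_fun do rewrite big_nat_recr//=.
exact: measurable_fun_addc.
Qed.

Lemma measurable_fun_normc f : measurable_fun D f ->
  measurable_fun D (fun x => normc (f x)).
Proof.
move=> /measurable_complexP[fr fi].
apply: (eq_measurable_fun (fun x => Num.sqrt (complex.Re (f x) ^+ 2 +
                                              complex.Im (f x) ^+ 2))).
  by move=> x _ /=; case: (f x).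
apply: measurableT_comp; first by apply: continuous_measurable_fun; exact: sqrt_continuous.
by apply: measurable_funD; exact: measurable_funX.
Qed.

End operations.

Lemma measurable_rect (A B : set R) : measurable A -> measurable B ->
  measurable [set z : C | A (complex.Re z) /\ B (complex.Im z)].
Proof.
move=> mA mB; exists (A `*` B); first exact: measurableX.
by rewrite setTI; apply/seteqP; split=> -[].
Qed.

Lemma measurable_complex1 (z : C) : measurable [set z].
Proof.
have -> : [set z] = [set w : C | [set complex.Re z] (complex.Re w) /\
                                 [set complex.Im z] (complex.Im w)].
  by apply/seteqP; split=> [w ->//|]; case: z => a b [c d] /= [-> ->].
by apply: measurable_rect; exact: measurable_set1.
Qed.

Lemma measurable_fun_eq0c d (T : measurableType d) (D : set T) (f : T -> C) :
  measurable D -> measurable_fun D f ->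
  measurable (D `&` [set x | f x = 0]).
Proof.
by move=> mD mf; exact: (mf mD [set 0] (measurable_complex1 0)).
Qed.

End complex_measurability.

(** * Lebesgue measure of the plane and rotations of a pair of Gaussians *)

Section density.
Local Open Scope ereal_scope.
Context d (T : measurableType d) (R : realType).
Variables (m mu : {measure set T -> \bar R}) (f : T -> R).
Hypotheses (f0 : forall x, (0 <= f x)%R) (mf : measurable_fun setT f).
Hypothesis mE : forall A, measurable A -> m A = \int[mu]_(x in A) (f x)%:E.

Import HBNNSimple.

Let ge0_integral_density_nnsfun (h : {nnsfun T >-> R}) :
  \int[m]_x (h x)%:E = \int[mu]_x ((h x)%:E * (f x)%:E).
Proof.
under [LHS]eq_integral do rewrite fimfunE -fsumEFin//.
rewrite ge0_integral_fsum//; last 2 first.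
- by move=> r; apply/measurable_EFinP; exact: measurable_funM.
- by move=> r x _; exact: nnfun_muleindic_ge0.
under [RHS]eq_integral => x _.
  rewrite fimfunE -fsumEFin// ge0_mule_fsuml; last first.
    by move=> y; exact: nnfun_muleindic_ge0.
  over.
rewrite ge0_integral_fsum//; last 2 first.
- move=> r; apply: emeasurable_funM; last exact/measurable_EFinP.
  by apply/measurable_EFinP; exact: measurable_funM.
- move=> r x _; apply: mule_ge0; first exact: nnfun_muleindic_ge0.
  by rewrite lee_fin.
apply: eq_fsbigr => r rh.
rewrite integralZl_indic_nnsfun// integral_indic// setIT mE//.
under [RHS]eq_integral do rewrite EFinM -muleA.
rewrite ge0_integralZl//.
- congr (_ * _); rewrite integral_mkcond; apply: eq_integral => x _.
  by rewrite patchE indicE; case: ifPn; rewrite ?mul1e ?mul0e.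
- apply: emeasurable_funM; last exact/measurable_EFinP.
  exact/measurable_EFinP.
- by move=> x _; rewrite mule_ge0 ?lee_fin.
- by rewrite lee_fin; move: rh; rewrite inE => -[x _ <-].
Qed.

Lemma ge0_integral_density (g : T -> \bar R) :
  (forall x, 0 <= g x) -> measurable_fun setT g ->
  \int[m]_x g x = \int[mu]_x (g x * (f x)%:E).
Proof.
move=> g0 mg; pose h := nnsfun_approx measurableT mg.
have hg x : (h n x)%:E @[n --> \oo] --> g x by exact: cvg_nnsfun_approx.
have -> : \int[m]_x g x = limn (fun n => \int[m]_x (h n x)%:E).
  rewrite -monotone_convergence//.
  - by apply: eq_integral => x _; apply/esym/cvg_lim => //; exact: hg.
  - by move=> n; exact/measurable_EFinP.
  - by move=> n x _; rewrite lee_fin.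
  - by move=> x _ a b ab; rewrite lee_fin; exact/lefP/nd_nnsfun_approx.
have -> : \int[mu]_x (g x * (f x)%:E) =
          limn (fun n => \int[mu]_x ((h n x)%:E * (f x)%:E)).
  rewrite -monotone_convergence//.
  - apply: eq_integral => x _; apply/esym/cvg_lim => //.
    by apply: cvgeZr => //; exact: hg.
  - by move=> n; apply: emeasurable_funM; exact/measurable_EFinP.
  - by move=> n x _; rewrite mule_ge0 ?lee_fin.
  - move=> x _ a b ab; rewrite lee_wpmul2r ?lee_fin//.
    exact/lefP/nd_nnsfun_approx.
by congr (limn _); apply/funext => n; exact: ge0_integral_density_nnsfun.
Qed.

End density.

Section plane_measure.
Context (R : realType).
Local Notation C := (R[i]).
Local Notation lebC := (@lebesgue_complex R).
Local Notation leb := (@lebesgue_measure R).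

Lemma lebesgue_measureD (t : R) (A : set R) : measurable A ->
  leb ((fun x => x + t) @^-1` A) = leb A.
Proof.
move=> mA.
have mt : measurable_fun setT (fun x : measurableTypeR R => x + t : measurableTypeR R).
  by apply: measurable_funD => //; exact: measurable_cst.
pose phi : {mfun (measurableTypeR R) >-> (measurableTypeR R)} :=
  HB.pack (fun x : measurableTypeR R => x + t : measurableTypeR R) (isMeasurableFun.Build _ _ _ _ _ mt).
apply/esym; apply: (@lebesgue_measure_unique _ (pushforward leb phi)) => //.
move=> _ [[a b]] _ <-; rewrite /pushforward.
transitivity (leb `](a - t), (b - t)]%classic); last first.
  congr (leb _); apply/seteqP; split=> x /=.
    by rewrite !in_itv/= ltrBlDr lerBrDr.
  by rewrite !in_itv/= ltrBlDr lerBrDr.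
rewrite [LHS]lebesgue_measure_itv/= [RHS]lebesgue_measure_itv/= !lte_fin ltrD2r.
by case: ifPn => // _; rewrite -!EFinB; congr EFin; ring.
Qed.

Lemma lebesgue_complexE (A : set C) :
  lebC A = (leb \x leb)%E (@of_Re_Im R @^-1` A).
Proof. by []. Qed.

Lemma lebesgue_complex_rect (A B : set R) : measurable A -> measurable B ->
  lebC [set z | A (complex.Re z) /\ B (complex.Im z)] = (leb A * leb B)%E.
Proof. by move=> mA mB; rewrite -product_measure1E. Qed.

Lemma lebesgue_complexD (t : C) (A : set C) : measurable A ->
  lebC ((fun z => z + t) @^-1` A) = lebC A.
Proof.
case: t => a b mA.
pose sh (p : measurableTypeR R * measurableTypeR R) :
  measurableTypeR R * measurableTypeR R := (p.1 + a, p.2 + b).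
have mt : measurable_fun setT sh.
  by apply: measurable_fun_pair; apply: measurable_funD => //; exact: measurable_cst.
pose phi : {mfun ((measurableTypeR R) * (measurableTypeR R))%type >-> ((measurableTypeR R) * (measurableTypeR R))%type} :=
  HB.pack sh (isMeasurableFun.Build _ _ _ _ _ mt).
have -> : lebC ((fun z => z + Complex a b) @^-1` A) =
    pushforward (leb \x leb)%E phi (@of_Re_Im R @^-1` A).
  by rewrite lebesgue_complexE /pushforward; congr ((leb \x leb)%E _).
rewrite lebesgue_complexE.
apply/esym; apply: product_measure_unique => [X Y mX mY|]; last first.
  by rewrite -[X in measurable X]setTI; exact: measurable_of_Re_Im.
transitivity ((leb \x leb)%E (((fun x => x + a) @^-1` X) `*`
                               ((fun x => x + b) @^-1` Y))); first by [].
have mp (s : R) (Z : set R) : measurable Z ->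
    measurable ((fun x : measurableTypeR R => x + s : measurableTypeR R) @^-1` Z).
  move=> mZ; rewrite -[X in measurable X]setTI.
  by apply: measurable_funD => //; exact: measurable_cst.
rewrite [LHS]product_measure1E; [|exact: mp|exact: mp].
by congr (_ * _)%E; exact: lebesgue_measureD.
Qed.

Let lebesgue_complex_sigma_finite : sigma_finite setT lebC.
Proof.
pose I (n : nat) : set R := `[- n%:R, n%:R]%classic.
have mI n : measurable (I n) by exact: measurable_itv.
exists (fun n => [set z | I n (complex.Re z) /\ I n (complex.Im z)]).
  apply/esym/seteqP; split=> // -[x y] _.
  exists (Num.truncn (Num.max `|x| `|y|)).+1 => //=.
  have lt_n (r : R) : `|r| <= Num.max `|x| `|y| ->
      I (Num.truncn (Num.max `|x| `|y|)).+1 r.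
    move=> rm; rewrite /I /= in_itv/= -ler_norml.
    by rewrite (le_trans rm)// ltW// truncnS_gt.
  by split; apply: lt_n; rewrite le_max lexx ?orbT.
move=> n; split; first exact: measurable_rect.
rewrite lebesgue_complex_rect// /I lebesgue_measure_itv/=.
by case: ifPn => _; rewrite ?mul0e// -EFinB -EFinM ltry.
Qed.

HB.instance Definition _ := Measure_isSigmaFinite.Build _ _ _ lebC
  lebesgue_complex_sigma_finite.

Lemma measurable_fun_translatec (t : C) : measurable_fun setT (fun z : C => z + t).
Proof. by apply: measurable_fun_addc => //; exact: measurable_cst. Qed.

Lemma ge0_integral_complexD (f : C -> \bar R) (t : C) :
  measurable_fun setT f -> (forall z, 0 <= f z)%E ->
  (\int[lebC]_z f (z + t)%R = \int[lebC]_z f z)%E.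
Proof.
move=> mf f0.
have := @ge0_integral_pushforward _ _ C C R _ (measurable_fun_translatec t)
  lebC setT f measurableT mf (fun z _ => f0 z).
rewrite preimage_setT => <-.
apply: eq_measure_integral => [|mphi A mA _].
  exact: measurable_fun_translatec.
exact: lebesgue_complexD.
Qed.

End plane_measure.

Section plane_rotation.
Context (R : realType).
Local Notation C := (R[i]).
Local Notation lebC := (@lebesgue_complex R).
Local Notation lebC2 := (product_measure1 lebC lebC).

Definition preserves_lebC2 (phi : C * C -> C * C) : Prop :=
  measurable_fun setT phi /\
  forall f : C * C -> \bar R, measurable_fun setT f -> (forall p, 0 <= f p)%E ->
    (\int[lebC2]_p f (phi p) = \int[lebC2]_p f p)%E.

Lemma preserves_lebC2_comp phi psi : preserves_lebC2 phi ->
  preserves_lebC2 psi -> preserves_lebC2 (phi \o psi).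
Proof.
move=> [mphi phiP] [mpsi psiP]; split; first exact: measurableT_comp.
move=> f mf f0; transitivity (\int[lebC2]_p f (phi p))%E; last exact: phiP.
by apply: (psiP (f \o phi)) => [|p]; [exact: (measurableT_comp mf mphi)|exact: f0].
Qed.

Let lebC2_integral1 (f : C * C -> \bar R) : measurable_fun setT f ->
  (forall p, 0 <= f p)%E ->
  (\int[lebC2]_p f p = \int[lebC]_z \int[lebC]_w f (z, w))%E.
Proof. by move=> mf f0; exact: (fubini_tonelli1 f mf f0). Qed.

Let lebC2_integral2 (f : C * C -> \bar R) : measurable_fun setT f ->
  (forall p, 0 <= f p)%E ->
  (\int[lebC2]_p f p = \int[lebC]_w \int[lebC]_z f (z, w))%E.
Proof.
move=> mf f0; apply: (etrans (lebC2_integral1 mf f0)).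
exact: (fubini_tonelli f mf f0).
Qed.

Lemma preserves_lebC2_shear1 (t : C) :
  preserves_lebC2 (fun p => (p.1 + t * p.2, p.2)).
Proof.
have mphi : measurable_fun setT (fun p : C * C => (p.1 + t * p.2, p.2)).
  apply: measurable_fun_pair; last exact: measurable_snd.
  apply: measurable_fun_addc; first exact: measurable_fst.
  by apply: measurable_fun_mulc; [exact: measurable_cst|exact: measurable_snd].
split=> // f mf f0.
apply: (etrans (lebC2_integral2 (measurableT_comp mf mphi) (fun p => f0 _))).
apply: (etrans _ (esym (lebC2_integral2 mf f0))).
apply: eq_integral => w _.
apply: (@ge0_integral_complexD R (fun z => f (z, w)) (t * w)) => //.
exact: measurable_fun_pair1.
Qed.

Lemma preserves_lebC2_shear2 (t : C) :
  preserves_lebC2 (fun p => (p.1, p.2 + t * p.1)).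
Proof.
have mphi : measurable_fun setT (fun p : C * C => (p.1, p.2 + t * p.1)).
  apply: measurable_fun_pair; first exact: measurable_fst.
  apply: measurable_fun_addc; first exact: measurable_snd.
  by apply: measurable_fun_mulc; [exact: measurable_cst|exact: measurable_fst].
split=> // f mf f0.
apply: (etrans (lebC2_integral1 (measurableT_comp mf mphi) (fun p => f0 _))).
apply: (etrans _ (esym (lebC2_integral1 mf f0))).
apply: eq_integral => z _.
apply: (@ge0_integral_complexD R (fun w => f (z, w)) (t * z)) => //.
exact: measurable_fun_pair2.
Qed.

(** A rotation other than the identity is a product of three shears, and a shear
    translates one coordinate once the other is fixed. *)
Lemma preserves_lebC2_rotation (k u : C) : k ^+ 2 + u * conjc u = 1 ->
  (u = 0 -> k = 1) ->
  preserves_lebC2 (fun p => (k * p.1 - u * p.2, conjc u * p.1 + k * p.2)).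
Proof.
move=> kuE u0k; have [u0|u0] := eqVneq u 0.
  rewrite (_ : (fun p => _) = id); last first.
    apply/funext => -[z w] /=.
    by rewrite u0 (u0k u0) conjc0 !mul0r !mul1r subr0 add0r.
  by split.
have cu0 : conjc u != 0 by rewrite conjc_eq0.
pose x := (k - 1) / conjc u.
have xu : x * conjc u = k - 1 by rewrite /x divfK.
have xk : x * (1 + k) = - u.
  apply: (mulfI cu0); rewrite mulrA [conjc u * x]mulrC xu.
  have -> : (k - 1) * (1 + k) = k ^+ 2 - 1 by ring.
  by rewrite -kuE; ring.
rewrite (_ : (fun p => _) = (fun p : C * C => (p.1 + x * p.2, p.2)) \o
  ((fun p : C * C => (p.1, p.2 + conjc u * p.1)) \o (fun p : C * C => (p.1 + x * p.2, p.2)))).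
  apply: preserves_lebC2_comp; first exact: preserves_lebC2_shear1.
  apply: preserves_lebC2_comp; last exact: preserves_lebC2_shear1.
  exact: preserves_lebC2_shear2.
apply/funext => -[z w] /=; congr pair.
  transitivity (z * (1 + x * conjc u) + w * (x * (1 + (1 + x * conjc u)))); last by ring.
  by rewrite xu addrCA subrr addr0 xk; ring.
transitivity (conjc u * z + (1 + x * conjc u) * w); last by ring.
by rewrite xu addrCA subrr addr0.
Qed.

End plane_rotation.

Section gaussian.
Context (R : realType).
Local Notation C := (R[i]).
Local Notation lebC := (@lebesgue_complex R).
Local Notation normc := (@Normc.normc R).

Definition gauss_density (z : C) : R := pi^-1 * expR (- normc z ^+ 2).

Lemma gauss_density_gt0 z : 0 < gauss_density z.
Proof. by rewrite mulr_gt0 ?invr_gt0 ?pi_gt0 ?expR_gt0. Qed.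

Lemma gauss_density_ge0 z : 0 <= gauss_density z.
Proof. exact/ltW/gauss_density_gt0. Qed.

Lemma measurable_gauss_density : measurable_fun setT gauss_density.
Proof.
apply: measurable_funM; first exact: measurable_cst.
apply: measurableT_comp; first exact: measurable_expR.
apply: measurable_funN; apply: measurable_funX.
by apply: measurable_fun_normc; exact: measurable_id.
Qed.

Lemma normc_sqr (z : C) : ((normc z ^+ 2)%:C)%C = z * conjc z.
Proof.
case: z => x y; rewrite /Normc.normc sqr_sqrtr ?addr_ge0 ?sqr_ge0//.
by apply/eqP; rewrite eq_complex/=; apply/andP; split; apply/eqP; ring.
Qed.

Lemma normc_rotation (k : R) (u z w : C) :
  k ^+ 2 + normc u ^+ 2 = 1 ->
  normc ((k%:C)%C * z - u * w) ^+ 2 + normc (conjc u * z + (k%:C)%C * w) ^+ 2 =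
  normc z ^+ 2 + normc w ^+ 2.
Proof.
case: u z w => [a b] [x y] [s t]; rewrite /= !sqr_sqrtr ?addr_ge0 ?sqr_ge0//.
move=> H; transitivity ((k ^+ 2 + (a ^+ 2 + b ^+ 2)) * (x ^+ 2 + y ^+ 2) +
                        (k ^+ 2 + (a ^+ 2 + b ^+ 2)) * (s ^+ 2 + t ^+ 2)).
  by ring.
by rewrite H !mul1r.
Qed.

Variable nu : probability C R.
Hypothesis nuE : forall A : set C, measurable A ->
  nu A = (\int[lebC]_(z in A) (gauss_density z)%:E)%E.

Lemma gauss_null (A : set C) : measurable A -> nu A = 0%E <-> lebC A = 0%E.
Proof.
move=> mA; rewrite nuE//.
have mf : measurable_fun A (EFin \o gauss_density).
  by apply/measurable_EFinP; apply: measurable_funTS; exact: measurable_gauss_density.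
have <- : (\int[lebC]_(z in A) `|(EFin \o gauss_density) z| =
           \int[lebC]_(z in A) (gauss_density z)%:E)%E.
  by apply: eq_integral => z _; rewrite /= ger0_norm// gauss_density_ge0.
split=> [|A0]; last exact: integral_abs_eq0.
move=> /(ae_eq_integral_abs lebC mA mf)[N [mN N0 AN]].
apply/negligibleP => //; exists N; split=> // z Az.
apply: AN => /= /(_ Az)/eqP; rewrite eqe gt_eqF//; exact: gauss_density_gt0.
Qed.

Lemma gauss_integral2 (f : C * C -> \bar R) : measurable_fun setT f ->
  (forall p, 0 <= f p)%E ->
  (\int[nu]_z \int[nu]_w f (z, w) = \int[product_measure1 lebC lebC]_p
     (f p * (gauss_density p.2)%:E * (gauss_density p.1)%:E))%E.
Proof.
move=> mf f0.
have mg : measurable_fun setT (fun p : C * C => f p * (gauss_density p.2)%:E)%E.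
  apply: emeasurable_funM => //; apply/measurable_EFinP.
  exact: (measurableT_comp measurable_gauss_density measurable_snd).
have g0 p : (0 <= f p * (gauss_density p.2)%:E)%E.
  by rewrite mule_ge0// lee_fin gauss_density_ge0.
have inner z : (\int[nu]_w f (z, w) =
    \int[lebC]_w (f (z, w) * (gauss_density w)%:E))%E.
  apply: (ge0_integral_density gauss_density_ge0 measurable_gauss_density nuE) => //.
  exact: measurable_fun_pair2.
under [LHS]eq_integral do rewrite inner.
rewrite (ge0_integral_density gauss_density_ge0 measurable_gauss_density nuE);
  last 2 first.
- by move=> z; apply: integral_ge0 => w _; exact: (g0 (z, w)).
- exact: (measurable_fun_fubini_tonelli_F (fun p : C * C => f p * (gauss_density p.2)%:E)%E).
have mh : measurable_fun setT (fun p : C * C =>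
    f p * (gauss_density p.2)%:E * (gauss_density p.1)%:E)%E.
  apply: emeasurable_funM => //; apply/measurable_EFinP.
  exact: (measurableT_comp measurable_gauss_density measurable_fst).
have h0 p : (0 <= f p * (gauss_density p.2)%:E * (gauss_density p.1)%:E)%E.
  by rewrite mule_ge0// lee_fin gauss_density_ge0.
apply: (etrans _ (esym (fubini_tonelli1 _ mh h0))).
apply: eq_integral => z _; rewrite /fubini_F /= ge0_integralZr//.
- exact: (measurable_fun_pair2 z mg).
- by rewrite lee_fin gauss_density_ge0.
Qed.

(** The Gaussian density of a pair depends on the squared norm of the pair
    only, which a unitary map preserves. *)
Lemma gauss_rotation (k : R) (u : C) (f : C * C -> \bar R) :
  0 <= k -> k ^+ 2 + normc u ^+ 2 = 1 ->
  measurable_fun setT f -> (forall p, 0 <= f p)%E ->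
  (\int[nu]_z \int[nu]_w f (((k%:C)%C * z - u * w)%R, (conjc u * z + (k%:C)%C * w)%R) =
   \int[nu]_z \int[nu]_w f (z, w))%E.
Proof.
move=> k0 ku mf f0.
have [mrho rhoP] : preserves_lebC2 (fun p : C * C =>
    ((k%:C)%C * p.1 - u * p.2, conjc u * p.1 + (k%:C)%C * p.2)).
  apply: preserves_lebC2_rotation.
    by rewrite -normc_sqr -!rmorphXn -rmorphD/= ku.
  move=> u0; suff -> : k = 1 by [].
  move: ku; rewrite u0 Normc.normc0 expr0n addr0 => /eqP.
  by rewrite sqrf_eq1 => /orP[/eqP//|/eqP k1]; move: k0; rewrite k1 oppr_ge0 ler10.
rewrite (gauss_integral2 (measurableT_comp mf mrho)); last by move=> p; exact: f0.
rewrite gauss_integral2//.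
rewrite -(rhoP (fun p => f p * (gauss_density p.2)%:E * (gauss_density p.1)%:E)%E).
- apply: eq_integral => -[z w] _ /=; rewrite -!muleA -!EFinM; congr (_ * _%:E)%E.
  rewrite /gauss_density [LHS]mulrACA [RHS]mulrACA -!expRD -!opprD.
  by congr (_ * expR (- _)); rewrite [RHS]addrC normc_rotation// addrC.
- apply: emeasurable_funM.
    apply: emeasurable_funM => //; apply/measurable_EFinP.
    exact: (measurableT_comp measurable_gauss_density measurable_snd).
  apply/measurable_EFinP.
  exact: (measurableT_comp measurable_gauss_density measurable_fst).
- by move=> p; rewrite !mule_ge0// lee_fin gauss_density_ge0.
Qed.

End gaussian.

(** * Lipschitz images of null sets of the plane *)

Section null_sets.
Context (R : realType).
Local Notation C := (R[i]).
Local Notation lebC := (@lebesgue_complex R).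
Local Notation normc := (@Normc.normc R).
Local Notation Re := (@complex.Re R).
Local Notation Im := (@complex.Im R).

Lemma normr_Re_le (z : C) : `|Re z| <= normc z.
Proof. by case: z => x y /=; rewrite -sqrtr_sqr ler_wsqrtr// lerDl sqr_ge0. Qed.

Lemma normr_Im_le (z : C) : `|Im z| <= normc z.
Proof. by case: z => x y /=; rewrite -sqrtr_sqr ler_wsqrtr// lerDr sqr_ge0. Qed.

Lemma normc_le (z : C) : normc z <= `|Re z| + `|Im z|.
Proof.
case: z => x y /=; rewrite -[leRHS]ger0_norm ?addr_ge0//.
rewrite -sqrtr_sqr ler_wsqrtr// sqrrD !real_normK ?num_real//.
by rewrite addrAC lerDl mulrn_wge0// mulr_ge0.
Qed.

Lemma normc_ge0 (z : C) : 0 <= normc z.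
Proof. by case: z => x y; exact: sqrtr_ge0. Qed.

Definition dyadic_index (n : nat) (z : C) : int * int :=
  (Num.floor (2 ^+ n * Re z), Num.floor (2 ^+ n * Im z)).

Definition dyadic_cell (n : nat) (ij : int * int) : set C :=
  [set z | dyadic_index n z = ij].

Let dyadic_side (n : nat) (i : int) : set R :=
  `[i%:~R / 2 ^+ n, (i + 1)%:~R / 2 ^+ n[%classic.

Let pow2_gt0 n : 0 < 2 ^+ n :> R.
Proof. by rewrite exprn_gt0. Qed.

Let dyadic_sideE n (x : R) i : Num.floor (2 ^+ n * x) = i <-> dyadic_side n i x.
Proof.
rewrite /dyadic_side /= in_itv/= ler_pdivrMr// ltr_pdivlMr// mulrC.
split=> [<-|/andP[ix xi]]; first by rewrite ge_floor floorD1_gt.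
by apply/floor_def; rewrite ix xi.
Qed.

Let dyadic_cellE n ij : dyadic_cell n ij =
  [set z | dyadic_side n ij.1 (Re z) /\ dyadic_side n ij.2 (Im z)].
Proof.
case: ij => i j; apply/seteqP; split=> z /=.
  by case=> /dyadic_sideE ? /dyadic_sideE.
by case=> /dyadic_sideE iE /dyadic_sideE jE; rewrite /dyadic_cell/= /dyadic_index iE jE.
Qed.

Lemma measurable_dyadic_cell n ij : measurable (dyadic_cell n ij).
Proof. by rewrite dyadic_cellE; apply: measurable_rect; exact: measurable_itv. Qed.

Lemma lebesgue_dyadic_cell n ij :
  lebC (dyadic_cell n ij) = ((2 ^+ n)^-1 ^+ 2)%:E.
Proof.
have side i : lebesgue_measure (dyadic_side n i) = ((2 ^+ n)^-1)%:E.
  rewrite lebesgue_measure_itv/= lte_fin ltr_pM2r ?invr_gt0//.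
  rewrite ltr_int ltzD1 lexx -EFinB; congr EFin.
  by rewrite -mulrBl intrD addrAC subrr add0r mul1r.
rewrite dyadic_cellE lebesgue_complex_rect; [|exact: measurable_itv..].
by rewrite expr2 EFinM; congr (_ * _)%E; exact: side.
Qed.

Lemma dyadic_index_dist n (z w : C) : dyadic_index n z = dyadic_index n w ->
  normc (z - w) <= 2 * (2 ^+ n)^-1.
Proof.
have dist (x y : R) : Num.floor (2 ^+ n * x) = Num.floor (2 ^+ n * y) ->
    `|x - y| <= (2 ^+ n)^-1.
  move=> xy; rewrite -[leRHS]mulr1 -ler_pdivrMl// invrK.
  rewrite -[2 ^+ n]gtr0_norm// -normrM mulrBr ler_norml.
  have := ge_floor (2 ^+ n * x); have := floorD1_gt (2 ^+ n * x).
  have := ge_floor (2 ^+ n * y); have := floorD1_gt (2 ^+ n * y).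
  rewrite xy intrD /=; set a := _ * x; set b := _ * y; set c := (Num.floor _)%:~R.
  by move=> *; apply/andP; split; lra.
case=> /dist zr /dist zi; apply: (le_trans (normc_le _)); rewrite mulr2n mulrDl mul1r.
by case: z w zr zi => [a b] [c d] /= *; exact: lerD.
Qed.

Lemma dyadic_index_refine n (z w : C) :
  dyadic_index n.+1 z = dyadic_index n.+1 w -> dyadic_index n z = dyadic_index n w.
Proof.
have half (x y : R) : Num.floor (2 * x) = Num.floor (2 * y) ->
    Num.floor x = Num.floor y.
  have mono (s t : R) : Num.floor s < Num.floor t ->
      Num.floor (2 * s) < Num.floor (2 * t).
    move=> st; rewrite -(ltr_int R).
    apply: (le_lt_trans (ge_floor _)).
    have s1 := floorD1_gt s; have := st; rewrite -lezD1 -(ler_int R) => s1t.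
    have := floorD1_gt (2 * t).
    have : (2 * Num.floor t <= Num.floor (2 * t))%R.
      by rewrite real_floor_ge_int ?num_real// intrM ler_pM2l// ge_floor.
    rewrite -(ler_int R) intrM => tt _.
    by apply: lt_le_trans tt; rewrite ltr_pM2l//; exact: lt_le_trans s1 s1t.
  move=> xy; apply/eqP; rewrite eq_le !leNgt.
  by apply/andP; split; apply/negP => /mono; rewrite xy ltxx.
by rewrite /dyadic_index !exprS -!mulrA => -[/half -> /half ->].
Qed.

Lemma dyadic_index_le n m (z w : C) : (n <= m)%N ->
  dyadic_index m z = dyadic_index m w -> dyadic_index n z = dyadic_index n w.
Proof.
move=> /subnK <-; elim: (m - n)%N => // k IHk.
by rewrite addSn => /dyadic_index_refine/IHk.
Qed.

(** Open sets of the topology generated by the dyadic cells. Every such set is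
    a union of cells, and cells of one level are disjoint, so that the measure
    of such a set is easily compared with that of its images. *)
Definition dyadic_open (O : set C) : Prop :=
  forall z, O z -> exists n, dyadic_cell n (dyadic_index n z) `<=` O.

Definition dyadic_part (O : set C) (n : nat) : set C :=
  [set z | dyadic_cell n (dyadic_index n z) `<=` O].

Lemma dyadic_part_sub O n : dyadic_part O n `<=` O.
Proof. by move=> z; apply. Qed.

Lemma dyadic_part_nd O n m : (n <= m)%N -> dyadic_part O n `<=` dyadic_part O m.
Proof.
move=> nm z zO w /= wz; apply: zO; rewrite /dyadic_cell/=.
exact: dyadic_index_le nm wz.
Qed.

Definition dyadic_enum (n : nat) (O : set C) (k : nat) : set C :=
  if pickle_inv k is Some ij then
    if `[< dyadic_cell n ij `<=` O >] then dyadic_cell n ij else set0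
  else set0.

Lemma measurable_dyadic_enum n O k : measurable (dyadic_enum n O k).
Proof.
rewrite /dyadic_enum; case: (pickle_inv k) => // ij; case: asboolP => // _.
exact: measurable_dyadic_cell.
Qed.

Lemma trivIset_dyadic_enum n O : trivIset setT (dyadic_enum n O).
Proof.
apply/trivIsetP => k l _ _ kl; apply/seteqP; split=> // z [].
rewrite /dyadic_enum.
case Ek: (pickle_inv k) => [ij|//]; case: asboolP => // _ zij.
case El: (pickle_inv l) => [ij'|//]; case: asboolP => // _ zij'.
have := @pickle_invK (int * int)%type k; have := @pickle_invK (int * int)%type l.
rewrite Ek El /= => lE kE; move: kl.
by rewrite -lE -kE -zij -zij' eqxx.
Qed.

Lemma dyadic_partE O n : dyadic_part O n = \bigcup_k dyadic_enum n O k.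
Proof.
apply/seteqP; split=> [z zO|z [k _]].
  have [k Ek] : exists k, pickle_inv k = Some (dyadic_index n z).
    by eexists; exact: pickleK_inv.
  by exists k; rewrite // /dyadic_enum Ek; case: asboolP => // -[].
rewrite /dyadic_enum; case: (pickle_inv k) => [ij|//]; case: asboolP => // ijO zij.
by rewrite /dyadic_part/= zij.
Qed.

Lemma measurable_dyadic_part O n : measurable (dyadic_part O n).
Proof.
by rewrite dyadic_partE; apply: bigcup_measurable => k _; exact: measurable_dyadic_enum.
Qed.

Lemma dyadic_openE O : dyadic_open O -> O = \bigcup_n dyadic_part O n.
Proof.
move=> oO; apply/seteqP; split=> [z /oO[n zn]|z [n _ /dyadic_part_sub//]].
by exists n.
Qed.

Lemma measurable_dyadic_open O : dyadic_open O -> measurable O.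
Proof.
move=> /dyadic_openE ->; apply: bigcup_measurable => n _.
exact: measurable_dyadic_part.
Qed.

Lemma dyadic_open_bigcup (I : Type) (P : set I) (F : I -> set C) :
  (forall i, P i -> dyadic_open (F i)) -> dyadic_open (\bigcup_(i in P) F i).
Proof.
move=> oF z [i Pi Fiz]; have [n zn] := oF i Pi z Fiz.
by exists n => w /zn Fiw; exists i.
Qed.

Lemma dyadic_openI (A B : set C) : dyadic_open A -> dyadic_open B ->
  dyadic_open (A `&` B).
Proof.
move=> oA oB z [/oA[n nA] /oB[m mB]]; exists (maxn n m) => w wz; split.
  by apply: nA; exact: dyadic_index_le (leq_maxl n m) wz.
by apply: mB; exact: dyadic_index_le (leq_maxr n m) wz.
Qed.

Lemma dyadic_open_bigcap n (F : nat -> set C) :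
  (forall i, dyadic_open (F i)) -> dyadic_open (\bigcap_(i < n) F i).
Proof.
move=> oF; elim: n => [|n IHn].
  by rewrite bigcap_mkord big_ord0 => z _; exists 0%N.
rewrite bigcap_mkord big_ord_recr/= -bigcap_mkord.
exact: dyadic_openI.
Qed.

Lemma dyadic_open_half (f : C -> R) (x : R) (b : bool) :
  (forall z w, `|f z - f w| <= normc (z - w)) ->
  dyadic_open [set z | (-1) ^+ b * f z < x].
Proof.
move=> fL z /= zx; have e0 : 0 < x - (-1) ^+ b * f z by rewrite subr_gt0.
have [n _ ne] : exists2 n, True & 2 * (2 ^+ n)^-1 < x - (-1) ^+ b * f z.
  pose e := x - (-1) ^+ b * f z; pose n := (Num.truncn (2 / e)).+1.
  exists n => //; rewrite ltr_pdivrMr// mulrC -ltr_pdivrMr//.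
  by rewrite (lt_trans (truncnS_gt _))// -natrX ltr_nat ltn_expl.
exists n => w /= wz.
have := le_lt_trans (le_trans (fL w z) (dyadic_index_dist wz)) ne.
by case: b {zx e0 ne} => /=; rewrite ?expr1 ?expr0 ?mulN1r ?mul1r ltr_norml => /andP[]; lra.
Qed.

End null_sets.

Section dyadic_regularity.
Context (R : realType).
Local Notation C := (R[i]).
Local Notation lebC := (@lebesgue_complex R).
Local Notation normc := (@Normc.normc R).
Local Notation Re := (@complex.Re R).
Local Notation Im := (@complex.Im R).

Lemma nonincreasing_measure_lt d (T : measurableType d)
    (mu : {measure set T -> \bar R}) (F : (set T)^nat) (e : \bar R) :
  (mu (F 0%N) < +oo)%E -> (forall n, measurable (F n)) ->
  nonincreasing_seq F -> (mu (\bigcap_n F n) < e)%E ->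
  exists n, (mu (F n) < e)%E.
Proof.
move=> F0 mF ndF; apply: contraPP => /forallNP Fe; apply/negP; rewrite -leNgt.
have cF : mu \o F @ \oo --> mu (\bigcap_n F n).
  by apply: nonincreasing_cvg_mu => //; exact: bigcapT_measurable.
rewrite -(cvg_lim _ cF)//; apply: lime_ge; first by apply/cvg_ex; eexists; exact: cF.
by apply: nearW => n /=; rewrite leNgt; apply/negP/Fe.
Qed.

Section finite_measure.
Variable mu : {measure set C -> \bar R}.
Hypothesis muoo : (mu setT < +oo)%E.

(** Outer regularity of [A] and of its complement at once, which makes the
    property symmetric under complement. *)
Definition dyadic_regular (A : set C) : Prop := forall e : R, 0 < e ->
  exists U V : set C, [/\ dyadic_open U, dyadic_open V, A `<=` U, ~` A `<=` V &
    (mu (U `&` V) <= e%:E)%E].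

Let mu_fin (A : set C) : measurable A -> (mu A < +oo)%E.
Proof.
move=> mA; apply: le_lt_trans muoo; apply: le_measure; rewrite ?inE//.
Qed.

Lemma dyadic_regularC A : dyadic_regular A -> dyadic_regular (~` A).
Proof.
move=> rA e /rA[U [V [oU oV AU AV UV]]]; exists V, U.
by split; rewrite ?setCK// setIC.
Qed.

Lemma dyadic_regular_bigcup (F : nat -> set C) :
  (forall n, dyadic_regular (F n)) -> dyadic_regular (\bigcup_n F n).
Proof.
move=> rF e e0.
have e20 n : 0 < e / 2 / (2 ^ n.+1)%:R by rewrite !divr_gt0// ltr0n expn_gt0.
have /choice[ U] := fun n => rF n _ (e20 n).
move=> /choice[V OO'].
have oO n : dyadic_open (U n) by have [] := OO' n.
have oO' n : dyadic_open (V n) by have [] := OO' n.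
pose W := \bigcup_n U n.
have oU : dyadic_open W by apply: dyadic_open_bigcup => n _.
have mU := measurable_dyadic_open oU.
have mO n := measurable_dyadic_open (oO n).
have mO' n := measurable_dyadic_open (oO' n).
pose G n := W `&` \bigcap_(i < n) V i.
have oG n : dyadic_open (G n) by apply: dyadic_openI => //; exact: dyadic_open_bigcap.
have mG n := measurable_dyadic_open (oG n).
(* finitely many of the [V i] suffice, by continuity from above *)
have [N GN] : exists N, (mu (G N) < e%:E)%E.
  apply: nonincreasing_measure_lt => //; first exact: mu_fin.
    move=> n m nm; apply/subsetPset => z [Uz zO']; split=> // i /= im.
    by apply: zO' => /=; exact: leq_trans im nm.
  apply: (@le_lt_trans _ _ (e / 2)%:E); last by rewrite lte_fin ltr_pdivrMr// ltr_pMr// ltr1n.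
  apply: (@le_trans _ _ (\sum_(0 <= n <oo) mu (U n `&` V n))%E).
    apply: measure_sigma_subadditive.
    - by move=> n; exact: measurableI.
    - exact: bigcapT_measurable.
    - move=> z zG; have [[n _ Onz] _] := zG 0%N I; exists n => //; split=> //.
      by have [_ /(_ n)] := zG n.+1 I; apply => /=.
  apply: (@le_trans _ _ (\sum_(0 <= n <oo) (e / 2 / (2 ^ n.+1)%:R)%:E)%E).
    by apply: lee_nneseries => // n _; have [] := OO' n.
  by apply: epsilon_trick0; rewrite divr_ge0// ltW.
exists W, (\bigcap_(i < N) V i); split=> //.
- exact: dyadic_open_bigcap.
- by apply: subset_bigcup => n _; have [] := OO' n.
- move=> z zF i _; have [_ _ _ FO' _] := OO' i; apply: FO' => Fiz.
  by apply: zF; exists i.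
- exact: ltW.
Qed.

Lemma dyadic_regular_half (f : C -> R) (x : R) :
  (forall z w, `|f z - f w| <= normc (z - w)) ->
  dyadic_regular [set z | f z < x].
Proof.
move=> fL e e0.
have oA : dyadic_open [set z | f z < x].
  have := @dyadic_open_half R f x false fL.
  by rewrite expr0 (_ : [set z | _] = [set z | f z < x])//; under eq_fun do rewrite mul1r.
pose A' n := [set z | x - n.+1%:R^-1 < f z].
have oA' n : dyadic_open (A' n).
  have := @dyadic_open_half R f (n.+1%:R^-1 - x) true fL.
  rewrite (_ : [set z | _] = A' n)//; apply/seteqP.
  by split=> z; rewrite /A' /= expr1 mulN1r; move: (n.+1%:R^-1) => t ?; lra.
pose G n := [set z | f z < x] `&` A' n.
have mG n : measurable (G n) by apply: measurable_dyadic_open; exact: dyadic_openI.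
have [N GN] : exists N, (mu (G N) < e%:E)%E.
  apply: nonincreasing_measure_lt => //; first exact: mu_fin.
    move=> n m nm; apply/subsetPset => z [zx zA]; split=> //; move: zA.
    rewrite /A' /=; apply: le_lt_trans.
    by rewrite lerD2l lerN2 lef_pV2 ?posrE// ler_nat.
  rewrite (_ : \bigcap_n _ = set0) ?measure0 ?lte_fin//.
  apply/seteqP; split=> // z zG; have [/= zx _] := zG 0%N I.
  have d0 : 0 < x - f z by rewrite subr_gt0.
  have [n _ /(_ n (leqnn _)) nd] := near_infty_natSinv_lt (PosNum d0).
  by have [_ +] := zG n I; move: nd; rewrite /A' /=; move: (n.+1%:R^-1) => t ? ?; lra.
exists [set z | f z < x], (A' N); split=> //; last exact: ltW.
move=> z /= /negP; rewrite -leNgt /A' /=; apply: lt_le_trans.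
by rewrite ltrBlDr ltrDl.
Qed.

(** Regular sets form a sigma-algebra that contains the half planes
    [f z < x], for [f] the real or imaginary part: these are dyadic open, and
    their complements are intersections of the dyadic open sets
    [x - 1 / n < f z]. *)
Lemma dyadic_regularT A : measurable A -> dyadic_regular A.
Proof.
have r0 : dyadic_regular set0.
  move=> e e0; exists set0, setT; split=> //; last by rewrite set0I measure0 lee_fin ltW.
  by move=> z _; exists 0%N.
have sigma (T : pointedType) (h : C -> T) (G : set (set T)) :
    (forall B, G B -> dyadic_regular (h @^-1` B)) ->
    forall B, <<s G >> B -> dyadic_regular (h @^-1` B).
  move=> hG; apply: smallest_sub => //; split.
  - by rewrite /= preimage_set0.
  - by move=> B rB; rewrite setTD /= preimage_setC; exact: dyadic_regularC.
  - by move=> F rF; rewrite /= preimage_bigcup; exact: dyadic_regular_bigcup.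
have line (f : C -> R) : (forall z w, `|f z - f w| <= normc (z - w)) ->
    forall B : set R, measurable B -> dyadic_regular (f @^-1` B).
  move=> fL B mB; have {}mB : (@RGenInftyO.G R).-sigma.-measurable B.
    by rewrite -RGenInftyO.measurableE.
  apply: (@sigma R f (@RGenInftyO.G R)) => // _ [x ->].
  rewrite (_ : _ @^-1` _ = [set z | f z < x]); first exact: dyadic_regular_half.
  by apply/seteqP; split=> z /=; rewrite in_itv.
case=> B mB <-; rewrite setTI.
apply: (@sigma (R * R)%type (@Re_Im R) _ _ B mB) => _ [|] [D mD <-]; rewrite setTI.
- apply: line => // z w; apply: le_trans (normr_Re_le (z - w)).
  by case: z w => [? ?] [? ?].
- apply: line => // z w; apply: le_trans (normr_Im_le (z - w)).
  by case: z w => [? ?] [? ?].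
Qed.

End finite_measure.

Let box (M : nat) : set C :=
  [set z | `[- M%:R, M%:R]%classic (Re z) /\ `[- M%:R, M%:R]%classic (Im z)].

Let measurable_box M : measurable (box M).
Proof. by apply: measurable_rect; exact: measurable_itv. Qed.

Let box_fin M : (lebC (box M) < +oo)%E.
Proof.
rewrite lebesgue_complex_rect ?lebesgue_measure_itv//=; [|exact: measurable_itv..].
by case: ifPn => _; rewrite ?mul0e// -EFinB -EFinM ltry.
Qed.

(** The null set is covered in the interior of a larger square, where Lebesgue
    measure is finite. *)
Lemma dyadic_open_cover (M : nat) (N : set C) (e : R) : measurable N ->
  lebC N = 0%E -> N `<=` box M -> 0 < e ->
  exists2 U, dyadic_open U /\ N `<=` U & (lebC U <= e%:E)%E.
Proof.
move=> mN N0 NM e0.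
pose nu := mrestr lebC (measurable_box M.+1).
have nuoo : (nu setT < +oo)%E by rewrite /nu /mrestr setTI; exact: box_fin.
have [ U [ V [oO oO' NO NO' OO']]] := @dyadic_regularT nu nuoo N mN e e0.
have lip (f : C -> R) : f = Re \/ f = Im -> forall z w, `|f z - f w| <= normc (z - w).
  case=> -> z w; [apply: le_trans (normr_Re_le (z - w))|apply: le_trans (normr_Im_le (z - w))];
    by case: z w => [? ?] [? ?].
pose half (f : C -> R) (b : bool) := [set z : C | (-1) ^+ b * f z < M.+1%:R].
have ohalf f b : f = Re \/ f = Im -> dyadic_open (half f b).
  by move=> /lip; exact: dyadic_open_half.
pose B := (half Re false `&` half Re true) `&` (half Im false `&` half Im true).
have oB : dyadic_open B by do !apply: dyadic_openI; apply: ohalf; (left; reflexivity) || (right; reflexivity).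
exists (U `&` B).
  split; first exact: dyadic_openI.
  move=> z Nz; split; first exact: NO.
  have [] := NM z Nz; rewrite /= !in_itv/= => /andP[? ?] /andP[? ?].
  have M1 : M%:R < M.+1%:R :> R by rewrite ltr_nat.
  by do !split; rewrite /half/= ?expr0 ?expr1 ?mul1r ?mulN1r; lra.
have mO := measurable_dyadic_open oO; have mO' := measurable_dyadic_open oO'.
have mB := measurable_dyadic_open oB.
apply: (@le_trans _ _ (lebC ((U `&` V) `&` box M.+1 `|` N))); last first.
  apply: (@le_trans _ _ (lebC ((U `&` V) `&` box M.+1) + lebC N)%E).
    by apply: measureU2 => //; apply: measurableI => //; exact: measurableI.
  by rewrite N0 adde0.
apply: le_measure; rewrite ?inE.
- exact: measurableI.
- by apply: measurableU => //; apply: measurableI => //; exact: measurableI.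
- move=> z [Oz Bz]; have [Nz|/NO' Vz] := pselect (N z); [by right|left].
  split=> //; move: Bz; rewrite /B /half /box /= !expr0 !expr1 !mul1r !mulN1r !in_itv/=.
  by move=> [[? ?] [? ?]]; split; apply/andP; split; lra.
Qed.

End dyadic_regularity.

Section lipschitz_null.
Context (R : realType).
Local Notation C := (R[i]).
Local Notation lebC := (@lebesgue_complex R).
Local Notation normc := (@Normc.normc R).
Local Notation Re := (@complex.Re R).
Local Notation Im := (@complex.Im R).

Lemma negligible_small (mu : {measure set C -> \bar R}) (A : set C) (k : R) :
  (forall e : R, 0 < e -> exists2 V, measurable V /\ A `<=` V &
    (mu V <= (k * e)%:E)%E) -> mu.-negligible A.
Proof.
move=> AV.
have /choice[V VP] : forall n, exists V, [/\ measurable V, A `<=` V &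
    (mu V <= (k * n.+1%:R^-1)%:E)%E].
  by move=> n; have [|V [mV AV'] muV] := AV n.+1%:R^-1; [by []|exists V].
have mV : measurable (\bigcap_n V n).
  by apply: bigcapT_measurable => n; have [] := VP n.
exists (\bigcap_n V n); split=> //; last by move=> z Az n _; have [_ + _] := VP n; exact.
apply/eqP; rewrite -measure_le0; apply/lee_addgt0Pr => e e0; rewrite add0e.
have ke : 0 < e / (`|k| + 1) by rewrite divr_gt0// ltr_wpDl.
have [n _ /(_ n (leqnn _)) /= nk] := near_infty_natSinv_lt (PosNum ke).
have [mVn _ muVn] := VP n.
apply: (@le_trans _ _ (mu (V n))); first by apply: le_measure; rewrite ?inE// => z /(_ n I).
apply: le_trans muVn _; rewrite lee_fin.
have k1 : 0 < `|k| + 1 by rewrite ltr_wpDl.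
apply: (@le_trans _ _ ((`|k| + 1) * n.+1%:R^-1)).
  by rewrite ler_wpM2r// (le_trans (ler_norm _))// lerDl.
by rewrite mulrC -ler_pdivlMr// ltW.
Qed.

Let box (M : nat) : set C :=
  [set z | `[- M%:R, M%:R]%classic (Re z) /\ `[- M%:R, M%:R]%classic (Im z)].

Let square (c : C) (r : R) : set C :=
  [set z | `[Re c - r, Re c + r]%classic (Re z) /\
           `[Im c - r, Im c + r]%classic (Im z)].

Let measurable_square c r : measurable (square c r).
Proof. by apply: measurable_rect; exact: measurable_itv. Qed.

Let lebesgue_square c r : 0 <= r -> lebC (square c r) = (4 * r ^+ 2)%:E.
Proof.
move=> r0; have side (x : R) : lebesgue_measure `[x - r, x + r]%classic = (2 * r)%:E.
  rewrite lebesgue_measure_itv/= lte_fin; case: ifPn => xr.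
    by rewrite -EFinB; congr EFin; ring.
  by move: xr; rewrite -leNgt => xr; congr EFin; lra.
rewrite lebesgue_complex_rect; [|exact: measurable_itv..].
by rewrite !side -EFinM; congr EFin; ring.
Qed.

Let mem_square c r z : normc (z - c) <= r -> square c r z.
Proof.
move=> zc; have := le_trans (normr_Re_le _) zc; have := le_trans (normr_Im_le _) zc.
case: c z zc => [a b] [x y] _ /=; rewrite !ler_norml => /andP[? ?] /andP[? ?].
by rewrite /square/= !in_itv/=; split; apply/andP; split; lra.
Qed.

Lemma lipschitz_null_bounded (M : nat) (T : Type) (X : set T) (f g : T -> C)
    (K : R) (N : set C) : measurable N -> lebC N = 0%E -> N `<=` box M ->
  (forall x, X x -> N (g x)) -> 0 <= K ->
  (forall x y, X x -> X y -> normc (f x - f y) <= K * normc (g x - g y)) ->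
  lebC.-negligible (f @` X).
Proof.
move=> mN N0 NM XN K0 fgK.
apply: (@negligible_small _ _ (16 * K ^+ 2)) => e e0.
have [U [oU NU] Ue] := dyadic_open_cover mN N0 NM e0.
have mU := measurable_dyadic_open oU.
pose r n := K * (2 * (2 ^+ n)^-1).
have r0 n : 0 <= r n by rewrite mulr_ge0// mulr_ge0// invr_ge0 exprn_ge0.
(* S n k covers the image of the k-th cell of level n inside U *)
have /choice[S SP] : forall nk : nat * nat, exists S : set C,
    [/\ measurable S, (lebC S <= (16 * K ^+ 2)%:E * lebC (dyadic_enum nk.1 U nk.2))%E &
      forall x, X x -> dyadic_enum nk.1 U nk.2 (g x) -> S (f x)].
  move=> [n k] /=.
  have [[x0 [Xx0 gx0]]|noX] := pselect (exists x, X x /\ dyadic_enum n U k (g x)); last first.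
    exists set0; split=> //; first by rewrite measure0 mule_ge0// lee_fin mulr_ge0// sqr_ge0.
    by move=> x Xx gx; apply: noX; exists x.
  exists (square (f x0) (r n)); split=> //.
    rewrite lebesgue_square//.
    have -> : lebC (dyadic_enum n U k) = ((2 ^+ n)^-1 ^+ 2)%:E.
      move: gx0; rewrite /dyadic_enum; case: (pickle_inv k) => // ij.
      by case: asboolP => // _ _; exact: lebesgue_dyadic_cell.
    by rewrite -EFinM lee_fin /r !exprMn le_eqVlt; apply/orP; left; apply/eqP; ring.
  move=> x Xx gx; apply: mem_square.
  apply: le_trans (fgK x x0 Xx Xx0) _; rewrite /r ler_wpM2l//.
  apply: dyadic_index_dist; move: gx gx0; rewrite /dyadic_enum.
  by case: (pickle_inv k) => // ij; case: asboolP => // _; rewrite /dyadic_cell/= => -> ->.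
pose V n := \bigcup_k S (n, k).
have mV n : measurable (V n).
  by apply: bigcup_measurable => k _; have [] := SP (n, k).
have Ve n : (lebC (V n) <= (16 * K ^+ 2 * e)%:E)%E.
  apply: (@le_trans _ _ (\sum_(0 <= k <oo) lebC (S (n, k)))%E).
    by apply: measure_sigma_subadditive => // k; have [] := SP (n, k).
  apply: (@le_trans _ _ (\sum_(0 <= k <oo) (16 * K ^+ 2)%:E * lebC (dyadic_enum n U k))%E).
    by apply: lee_nneseries => // k _; have [] := SP (n, k).
  rewrite nneseriesZl//.
  rewrite [leRHS]EFinM lee_wpmul2l// ?lee_fin ?mulr_ge0 ?sqr_ge0//.
  apply: le_trans Ue.
  have -> : (\sum_(0 <= k <oo) lebC (dyadic_enum n U k) = lebC (dyadic_part U n))%E.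
    rewrite dyadic_partE measure_semi_bigcup//.
    - by move=> k; exact: measurable_dyadic_enum.
    - exact: trivIset_dyadic_enum.
    - by apply: bigcup_measurable => k _; exact: measurable_dyadic_enum.
  apply: le_measure; rewrite ?inE//; first exact: measurable_dyadic_part.
  exact: dyadic_part_sub.
pose W n := \bigcap_(m in [set m | (n <= m)%N]) V m.
have mW n : measurable (W n) by apply: bigcap_measurable => [|m _]; [exists n => /=|exact: mV].
have cW : lebC \o W @ \oo --> lebC (\bigcup_n W n).
  apply: nondecreasing_cvg_mu => //; first by apply: bigcup_measurable => n _; exact: mW.
  by move=> n m nm; apply/subsetPset => z zW k /= mk; apply: zW => /=; exact: leq_trans mk.
have We : (lebC (\bigcup_n W n) <= (16 * K ^+ 2 * e)%:E)%E.
  rewrite -(cvg_lim _ cW)//; apply: lime_le; first by apply/cvg_ex; eexists; exact: cW.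
  apply: nearW => n /=; apply: le_trans (Ve n).
  by apply: le_measure; rewrite ?inE// => z; apply => /=.
exists (\bigcup_n W n) => //.
split; first by apply: bigcup_measurable => n _; exact: mW.
move=> _ [x Xx <-]; have [n nU] := oU _ (NU _ (XN _ Xx)); exists n => // m /= nm.
have : dyadic_part U m (g x) by exact: (dyadic_part_nd nm nU).
rewrite dyadic_partE => -[k _ kg]; exists k => //.
by have [_ _] := SP (m, k); exact.
Qed.

(** A null set is covered by dyadic cells of small total area; the image of a
    cell lies in a square of comparable area. Taking [f := id] or [g := id]
    gives images of null sets and preimages of null sets. *)
Lemma lipschitz_null (T : Type) (X : set T) (f g : T -> C) (K : R) :
  lebC.-negligible (g @` X) -> 0 <= K ->
  (forall x y, X x -> X y -> normc (f x - f y) <= K * normc (g x - g y)) ->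
  lebC.-negligible (f @` X).
Proof.
move=> [N [mN N0 XN]] K0 fgK.
have mbox M : measurable (box M) by apply: measurable_rect; exact: measurable_itv.
apply: (@negligibleS _ _ _ _ (\bigcup_M f @` (X `&` g @^-1` box M))).
  move=> _ [x Xx <-].
  pose M := (Num.truncn (normc (g x))).+1; exists M => //; exists x => //; split=> //.
  have := le_trans (normr_Re_le (g x)) (ltW (truncnS_gt _)).
  have := le_trans (normr_Im_le (g x)) (ltW (truncnS_gt _)).
  by rewrite /box /M /= !in_itv/= -!ler_norml.
apply: negligible_bigcup => M.
apply: (@lipschitz_null_bounded M _ _ f g K (N `&` box M)) => //.
- exact: measurableI.
- by apply: (subset_measure0 _ _ _ N0) => //; exact: measurableI.
- by move=> x [Xx gx]; split=> //; apply: XN; exists x.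
- by move=> x y [Xx _] [Xy _]; exact: fgK.
Qed.

End lipschitz_null.

(** * Sequences of independent Gaussians *)

Section null_sections.
Local Open Scope ereal_scope.
Context d1 d2 (T1 : measurableType d1) (T2 : measurableType d2) (R : realType).
Variables (m1 : {sigma_finite_measure set T1 -> \bar R}%R)
          (m2 : {sigma_finite_measure set T2 -> \bar R}%R).

Let ge0_integral_eq0 d (T : measurableType d) (m : {measure set T -> \bar R}%R)
    (f : T -> \bar R) : measurable_fun setT f -> (forall x, 0 <= f x) ->
  \int[m]_x f x = 0 <-> {ae m, forall x, f x = 0}.
Proof.
move=> mf f0; have -> : \int[m]_x f x = \int[m]_x `|f x|.
  by apply: eq_integral => x _; rewrite gee0_abs.
rewrite (ae_eq_integral_abs m measurableT mf).
by split; apply: filterS => x /=; [apply|move=> ->].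
Qed.

Lemma null_xsection (A : set (T1 * T2)) : measurable A ->
  (m1 \x m2) A = 0 <-> {ae m1, forall x, m2 (xsection A x) = 0}.
Proof. by move=> mA; apply: ge0_integral_eq0 => //; exact: measurable_fun_xsection. Qed.

Lemma null_ysection (A : set (T1 * T2)) : measurable A ->
  (m1 \x m2) A = 0 <-> {ae m2, forall y, m1 (ysection A y) = 0}.
Proof.
move=> mA.
have -> : (m1 \x m2) A = \int[m2]_y (m1 \o ysection A) y.
  transitivity (\int[m1]_x (m2 \o xsection A) x); first by [].
  have := indic_fubini_tonelli m1 m2 mA.
  by rewrite -indic_fubini_tonelli_FE// -indic_fubini_tonelli_GE// => ->.
by apply: ge0_integral_eq0 => //; exact: measurable_fun_ysection.
Qed.

End null_sections.

Section sequence_space.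
Context (R : realType).
Local Notation C := (R[i]).

Definition cseq : Type := nat -> C.

HB.instance Definition _ := gen_eqMixin cseq.
HB.instance Definition _ := gen_choiceMixin cseq.
HB.instance Definition _ := isPointed.Build cseq (fun=> 0).

HB.instance Definition _ := Measurable.copy cseq (g_sigma_algebraType
  (\bigcup_n preimage_set_system setT (fun x : cseq => x n) measurable)).

Lemma measurable_coord n : measurable_fun setT (fun x : cseq => x n).
Proof.
move=> _ B mB; apply: sub_sigma_algebra; exists n => //.
by exists B.
Qed.

Lemma measurable_fun_cseq d (T : measurableType d) (D : set T) (f : T -> cseq) :
  (forall n, measurable_fun D (fun x => f x n)) -> measurable_fun D f.
Proof.
move=> mf mD; apply: (@measurability _ _ _ _ D f
  (\bigcup_n preimage_set_system setT (fun x : cseq => x n) measurable)) (mD) => //.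
by move=> _ [_ [n _ [B mB <-]] <-]; rewrite setTI; exact: mf.
Qed.

Definition ccons (c : C) (b : cseq) : cseq := fun n => if n is n'.+1 then b n' else c.

Definition ctail (x : cseq) : cseq := fun n => x n.+1.

Lemma ccons_tail x : ccons (x 0%N) (ctail x) = x.
Proof. by apply/funext => -[]. Qed.

Lemma measurable_ctail : measurable_fun setT ctail.
Proof. by apply: measurable_fun_cseq => n; exact: measurable_coord. Qed.

Lemma measurable_ccons d (T : measurableType d) (D : set T) (f : T -> C) (g : T -> cseq) :
  measurable_fun D f -> measurable_fun D g -> measurable_fun D (fun x => ccons (f x) (g x)).
Proof.
move=> mf mg; apply: measurable_fun_cseq => -[|n] //=.
exact: (measurableT_comp (measurable_coord n) mg).
Qed.

Fixpoint cylinder (l : seq (set C)) : set cseq :=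
  if l is B :: l' then [set x | B (x 0%N) /\ cylinder l' (ctail x)] else setT.

Definition measurable_seq (l : seq (set C)) : Prop :=
  forall B, B \in l -> measurable B.

Lemma measurable_seq_cons B l : measurable_seq (B :: l) ->
  measurable B /\ measurable_seq l.
Proof.
move=> mBl; split; first by apply: mBl; rewrite inE eqxx.
by move=> D Dl; apply: mBl; rewrite inE Dl orbT.
Qed.

Lemma measurable_cylinder l : measurable_seq l -> measurable (cylinder l).
Proof.
elim: l => [_|B l IHl /measurable_seq_cons[mB /IHl ml]]; first exact: measurableT.
rewrite (_ : cylinder _ = (fun x => x 0%N) @^-1` B `&` ctail @^-1` cylinder l)//.
apply: measurableI; rewrite -[X in measurable X]setTI; first exact: measurable_coord.
exact: measurable_ctail.
Qed.

Definition cylinders : set (set cseq) :=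
  [set A | exists2 l, measurable_seq l & A = cylinder l].

Lemma cylinders_setI : setI_closed cylinders.
Proof.
move=> _ _ [l ml ->] [l' ml' ->].
elim: l l' ml ml' => [|B l IHl] [|D l'] ml ml'.
- by exists [::] => //=; rewrite setTI.
- by exists (D :: l') => //; rewrite setTI.
- by exists (B :: l) => //; rewrite setIT.
have [mB {}ml] := measurable_seq_cons ml; have [mD {}ml'] := measurable_seq_cons ml'.
have [k mk kE] := IHl _ ml ml'; exists (B `&` D :: k).
  by move=> X; rewrite inE => /orP[/eqP ->|/mk//]; exact: measurableI.
apply/seteqP; split=> x /=; first by move=> [[? ?] [? ?]]; rewrite -kE.
by move=> [[? ?]]; rewrite -kE => -[].
Qed.

Lemma measurable_cseqE : @measurable _ cseq = <<s cylinders >>.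
Proof.
apply/seteqP; split; last first.
  apply: smallest_sub; first exact: sigma_algebra_measurable.
  by move=> _ [l ml ->]; exact: measurable_cylinder.
apply: smallest_sub; first exact: smallest_sigma_algebra.
move=> _ [n _ [B mB <-]]; rewrite setTI; apply: sub_sigma_algebra.
exists (rcons (nseq n setT) B).
  move=> D; rewrite mem_rcons inE => /orP[/eqP ->//|/nseqP[-> _]]; exact: measurableT.
elim: n => [|n IHn] /=; first by apply/seteqP; split=> x //= [].
rewrite -IHn; apply/seteqP; split=> x /=; last by case.
by split.
Qed.

Lemma eq_measure_cylinder (m1 m2 : {measure set cseq -> \bar R}) :
  (m1 setT < +oo)%E ->
  (forall l, measurable_seq l -> m1 (cylinder l) = m2 (cylinder l)) ->
  forall A, measurable A -> m1 A = m2 A.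
Proof.
move=> m1oo m12 A mA.
apply: (measure_unique cylinders (fun=> setT)) => //.
- exact: measurable_cseqE.
- exact: cylinders_setI.
- by move=> _; exists [::].
- by rewrite bigcup_const.
- by move=> _ [l ml ->]; exact: m12.
Qed.

End sequence_space.

Section gaussian_sequence.
Context (R : realType).
Local Notation C := (R[i]).
Local Notation cseq := (cseq R).
Local Notation lebC := (@lebesgue_complex R).
Local Notation normc := (@Normc.normc R).

(** The lattice filter of Schur: state [s], input [x], output
    [filter_out k u s x]. One step rotates the pair of the state and the next
    input letter. In generating functions, with [k = sqrt (1 - |u|^2)], the
    output is [k * s / (1 - conj u * z) + (z - u) / (1 - conj u * z) * x(z)]:
    the Szego kernel at [u] and the Blaschke factor at [u]. *)
Fixpoint filter_state (k u s : C) (x : cseq) (n : nat) : C :=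
  if n is n'.+1 then conjc u * filter_state k u s x n' + k * x n' else s.

Definition filter_out (k u s : C) (x : cseq) : cseq :=
  fun n => k * filter_state k u s x n - u * x n.

Lemma filter_stateS k u s x n :
  filter_state k u s x n.+1 = filter_state k u (conjc u * s + k * x 0%N) (ctail x) n.
Proof. by elim: n => //= n <-. Qed.

Lemma ctail_filter_out k u s x :
  ctail (filter_out k u s x) = filter_out k u (conjc u * s + k * x 0%N) (ctail x).
Proof. by apply/funext => n; rewrite /ctail /filter_out filter_stateS. Qed.

Lemma measurable_filter_state d (T : measurableType d) (k u s : T -> C) (x : T -> cseq) n :
  measurable_fun setT k -> measurable_fun setT u -> measurable_fun setT s ->
  measurable_fun setT x ->
  measurable_fun setT (fun t => filter_state (k t) (u t) (s t) (x t) n).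
Proof.
move=> mk mu ms mx; elim: n => //= n IHn; apply: measurable_fun_addc.
  by apply: measurable_fun_mulc => //; exact: measurable_fun_conjc.
by apply: measurable_fun_mulc => //; exact: (measurableT_comp (measurable_coord n) mx).
Qed.

Lemma measurable_filter_out d (T : measurableType d) (k u s : T -> C) (x : T -> cseq) :
  measurable_fun setT k -> measurable_fun setT u -> measurable_fun setT s ->
  measurable_fun setT x ->
  measurable_fun setT (fun t => filter_out (k t) (u t) (s t) (x t)).
Proof.
move=> mk mu ms mx; apply: measurable_fun_cseq => n; apply: measurable_fun_subc.
  by apply: measurable_fun_mulc => //; exact: measurable_filter_state.
by apply: measurable_fun_mulc => //; exact: (measurableT_comp (measurable_coord n) mx).
Qed.

Variables (nu : probability C R) (gam : probability cseq R).
Hypothesis nuE : forall A : set C, measurable A ->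
  nu A = (\int[lebC]_(z in A) (gauss_density z)%:E)%E.
Hypothesis gamE : forall l, measurable_seq l ->
  gam (cylinder l) = (\prod_(B <- l) nu B)%E.

Let cons2 (p : C * cseq) : cseq := ccons p.1 p.2.

Let measurable_cons2 : measurable_fun setT cons2.
Proof. by apply: measurable_ccons; [exact: measurable_fst|exact: measurable_snd]. Qed.

Let cons2_mfun : {mfun (C * cseq)%type >-> cseq} :=
  HB.pack cons2 (isMeasurableFun.Build _ _ _ _ _ measurable_cons2).

Lemma gaussian_seq_cons (A : set cseq) : measurable A ->
  gam A = (nu \x gam)%E (cons2 @^-1` A).
Proof.
move=> mA; have -> : (nu \x gam)%E (cons2 @^-1` A) = pushforward (nu \x gam)%E cons2_mfun A.
  by [].
apply: (@eq_measure_cylinder _ gam) => //.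
  by rewrite [X in (X < _)%E](probability_setT gam) ltry.
case=> [_|B l /measurable_seq_cons[mB ml]].
  transitivity ((nu \x gam)%E (setT `*` setT)); last by rewrite setXTT.
  have -> : (nu \x gam)%E (setT `*` setT) = (nu setT * gam setT)%E.
    exact: product_measure1E.
  by rewrite [nu _]probability_setT mul1e.
transitivity (\prod_(D <- B :: l) nu D)%E.
  by apply: gamE => D; rewrite inE => /orP[/eqP ->//|/ml].
transitivity (nu B * gam (cylinder l))%E; first by rewrite big_cons gamE.
transitivity ((nu \x gam)%E (B `*` cylinder l)); last by [].
by apply/esym/product_measure1E => //; exact: measurable_cylinder.
Qed.

Lemma gaussian_seq_integral (A : set cseq) : measurable A ->
  gam A = (\int[nu]_c gam [set b | A (ccons c b)])%E.
Proof.
move=> mA; rewrite gaussian_seq_cons//.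
transitivity (\int[nu]_c (gam \o xsection (cons2 @^-1` A)) c)%E; first by [].
apply: eq_integral => c _ /=; congr (gam _).
by apply/seteqP; split=> b; rewrite /xsection/= inE.
Qed.

Lemma gaussian_seq_null (A : set cseq) : measurable A ->
  gam A = 0%E <-> {ae gam, forall b, nu [set c | A (ccons c b)] = 0%E}.
Proof.
move=> mA; rewrite gaussian_seq_cons//.
rewrite null_ysection; last by rewrite -[X in measurable X]setTI; exact: measurable_cons2.
have E b : ysection (cons2 @^-1` A) b = [set c | A (ccons c b)].
  by apply/seteqP; split=> c; rewrite /ysection/= inE.
by split; apply: filterS => b; rewrite E.
Qed.

Section filter_law.
Variables (k : R) (u : C).
Hypotheses (k0 : 0 <= k) (ku : k ^+ 2 + normc u ^+ 2 = 1).
Local Notation K := (k%:C)%C.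

Let Q (l : seq (set C)) (s : C) : \bar R :=
  gam [set x | cylinder l (filter_out K u s x)].

Let measurable_Q l : measurable_seq l -> measurable_fun setT (Q l).
Proof.
move=> ml; pose A := (fun p : C * cseq => filter_out K u p.1 p.2) @^-1` cylinder l.
have mA : measurable A.
  rewrite -[A]setTI; apply: measurable_filter_out => //.
  exact: measurable_cylinder.
have := measurable_fun_xsection gam mA; apply: eq_measurable_fun => s _ /=.
by congr (gam _); apply/seteqP; split=> x; rewrite /xsection/= inE.
Qed.

(** One step of the filter is a rotation, after which its output letter and its
    new state are again independent Gaussians. *)
Let integral_Q l : measurable_seq l ->
  (\int[nu]_s Q l s = \prod_(B <- l) nu B)%E.
Proof.
elim: l => [_|B l IHl /measurable_seq_cons[mB ml]].
  rewrite big_nil (eq_integral (cst 1%E)); last by move=> s _; exact: probability_setT.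
  by rewrite integral_cst// mul1e; exact: probability_setT.
have mQl := measurable_Q ml.
rewrite big_cons -IHl//.
pose f (p : C * C) : \bar R := ((\1_B p.1)%:E * Q l p.2)%E.
have mf : measurable_fun setT f.
  apply: emeasurable_funM; last exact: (measurableT_comp mQl measurable_snd).
  apply/measurable_EFinP; apply: (measurableT_comp _ measurable_fst).
  exact: measurable_indic.
have f0 p : (0 <= f p)%E by rewrite mule_ge0// lee_fin.
have QE s : Q (B :: l) s = (\int[nu]_c f (K * s - u * c, conjc u * s + K * c)%R)%E.
  rewrite /Q gaussian_seq_integral.
    apply: eq_integral => c _; rewrite /f /= indicE.
    have [Bs|Bs] := pselect (B (K * s - u * c)%R).
      rewrite mem_set// mul1e; congr (gam _).
      apply/seteqP; split=> b /=; rewrite ctail_filter_out => bl.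
        by case: bl.
      by split; [exact: Bs|exact: bl].
    rewrite memNset// mul0e (_ : [set b | _] = set0) ?measure0//.
    by apply/seteqP; split=> // b /= [].
  rewrite -[X in measurable X]setTI; apply: measurable_filter_out => //.
  apply: (@measurable_cylinder _ (B :: l)) => D; rewrite inE => /orP[/eqP ->//|/ml//].
under eq_integral do rewrite QE.
rewrite (gauss_rotation nuE k0 ku mf f0).
transitivity (\int[nu]_z ((\1_B z)%:E * \int[nu]_s Q l s))%E.
  by apply: eq_integral => z _; rewrite /f /= ge0_integralZl.
rewrite ge0_integralZr//.
- by rewrite integral_indic// setIT.
- by apply/measurable_EFinP; exact: measurable_indic.
- by apply: integral_ge0 => s _; exact: measure_ge0.
Qed.

Lemma filter_out_law (A : set cseq) : measurable A ->
  gam [set a | A (filter_out K u (a 0%N) (ctail a))] = gam A.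
Proof.
move=> mA.
have mF : measurable_fun setT (fun a : cseq => filter_out K u (a 0%N) (ctail a)).
  apply: measurable_filter_out; [exact: measurable_cst..|exact: measurable_coord|].
  exact: measurable_ctail.
pose F : {mfun cseq >-> cseq} := HB.pack
  (fun a : cseq => filter_out K u (a 0%N) (ctail a)) (isMeasurableFun.Build _ _ _ _ _ mF).
transitivity (pushforward gam F A); first by [].
apply/esym; apply: (@eq_measure_cylinder _ gam) => //.
  by rewrite [X in (X < _)%E](probability_setT gam) ltry.
move=> l ml; apply: (etrans (gamE ml)); apply: (etrans (esym (integral_Q ml))).
apply/esym/(@gaussian_seq_integral (F @^-1` cylinder l)).
by rewrite -[X in measurable X]setTI; apply: (mF) => //; exact: measurable_cylinder.
Qed.

End filter_law.

(** The filter expects a Gaussian state, whereas adding a zero to [a] uses the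
    state [k * a 0]: its law is another one, with the same null sets. *)
Lemma scale_head_null (k : C) (A : set cseq) : k != 0 -> measurable A ->
  gam A = 0%E -> gam [set a | A (ccons (k * a 0%N) (ctail a))] = 0%E.
Proof.
move=> k0 mA /(gaussian_seq_null mA) A0.
have mS : measurable_fun setT (fun a : cseq => ccons (k * a 0%N) (ctail a)).
  apply: measurable_ccons; last exact: measurable_ctail.
  by apply: measurable_fun_mulc; [exact: measurable_cst|exact: measurable_coord].
apply/gaussian_seq_null; first by rewrite -[X in measurable X]setTI; exact: mS.
apply: filterS A0 => b b0.
have mAb : measurable [set c | A (ccons c b)].
  rewrite -[X in measurable X]setTI; apply: measurable_ccons => //.
have mAkb : measurable [set c : C | A (ccons (k * c) b)].
  rewrite -[X in measurable X]setTI; apply: measurable_ccons => //.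
  exact: measurable_fun_mulc.
rewrite /=; apply/(gauss_null nuE mAkb)/negligibleP => //.
have := @lipschitz_null R C [set c | A (ccons (k * c) b)] id (fun c => k * c) (normc k)^-1.
rewrite image_id; apply.
- apply: (@negligibleS _ _ _ _ [set c | A (ccons c b)]); first by move=> _ [c ? <-].
  by apply/negligibleP => //; apply/(gauss_null nuE mAb).
- by rewrite invr_ge0 normc_ge0.
- move=> x y _ _; rewrite -mulrBr Normc.normcM mulrA mulVf ?mul1r//.
  by apply: contra_neq k0; exact: Normc.eq0_normc.
Qed.

End gaussian_sequence.

(** * Power series in the unit disc *)

Section complex_series.
Context (R : realType).
Local Notation C := (R[i]).
Local Notation normc := (@Normc.normc R).
Local Notation Re := (@complex.Re R).
Local Notation Im := (@complex.Im R).
Implicit Types (c d : nat -> C) (l m : C).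

Lemma normcE z : `|z : C| = ((normc z)%:C)%C.
Proof. by rewrite normc_def; case: z. Qed.

Lemma ler_normcD (x y : C) : normc (x + y) <= normc x + normc y.
Proof. by have := ler_normD x y; rewrite !normcE -rmorphD/= lecR. Qed.

Lemma ler_normcB (x y : C) : normc (x - y) <= normc x + normc y.
Proof. by have := ler_normB x y; rewrite !normcE -rmorphD/= lecR. Qed.

Lemma normc_distC (x y : C) : normc (x - y) = normc (y - x).
Proof. by have := distrC x y; rewrite !normcE => /complexI. Qed.

Lemma normcX (x : C) n : normc (x ^+ n) = normc x ^+ n.
Proof.
by elim: n => [|n IHn]; rewrite ?Normc.normc1// !exprS Normc.normcM IHn.
Qed.

Lemma normcJ (x : C) : normc (conjc x) = normc x.
Proof. by case: x => a b /=; rewrite sqrrN. Qed.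

Lemma cvgcP (z : nat -> C) l : ((z : nat -> C^o) @ \oo --> (l : C^o)) <->
  ((fun n => normc (z n - l)) @ \oo --> (0 : R)).
Proof.
split=> [/cvgrPdist_lt zl|/cvgrPdist_lt zl].
  apply/cvgrPdist_lt => e e0.
  have := zl (e%:C)%C; rewrite -[X in X < _]/((0 : R)%:C)%C ltcR => /(_ e0).
  apply: filterS => n; rewrite sub0r normrN normcE ltcR normc_distC.
  by rewrite ger0_norm// normc_ge0.
apply/cvgrPdist_lt => -[e e'] /=; rewrite ltcE/= => /andP[/eqP e'0 e0].
move: (zl e e0); apply: filterS => n; rewrite sub0r normrN ger0_norm ?normc_ge0//.
by rewrite normcE normc_distC ltcE/= e'0 eqxx.
Qed.

Definition sums c l : Prop :=
  (series (fun n => c n : C^o) : nat -> C^o) @ \oo --> (l : C^o).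

Lemma sumsP c l : sums c l <->
  ((fun n => normc (\sum_(0 <= k < n) c k - l)) @ \oo --> (0 : R)).
Proof. exact: cvgcP. Qed.

Lemma sums_unique c l m : sums c l -> sums c m -> l = m.
Proof. by move=> cl cm; exact: (cvg_unique (@norm_hausdorff _ C^o) cl cm). Qed.

Lemma sums_lim c l : sums c l -> limn (series (fun n => c n : C^o) : nat -> C^o) = l.
Proof. by move=> cl; apply/cvg_lim => //; exact: norm_hausdorff. Qed.

Lemma sumsD c d l m : sums c l -> sums d m -> sums (fun n => c n + d n) (l + m).
Proof.
rewrite /sums => cl dm.
have -> : series (fun n => c n + d n : C^o) =
          (series (fun n => c n : C^o) \+ series (fun n => d n : C^o) : nat -> C^o).
  by apply/funext => n; rewrite /series/= big_split.
exact: (cvgD cl dm).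
Qed.

Lemma sumsZ c l k : sums c l -> sums (fun n => k * c n) (k * l).
Proof.
rewrite /sums => cl.
have -> : series (fun n => k * c n : C^o) =
          (fun n => (k : C) *: (series (fun n => c n : C^o) n)).
  by apply/funext => n; rewrite /series/= scaler_sumr.
exact: cvgZr.
Qed.

Lemma sumsN c l : sums c l -> sums (fun n => - c n) (- l).
Proof. by move=> cl; have := @sumsZ c l (-1) cl; rewrite mulN1r; under eq_fun do rewrite mulN1r. Qed.

Lemma sumsB c d l m : sums c l -> sums d m -> sums (fun n => c n - d n) (l - m).
Proof. by move=> cl /sumsN; exact: sumsD. Qed.

Lemma sums_shift c l : sums c l -> sums (fun n => c n.+1) (l - c 0%N).
Proof.
move=> /sumsP cl; apply/sumsP.
rewrite (_ : (fun n => _) = (fun n => normc (\sum_(0 <= k < n.+1) c k - l))).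
  by have := cvg_shiftS (fun n => normc (\sum_(0 <= k < n) c k - l)) (nbhs (0 : R)); move=> ->.
apply/funext => n; congr normc; rewrite [in RHS]big_nat_recl//=.
by rewrite opprB addrA [X in X - l]addrC.
Qed.

Definition geometric_bound (A q : R) c : Prop := forall n, normc (c n) <= A * q ^+ n.

Lemma geometric_sums (A q : R) c : 0 <= q < 1 -> geometric_bound A q c ->
  exists2 l, sums c l & normc l <= 2 * (A / (1 - q)).
Proof.
move=> /andP[q0 q1] cA.
have A0 : 0 <= A by have := cA 0%N; rewrite expr0 mulr1; apply: le_trans; exact: normc_ge0.
have part (x : nat -> R) : (forall n, `|x n| <= A * q ^+ n) ->
    exists2 s, series x @ \oo --> s & `|s| <= A / (1 - q).
  move=> xA.
  have geo : series (geometric A q) @ \oo --> A / (1 - q).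
    by apply: cvg_geometric_series; rewrite ger0_norm.
  have cx : cvgn [normed series x].
    apply: (@series_le_cvg _ _ (geometric A q)) => //= [n|].
    - by rewrite mulr_ge0// exprn_ge0.
    - by apply/cvg_ex; eexists; exact: geo.
  have cs := normed_cvg cx; exists (limn (series x)); first exact: cs.
  rewrite -(cvg_lim (@Rhausdorff R) geo).
  apply: le_trans (lim_series_norm cx) _.
  by apply: lim_series_le => //; apply/cvg_ex; eexists; exact: geo.
have [n|s cs sA] := part (Re \o c).
  exact: le_trans (normr_Re_le _) (cA n).
have [n|t ct tA] := part (Im \o c).
  exact: le_trans (normr_Im_le _) (cA n).
exists (Complex s t); last first.
  by apply: le_trans (normc_le _) _; rewrite mulr2n mulrDl mul1r lerD.
apply/sumsP.
apply: (@squeeze_cvgr _ _ _ _ (fun=> 0) (fun n => `|series (Re \o c) n - s| +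
                                    `|series (Im \o c) n - t|)).
- apply: nearW => n; rewrite normc_ge0/=; apply: le_trans (normc_le _) _.
  have ReB (x y : C) : Re (x - y) = Re x - Re y by case: x y => [? ?] [].
  have ImB (x y : C) : Im (x - y) = Im x - Im y by case: x y => [? ?] [].
  rewrite ReB ImB /series /=.
  rewrite (big_morph Re (id1 := 0) (op1 := +%R))//; last by case=> ? ? [].
  by rewrite (big_morph Im (id1 := 0) (op1 := +%R))//; case=> ? ? [].
- exact: cvg_cst.
- rewrite -[X in _ --> X]addr0; apply: cvgD.
    by rewrite -(normr0 R); apply: cvg_norm; rewrite -(subrr s); apply: cvgB => //; exact: cvg_cst.
  by rewrite -(normr0 R); apply: cvg_norm; rewrite -(subrr t); apply: cvgB => //; exact: cvg_cst.
Qed.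

Lemma poly_geometric (r : R) : 0 <= r < 1 -> exists A q : R,
  [/\ 0 <= A, 0 <= q < 1 & forall n, n.+1%:R ^+ 3 * r ^+ n <= A * q ^+ n].
Proof.
move=> /andP[r0 r1].
(* [r <= q ^+ 4] by Bernoulli, and each factor [n.+1] is absorbed by [q ^+ n] *)
pose q := 1 - (1 - r) / 4.
have q0 : 0 < q by rewrite /q; lra.
have q1 : q < 1 by rewrite /q; lra.
have rq : r <= q ^+ 4.
  have : (1 - r) / 4 <= 1 by lra.
  have : 0 <= (1 - r) / 4 by lra.
  rewrite /q; set t := (1 - r) / 4 => t0 t1.
  have -> : r = 1 - 4 * t by rewrite /t; field.
  rewrite (_ : (1 - t) ^+ 4 = 1 - 4 * t + t ^+ 2 * ((2 - t) ^+ 2 + 2 - 0)); last by ring.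
  by rewrite lerDl mulr_ge0 ?sqr_ge0// subr0 addr_ge0 ?sqr_ge0.
have nq n : n.+1%:R * q ^+ n <= (1 - q)^-1.
  rewrite -[leRHS]mul1r ler_pdivlMr ?subr_gt0// -mulrA.
  have sumE : (\sum_(i < n.+1) q ^+ i) * (1 - q) = 1 - q ^+ n.+1.
    by rewrite mulrC -opprB mulNr -subrX1 opprB.
  apply: (@le_trans _ _ ((\sum_(i < n.+1) q ^+ i) * (1 - q))); last first.
    by rewrite sumE gerBl exprn_ge0// ltW.
  have nS : n.+1%:R * q ^+ n <= \sum_(i < n.+1) q ^+ i.
    rewrite mulr_natl -[n.+1 in leLHS]card_ord -sumr_const.
    apply: ler_sum => i _; apply: ler_wiXn2l; rewrite ?ltW//.
    by rewrite -ltnS.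
  by rewrite mulrA; apply: ler_wpM2r => //; rewrite subr_ge0 ltW.
exists ((1 - q)^-1 ^+ 3), q; split.
- by rewrite exprn_ge0// invr_ge0 subr_ge0 ltW.
- by rewrite (ltW q0) q1.
- move=> n; apply: (@le_trans _ _ (n.+1%:R ^+ 3 * (q ^+ n) ^+ 4)).
    rewrite ler_wpM2l// ?exprn_ge0// -exprM mulnC exprM.
    by apply: lerXn2r; rewrite ?nnegrE// exprn_ge0// ltW.
  rewrite [(q ^+ n) ^+ 4]exprSr mulrA -exprMn ler_wpM2r ?exprn_ge0 ?(ltW q0)//.
  apply: lerXn2r; rewrite ?nnegrE//; last by rewrite invr_ge0 subr_ge0 ltW.
  by rewrite mulr_ge0// exprn_ge0// ltW.
Qed.

End complex_series.
Arguments sumsZ {R c l} k _.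

Section good_sequences.
Context (R : realType).
Local Notation C := (R[i]).
Local Notation cseq := (cseq R).
Local Notation normc := (@Normc.normc R).
Implicit Types (a b x p h : cseq) (u v w z : C).

(** Linear growth ensures convergence in the disc, and holds almost surely for
    Gaussian coefficients. *)
Definition good a : Prop := exists M : nat, forall n, normc (a n) <= M%:R * n.+1%:R.

Lemma goodP a (K : R) : (forall n, normc (a n) <= K * n.+1%:R) -> good a.
Proof.
move=> aK; exists (Num.truncn K).+1 => n; apply: le_trans (aK n) _.
by rewrite ler_wpM2r// ltW// truncnS_gt.
Qed.

Lemma measurable_good : measurable [set a | good a].
Proof.
have -> : [set a | good a] =
    \bigcup_M \bigcap_n [set a : cseq | normc (a n) <= M%:R * n.+1%:R].
  apply/seteqP; split=> a [M] => [aM|_ aM]; exists M => // n; first by move=> _; exact: aM.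
  exact: aM.
apply: bigcup_measurable => M _; apply: bigcap_measurable => [|n _]; first by exists 0%N.
rewrite -[X in measurable X]setTI.
rewrite (_ : [set a : cseq | _] = (fun a : cseq => normc (a n)) @^-1` `]-oo, M%:R * n.+1%:R]).
  have mn : measurable_fun setT (fun a : cseq => normc (a n)).
    by apply: measurable_fun_normc; exact: measurable_coord.
  by apply: mn => //; exact: measurable_itv.
by apply/seteqP; split=> a /=; rewrite in_itv.
Qed.

Lemma good_ctail a : good a -> good (ctail a).
Proof.
move=> [M aM]; apply: (@goodP _ (M%:R * 2)) => n; apply: le_trans (aM n.+1) _.
rewrite -mulrA ler_wpM2l// -natrM ler_nat mul2n -addnn.
by rewrite addSn addnS !ltnS leq_addr.
Qed.

Lemma good_ccons c a : good a -> good (ccons c a).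
Proof.
move=> [M aM]; apply: (@goodP _ (normc c + M%:R)) => -[|n] /=.
  by rewrite mulr1 lerDl.
apply: le_trans (aM n) _; rewrite mulrDl ler_wpDl ?mulr_ge0 ?normc_ge0//.
by rewrite ler_wpM2l// ler_nat.
Qed.

Lemma good_iter_ctail j a : good a -> good (iter j (@ctail R) a).
Proof. by elim: j => //= j IHj /IHj; exact: good_ctail. Qed.

Lemma poly_sums (r : R) : 0 <= r < 1 -> exists2 B : R, 0 <= B &
  forall (K : R) (c : nat -> C), 0 <= K ->
    (forall n, normc (c n) <= K * (n.+1%:R ^+ 3 * r ^+ n)) ->
    exists2 l, sums c l & normc l <= K * B.
Proof.
move=> /poly_geometric[A [q [A0 q01 Aq]]]; exists (2 * (A / (1 - q))).
  by case/andP: q01 => _ q1; rewrite mulr_ge0// divr_ge0// subr_ge0 ltW.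
move=> K c K0 cK; have [n|l cl lB] := @geometric_sums R (K * A) q c q01.
  by apply: le_trans (cK n) _; rewrite -mulrA ler_wpM2l.
exists l => //; apply: le_trans lB _.
by rewrite (_ : 2 * _ = K * (2 * (A / (1 - q)))) //; ring.
Qed.

Let natr_le_cube n : n.+1%:R <= n.+1%:R ^+ 3 :> R.
Proof. by rewrite ler_eXnr// ler1n. Qed.

Let natr_sqr_le_cube n : n.+1%:R * n%:R ^+ 2 <= n.+1%:R ^+ 3 :> R.
Proof.
by rewrite [leRHS]exprS ler_wpM2l//; apply: lerXn2r; rewrite ?nnegrE// ler_nat.
Qed.

Let natr_mul_le_cube n : n.+1%:R * n%:R <= n.+1%:R ^+ 3 :> R.
Proof.
apply: le_trans (natr_sqr_le_cube n); rewrite ler_wpM2l// -natrX ler_nat.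
by case: n => // n; rewrite -mulnn leq_pmulr.
Qed.

Lemma sums_power a u : good a -> normc u < 1 ->
  sums (fun n => a n * u ^+ n) (power_series a u).
Proof.
move=> [M aM] u1; have [|B B0 sumB] := @poly_sums (normc u); first by rewrite normc_ge0.
have [//|n|l al _] := sumB M%:R (fun n => a n * u ^+ n).
  rewrite Normc.normcM normcX mulrA ler_wpM2r ?exprn_ge0 ?normc_ge0//.
  by apply: le_trans (aM n) _; rewrite ler_wpM2l.
by rewrite /power_series (sums_lim al).
Qed.

Lemma power_series_ctail a u : good a -> normc u < 1 ->
  power_series a u = a 0%N + u * power_series (ctail a) u.
Proof.
move=> ga u1; have /sums_shift := sums_power ga u1; rewrite expr0 mulr1 => s1.
have /(@sumsZ _ _ _ u) s2 := sums_power (good_ctail ga) u1.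
have : sums (fun n => a n.+1 * u ^+ n.+1) (u * power_series (ctail a) u).
  by move: s2; congr sums; apply/funext => n; rewrite /ctail mulrCA exprS.
by move=> /(sums_unique s1) <-; rewrite addrC subrK.
Qed.

(** The quotient [(u ^+ n - v ^+ n) / (u - v)], extended by continuity. *)
Fixpoint power_quot (n : nat) u v : C :=
  if n is n'.+1 then u * power_quot n' u v + v ^+ n' else 0.

Lemma power_quotE n u v : (u - v) * power_quot n u v = u ^+ n - v ^+ n.
Proof.
elim: n => [|n IHn] /=; first by rewrite mulr0 subrr.
by rewrite mulrDr mulrCA IHn !exprS; ring.
Qed.

Section radius.
Variables (r : R).
Hypotheses (r0 : 0 < r).

Lemma power_quot_norm n u v : normc u <= r -> normc v <= r ->
  r * normc (power_quot n u v) <= n%:R * r ^+ n.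
Proof.
move=> ur vr; elim: n => [|n IHn].
  by rewrite mul0r (_ : normc _ = 0) ?mulr0//; exact: Normc.normc0.
rewrite [power_quot _ _ _]/=.
apply: (@le_trans _ _ (r * (normc u * normc (power_quot n u v) + normc v ^+ n))).
  rewrite ler_wpM2l ?(ltW r0)//; apply: le_trans (ler_normcD _ _) _.
  by rewrite Normc.normcM normcX.
apply: (@le_trans _ _ (r * (n%:R * r ^+ n) + r * r ^+ n)).
  rewrite mulrDr; apply: lerD.
    rewrite mulrCA; apply: ler_pM => //; rewrite ?normc_ge0//.
    by rewrite mulr_ge0 ?normc_ge0 ?(ltW r0).
  rewrite ler_wpM2l ?(ltW r0)//.
  by apply: lerXn2r; rewrite ?nnegrE ?normc_ge0 ?(ltW r0).
by rewrite (exprS r n) -natr1 le_eqVlt; apply/orP; left; apply/eqP; ring.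
Qed.

Lemma power_quot_dist n u v w (e : R) : normc u <= r -> normc v <= r ->
  normc w <= r -> normc (u - w) <= e -> normc (v - w) <= e ->
  r ^+ 2 * normc (power_quot n u v - power_quot n w w) <= e * (n%:R ^+ 2 * r ^+ n).
Proof.
move=> ur vr wr ue ve.
have e0 : 0 <= e by apply: le_trans ue; exact: normc_ge0.
elim: n => [|n IHn].
  have -> : normc (power_quot 0 u v - power_quot 0 w w) = 0.
    by rewrite subrr; exact: Normc.normc0.
  by rewrite mulr0 expr0n/= mul0r mulr0.
rewrite /=.
have -> : u * power_quot n u v + v ^+ n - (w * power_quot n w w + w ^+ n) =
    u * (power_quot n u v - power_quot n w w) + (u - w) * power_quot n w w +
    (v - w) * power_quot n v w by rewrite power_quotE; ring.
apply: (@le_trans _ _ (r ^+ 2 * (r * normc (power_quot n u v - power_quot n w w) +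
    e * normc (power_quot n w w) + e * normc (power_quot n v w)))).
  rewrite ler_wpM2l ?sqr_ge0//; apply: le_trans (ler_normcD _ _) _; apply: lerD.
    apply: le_trans (ler_normcD _ _) _; rewrite !Normc.normcM.
    by apply: lerD; apply: ler_wpM2r; rewrite ?normc_ge0.
  by rewrite Normc.normcM; apply: ler_wpM2r; rewrite ?normc_ge0.
have H1 := power_quot_norm n wr wr; have H2 := power_quot_norm n vr wr.
apply: (@le_trans _ _ (r * (e * (n%:R ^+ 2 * r ^+ n)) + r * e * (n%:R * r ^+ n) +
                       r * e * (n%:R * r ^+ n))).
  have -> (p s t : R) : r ^+ 2 * (r * p + e * s + e * t) =
      r * (r ^+ 2 * p) + (r * e) * (r * s) + (r * e) * (r * t) by ring.
  have re0 : 0 <= r * e by rewrite mulr_ge0// ltW.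
  apply: lerD; [apply: lerD|].
  - by apply: ler_wpM2l IHn; exact: ltW.
  - exact: ler_wpM2l H1.
  - exact: ler_wpM2l H2.
rewrite -subr_ge0 (_ : _ - _ = e * r ^+ n.+1).
  by rewrite mulr_ge0// exprn_ge0// (ltW r0).
by rewrite (exprS r n) -natr1; ring.
Qed.

End radius.

(** [(power_series a u - power_series a v) / (u - v)]; on the diagonal it is the
    derivative of the power series. *)
Definition series_quot a u v : C :=
  limn (series (fun n => a n * power_quot n u v : C^o) : nat -> C^o).

Lemma sums_series_quot a (r : R) : good a -> 0 < r < 1 ->
  exists2 K, 0 <= K & forall u v, normc u <= r -> normc v <= r ->
    sums (fun n => a n * power_quot n u v) (series_quot a u v) /\
    normc (series_quot a u v) <= K.
Proof.
move=> [M aM] /andP[r0 r1].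
have [|B B0 sumB] := @poly_sums r; first by rewrite (ltW r0).
exists (M%:R / r * B) => [|u v ur vr]; first by rewrite mulr_ge0// divr_ge0// ltW.
have [|n|l al lB] := sumB (M%:R / r) (fun n => a n * power_quot n u v).
- by rewrite divr_ge0// ltW.
- rewrite Normc.normcM mulrAC ler_pdivlMr//.
  have H := power_quot_norm r0 n ur vr.
  rewrite -mulrA [normc (power_quot _ _ _) * r]mulrC.
  apply: (@le_trans _ _ (M%:R * n.+1%:R * (n%:R * r ^+ n))).
    by apply: ler_pM; rewrite ?normc_ge0 ?mulr_ge0 ?normc_ge0 ?(ltW r0).
  rewrite -(mulrA M%:R) ler_wpM2l// mulrA; apply: ler_wpM2r => //.
  by rewrite exprn_ge0// ltW.
by rewrite /series_quot (sums_lim al).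
Qed.

Lemma power_series_diff a u v : good a -> normc u < 1 -> normc v < 1 ->
  power_series a u - power_series a v = (u - v) * series_quot a u v.
Proof.
move=> ga u1 v1; pose r := (1 + Num.max (normc u) (normc v)) / 2.
have m1 : Num.max (normc u) (normc v) < 1 by rewrite gt_max u1.
have mu : normc u <= Num.max (normc u) (normc v) by rewrite le_max lexx.
have mv : normc v <= Num.max (normc u) (normc v) by rewrite le_max lexx orbT.
have u0 := normc_ge0 u.
have r01 : 0 < r < 1 by rewrite /r; apply/andP; split; lra.
have [K K0 /(_ u v)[||/(@sumsZ _ _ _ (u - v)) s1 _]] := sums_series_quot ga r01.
- by rewrite /r; lra.
- by rewrite /r; lra.
have := sumsB (sums_power ga u1) (sums_power ga v1).
rewrite (_ : (fun n => _) = (fun n => (u - v) * (a n * power_quot n u v))).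
  by move=> s2; exact: sums_unique s2 s1.
by apply/funext => n; rewrite mulrCA power_quotE mulrBr.
Qed.

Lemma series_quot_cont a (r : R) : good a -> 0 < r < 1 ->
  exists2 K, 0 <= K & forall u v w e, normc u <= r -> normc v <= r ->
    normc w <= r -> normc (u - w) <= e -> normc (v - w) <= e ->
    normc (series_quot a u v - series_quot a w w) <= K * e.
Proof.
move=> ga r01; have [K _ Ksum] := sums_series_quot ga r01.
case: ga => M aM; case/andP: r01 => r0 r1.
have [|B B0 sumB] := @poly_sums r; first by rewrite (ltW r0).
exists (M%:R / r ^+ 2 * B) => [|u v w e ur vr wr ue ve].
  by rewrite mulr_ge0// divr_ge0// exprn_ge0// ltW.
have e0 : 0 <= e by apply: le_trans ue; exact: normc_ge0.
have [s1 _] := Ksum _ _ ur vr; have [s2 _] := Ksum _ _ wr wr.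
have s3 := sumsB s1 s2.
have [|n|l al lB] := sumB (M%:R / r ^+ 2 * e)
    (fun n => a n * power_quot n u v - a n * power_quot n w w).
- by rewrite mulr_ge0// divr_ge0// exprn_ge0// ltW.
- rewrite -mulrBr Normc.normcM.
  rewrite (_ : M%:R / r ^+ 2 * e * _ = M%:R * (e * (n.+1%:R ^+ 3 * r ^+ n)) / r ^+ 2);
    last by ring.
  rewrite ler_pdivlMr ?exprn_gt0//.
  have H := power_quot_dist r0 n ur vr wr ue ve.
  rewrite -mulrA [normc (_ - _) * _]mulrC.
  apply: (@le_trans _ _ (M%:R * n.+1%:R * (e * (n%:R ^+ 2 * r ^+ n)))).
    by apply: ler_pM; rewrite ?normc_ge0 ?mulr_ge0 ?normc_ge0 ?exprn_ge0 ?(ltW r0).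
  rewrite -(mulrA M%:R) ler_wpM2l// mulrCA ler_wpM2l// mulrA; apply: ler_wpM2r => //.
  by rewrite exprn_ge0// ltW.
by rewrite -(sums_unique al s3) mulrAC.
Qed.

(** The power series of [p] is that of [a] times the Blaschke factor
    [(z - u) / (1 - conj u * z)]. *)
Definition blaschke u a p : Prop :=
  p 0%N = - u * a 0%N /\ forall n, p n.+1 - conjc u * p n = a n - u * a n.+1.

Lemma blaschke_power u a p z : blaschke u a p -> good a -> good p ->
  normc z < 1 ->
  (1 - conjc u * z) * power_series p z = (z - u) * power_series a z.
Proof.
move=> [p0 pS] ga gp z1.
have sp := sums_power gp z1; have sa := sums_power ga z1.
have s1 := sumsB (sums_shift sp) (sumsZ (conjc u * z) sp).
have s2 := sumsB (sumsZ z sa) (sumsZ u (sums_shift sa)).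
rewrite (_ : (fun n => _) = (fun n => z * (a n * z ^+ n) - u * (a n.+1 * z ^+ n.+1))) in s1.
  have := sums_unique s1 s2; rewrite !expr0 !mulr1 p0 => E.
  have -> : (1 - conjc u * z) * power_series p z =
    power_series p z - - u * a 0%N - conjc u * z * power_series p z - u * a 0%N by ring.
  by rewrite E; ring.
apply/funext => n.
transitivity ((p n.+1 - conjc u * p n) * z ^+ n.+1); first by rewrite exprS; ring.
by rewrite pS exprS; ring.
Qed.

Lemma blaschke_zero u a p z : blaschke u a p -> good a -> good p ->
  normc u < 1 -> normc z < 1 ->
  power_series p z = 0 <-> z = u \/ power_series a z = 0.
Proof.
move=> upa ga gp u1 z1; have E := blaschke_power upa ga gp z1.
have uz : 1 - conjc u * z != 0.
  rewrite subr_eq0; apply/eqP => uz1; have : normc (conjc u * z) < 1.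
    rewrite Normc.normcM normcJ; apply: (@le_lt_trans _ _ (normc u * 1)).
      by apply: ler_wpM2l; rewrite ?normc_ge0 ?ltW.
    by rewrite mulr1.
  by rewrite -uz1 Normc.normc1 ltxx.
split=> [pz|[zu|az]].
- move: E; rewrite pz mulr0 => /esym/eqP; rewrite mulf_eq0 subr_eq0.
  by case/orP => /eqP; [left|right].
- by apply: (mulfI uz); rewrite E zu subrr mul0r mulr0.
- by apply: (mulfI uz); rewrite E az !mulr0.
Qed.

Section filter_series.
Variables (k : R) (u : C).
Hypotheses (k0 : 0 < k) (ku : k ^+ 2 + normc u ^+ 2 = 1).
Local Notation K := (k%:C)%C.

Let u1 : normc u < 1.
Proof.
rewrite -(@ltr_pXn2r _ 2)// ?nnegrE ?normc_ge0// expr1n -ku ltrDr.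
by rewrite exprn_gt0.
Qed.

Let K0 : K != 0.
Proof.
apply/eqP => /(congr1 (@complex.Re R)) /= k00.
by move: k0; rewrite k00 ltxx.
Qed.

Let Ku : K ^+ 2 + u * conjc u = 1.
Proof. by rewrite -normc_sqr -!rmorphXn -rmorphD/= ku. Qed.

Lemma good_filter_state s x : good x -> good (filter_state K u s x).
Proof.
move=> [M xM]; pose B := normc s + normc K * M%:R / (1 - normc u).
have u10 : 0 < 1 - normc u by rewrite subr_gt0.
have B0 : 0 <= normc K * M%:R by rewrite mulr_ge0// normc_ge0.
apply: (@goodP _ B); elim=> [|n IHn].
  by rewrite mulr1 lerDl divr_ge0// ltW.
apply: le_trans (ler_normcD _ _) _; rewrite !Normc.normcM normcJ.
apply: (@le_trans _ _ (normc u * (B * n.+1%:R) + normc K * (M%:R * n.+1%:R))).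
  by apply: lerD; apply: ler_wpM2l => //; exact: normc_ge0.
apply: (@le_trans _ _ (B * n.+1%:R)); last first.
  by rewrite ler_wpM2l ?ler_nat// /B addr_ge0 ?normc_ge0// divr_ge0// ltW.
rewrite !mulrA -mulrDl; apply: ler_wpM2r => //.
have H : (1 - normc u) * B = (1 - normc u) * normc s + normc K * M%:R.
  by rewrite /B mulrDr; congr (_ + _); rewrite mulrC divfK// gt_eqF.
have : 0 <= (1 - normc u) * normc s by rewrite mulr_ge0 ?normc_ge0// ltW.
by move: H; rewrite !mulrBl !mul1r; lra.
Qed.

Lemma filter_outE s x n : filter_out K u s x n =
  (filter_state K u s x n - u * filter_state K u s x n.+1) / K.
Proof.
apply: (mulIf K0); rewrite divfK//= /filter_out; set t := filter_state _ _ _ _ _.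
transitivity (K ^+ 2 * t - u * (K * x n)); first by ring.
have -> : K ^+ 2 = 1 - u * conjc u by rewrite -Ku addrK.
by ring.
Qed.

Lemma good_filter_out s x : good x -> good (filter_out K u s x).
Proof.
move=> gx; have [M sM] := good_filter_state s gx; case: gx => N xN.
apply: (@goodP _ (normc K * M%:R + normc u * N%:R)) => n.
apply: le_trans (ler_normcB _ _) _; rewrite !Normc.normcM mulrDl.
by apply: lerD; rewrite -mulrA ler_wpM2l ?normc_ge0.
Qed.

(** By [filter_outE] the series telescopes at [u], where the evaluation of the
    output recovers the initial state. *)
Lemma power_series_filter_out s x : good x ->
  power_series (filter_out K u s x) u = s / K.
Proof.
move=> gx; apply: (sums_unique (sums_power (good_filter_out s gx) u1)).
apply/sumsP.
have sumE N : \sum_(0 <= n < N) filter_out K u s x n * u ^+ n =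
    (s - u ^+ N * filter_state K u s x N) / K.
  elim: N => [|N IHN]; first by rewrite big_nil expr0 mul1r subrr mul0r.
  rewrite big_nat_recr//= IHN filter_outE.
  by rewrite mulrAC -mulrDl; congr (_ / K); rewrite exprS /=; ring.
have [M sM] := good_filter_state s gx.
have [|A [q [A0 /andP[q0 q1] Aq]]] := @poly_geometric R (normc u).
  by rewrite normc_ge0 u1.
have geo : geometric (M%:R * A * normc K^-1) q @ \oo --> (0 : R).
  by apply: cvg_geometric; rewrite ger0_norm.
apply: (@squeeze_cvgr _ _ _ _ (fun=> 0) (geometric (M%:R * A * normc K^-1) q)) => //;
  last exact: cvg_cst.
apply: nearW => N; rewrite normc_ge0/= sumE.
rewrite (_ : _ - _ = - (u ^+ N * filter_state K u s x N / K)); last by ring.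
rewrite normcN !Normc.normcM normcX [leRHS]mulrAC; apply: ler_wpM2r.
  exact: normc_ge0.
apply: (@le_trans _ _ (normc u ^+ N * (M%:R * N.+1%:R))).
  by apply: ler_wpM2l; [rewrite exprn_ge0 ?normc_ge0|exact: sM].
apply: (@le_trans _ _ (M%:R * (N.+1%:R ^+ 3 * normc u ^+ N))); last first.
  by rewrite -[leRHS]mulrA; apply: ler_wpM2l.
rewrite mulrCA; apply: ler_wpM2l => //; rewrite mulrC; apply: ler_wpM2r => //.
by rewrite exprn_ge0 ?normc_ge0.
Qed.

End filter_series.

End good_sequences.

Section blaschke_quotient.
Context (R : realType).
Local Notation C := (R[i]).
Local Notation cseq := (cseq R).
Local Notation normc := (@Normc.normc R).
Implicit Types (a b x : cseq) (u s : C).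

Definition tail_series u b (j : nat) : C := power_series (iter j (@ctail R) b) u.

(** Coefficients of the quotient by the Blaschke factor at [u] of the power
    series with tail [b] that vanishes at [u]. *)
Definition blaschke_quot u b : cseq := fun n =>
  if n is j.+1 then tail_series u b j.+1 - conjc u * tail_series u b j
  else tail_series u b 0.

Lemma iter_ctail j b n : iter j (@ctail R) b n = b (n + j)%N.
Proof. by elim: j n => [|j IHj] n; rewrite ?addn0// iterS /ctail IHj addSnnS. Qed.

Lemma tail_seriesE u b j : good b -> normc u < 1 ->
  tail_series u b j = b j + u * tail_series u b j.+1.
Proof.
by move=> gb u1; rewrite /tail_series power_series_ctail ?iter_ctail//; exact: good_iter_ctail.
Qed.

Lemma good_blaschke_quot u b : good b -> normc u < 1 -> good (blaschke_quot u b).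
Proof.
move=> gb u1; have [M bM] := gb.
have [|B B0 sumB] := @poly_sums R (normc u); first by rewrite normc_ge0.
have tailB j : normc (tail_series u b j) <= M%:R * j.+1%:R * B.
  have [|n|l sl lB] := sumB (M%:R * j.+1%:R) (fun n => iter j (@ctail R) b n * u ^+ n).
  - by rewrite mulr_ge0.
  - rewrite Normc.normcM normcX mulrA; apply: ler_wpM2r; first by rewrite exprn_ge0 ?normc_ge0.
    rewrite iter_ctail; apply: le_trans (bM _) _.
    rewrite -mulrA ler_wpM2l// -natrX -natrM ler_nat.
    rewrite (@leq_trans (j.+1 * n.+1))//.
      by rewrite mulSn -addSn leq_add2l leq_pmulr.
    by rewrite leq_mul2l/= -[leqLHS]expn1 leq_pexp2l.
  by rewrite /tail_series (sums_unique (sums_power (good_iter_ctail j gb) u1) sl).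
apply: (@goodP _ _ (M%:R * B * 3)) => -[|j] /=.
  apply: le_trans (tailB 0%N) _; rewrite !mulr1 ler_peMr ?ler1n// mulr_ge0//.
apply: le_trans (ler_normcB _ _) _; rewrite Normc.normcM normcJ.
apply: (@le_trans _ _ (M%:R * j.+2%:R * B + 1 * (M%:R * j.+1%:R * B))).
  by apply: lerD => //; apply: ler_pM; rewrite ?normc_ge0 ?(ltW u1).
have MB : 0 <= M%:R * B by rewrite mulr_ge0.
rewrite -[j.+2%:R]natr1 -subr_ge0.
rewrite (_ : _ - _ = M%:R * B * (j.+1%:R + 2)); last by ring.
by rewrite mulr_ge0// addr_ge0.
Qed.

Lemma blaschke_quotP u b : good b -> normc u < 1 ->
  blaschke u (blaschke_quot u b) (ccons (- u * power_series b u) b).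
Proof.
move=> gb u1; split=> // -[|n] /=.
  have := tail_seriesE 0 gb u1; rewrite /tail_series/= => ->.
  by ring.
have := tail_seriesE n gb u1; have := tail_seriesE n.+1 gb u1.
move: (tail_series u b n) (tail_series u b n.+1) (tail_series u b n.+2).
by move=> t0 t1 t2 -> ->; ring.
Qed.

Section filter.
Variables (k : R) (u : C).
Hypotheses (k0 : 0 < k) (ku : k ^+ 2 + normc u ^+ 2 = 1).
Local Notation K := (k%:C)%C.

Lemma tail_series_filter s x j : good x ->
  tail_series u (filter_out K u s x) j = filter_state K u s x j / K.
Proof.
elim: j s x => [|j IHj] s x gx; first exact: power_series_filter_out.
rewrite /tail_series iterSr ctail_filter_out -/(tail_series _ _ _).
by rewrite IHj ?filter_stateS//; exact: good_ctail.
Qed.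

(** The tail values of the output are the states of the filter, up to the
    factor [K], so that the quotient reads off the input. *)
Lemma blaschke_quot_filter s x : good x ->
  blaschke_quot u (filter_out K u s x) = ccons (s / K) x.
Proof.
move=> gx; have K0 : K != 0.
  by apply/eqP => /(congr1 (@complex.Re R)) /= k00; move: k0; rewrite k00 ltxx.
apply/funext => -[|j]; rewrite /blaschke_quot ?tail_series_filter//=.
by rewrite mulrA -mulrBl addrAC subrr add0r mulrAC divff// mul1r.
Qed.

Lemma blaschke_filter c x :
  blaschke u (ccons c x) (ccons (- u * c) (filter_out K u (K * c) x)).
Proof.
have Ku : K ^+ 2 = 1 - u * conjc u.
  by rewrite -normc_sqr -[1]/((1 : R)%:C)%C -ku rmorphD/= rmorphXn addrK.
split=> // -[|n] /=; rewrite /filter_out/=.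
  transitivity (K ^+ 2 * c - u * x 0%N + conjc u * u * c); first by ring.
  by rewrite Ku; ring.
move: (filter_state K u (K * c) x n) => t.
transitivity (K ^+ 2 * x n - u * x n.+1 + conjc u * u * x n); first by ring.
by rewrite Ku; ring.
Qed.

End filter.

End blaschke_quotient.

Section measurable_series.
Context (R : realType).
Local Notation C := (R[i]).
Local Notation cseq := (cseq R).
Local Notation normc := (@Normc.normc R).
Context d (T : measurableType d) (D : set T).
Hypothesis mD : measurable D.

Lemma measurable_sums (c : nat -> T -> C) (f : T -> C) :
  (forall n, measurable_fun D (c n)) -> (forall t, D t -> sums (c^~ t) (f t)) ->
  measurable_fun D f.
Proof.
move=> mc cf.
have mS n := @measurable_fun_sumc _ _ T D c n mc.
have part (p : C -> R) : (forall z w, `|p z - p w| <= normc (z - w)) ->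
    measurable_fun setT p -> measurable_fun D (p \o f).
  move=> pL mp; apply: (@measurable_fun_cvg _ _ _ D
      (fun n t => p (\sum_(0 <= k < n) c k t))).
    by move=> n; exact: (measurableT_comp mp (mS n)).
  move=> t Dt; have /sumsP tf := cf t Dt.
  apply/cvgrPdist_le => e e0; have /cvgrPdist_le/(_ e e0) := tf.
  apply: filterS => n; rewrite sub0r normrN ger0_norm ?normc_ge0// => ne.
  by rewrite /=; apply: le_trans (pL _ _) _; rewrite normc_distC.
apply/measurable_complexP; split; apply: part.
- by move=> z w; apply: le_trans (normr_Re_le (z - w)); case: z w => [? ?] [].
- exact: measurable_Re.
- by move=> z w; apply: le_trans (normr_Im_le (z - w)); case: z w => [? ?] [].
- exact: measurable_Im.
Qed.

Variables (b : T -> cseq) (u : T -> C).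
Hypotheses (mb : measurable_fun D b) (mu : measurable_fun D u).
Hypotheses (gb : forall t, D t -> good (b t)) (u1 : forall t, D t -> normc (u t) < 1).

Let mbn n : measurable_fun D (fun t => b t n).
Proof. exact: (measurableT_comp (measurable_coord n) mb). Qed.

Lemma measurable_power_series : measurable_fun D (fun t => power_series (b t) (u t)).
Proof.
apply: (@measurable_sums (fun n t => b t n * u t ^+ n)) => [n|t Dt].
  by apply: measurable_fun_mulc => //; exact: measurable_fun_expc.
by apply: sums_power; [exact: gb|exact: u1].
Qed.

Lemma measurable_series_quot :
  measurable_fun D (fun t => series_quot (b t) (u t) (u t)).
Proof.
apply: (@measurable_sums (fun n t => b t n * power_quot n (u t) (u t))) => [n|t Dt].
  apply: measurable_fun_mulc => //; elim: n => [|n IHn] /=; first exact: measurable_cst.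
  by apply: measurable_fun_addc; [exact: measurable_fun_mulc|exact: measurable_fun_expc].
pose r := (1 + normc (u t)) / 2; have ut := u1 Dt; have u0 := normc_ge0 (u t).
have r01 : 0 < r < 1 by rewrite /r; apply/andP; split; lra.
have [K _ /(_ (u t) (u t))[||//]] := sums_series_quot (gb Dt) r01.
- by rewrite /r; lra.
- by rewrite /r; lra.
Qed.

End measurable_series.

Lemma measurable_blaschke_quot (R : realType) d (T : measurableType d) (D : set T)
    (b : T -> cseq R) (u : T -> R[i]) : measurable D ->
  measurable_fun D b -> measurable_fun D u ->
  (forall t, D t -> good (b t)) -> (forall t, D t -> Normc.normc (u t) < 1) ->
  measurable_fun D (fun t => blaschke_quot (u t) (b t)).
Proof.
move=> mD mb mu gb u1.
have mB j : measurable_fun D (fun t => tail_series (u t) (b t) j).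
  apply: measurable_power_series => // [|t Dt]; last exact: good_iter_ctail (gb t Dt).
  elim: j => // j IHj.
  exact: (measurableT_comp (@measurable_ctail R) IHj).
apply: measurable_fun_cseq => -[|j] /=; first exact: mB.
apply: measurable_fun_subc => //; apply: measurable_fun_mulc => //.
exact: measurable_fun_conjc.
Qed.

(** * Growth of Gaussian coefficients *)

Section gaussian_growth.
Context (R : realType).
Local Notation C := (R[i]).
Local Notation cseq := (cseq R).
Local Notation lebC := (@lebesgue_complex R).
Local Notation normc := (@Normc.normc R).
Local Notation Re := (@complex.Re R).
Local Notation Im := (@complex.Im R).
Variables (nu : probability C R) (gam : probability cseq R).
Hypothesis nuE : forall A : set C, measurable A ->
  nu A = (\int[lebC]_(z in A) (gauss_density z)%:E)%E.
Hypothesis gamE : forall l, measurable_seq l ->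
  gam (cylinder l) = (\prod_(B <- l) nu B)%E.

Let pdf (x : R) : R := normal_pdf 0 1 x.

Let measurable_pdf2 : measurable_fun setT (fun z : C => pdf (Re z) * pdf (Im z)).
Proof.
apply: measurable_funM.
  exact: (measurableT_comp (measurable_normal_pdf 0 1) (@measurable_Re R)).
exact: (measurableT_comp (measurable_normal_pdf 0 1) (@measurable_Im R)).
Qed.

Let integral_pdf2 : (\int[lebC]_z (pdf (Re z) * pdf (Im z))%:E <= 1)%E.
Proof.
have := @ge0_integral_pushforward _ _ (measurableTypeR R * measurableTypeR R)%type C R _
  (@measurable_of_Re_Im R) (product_measure1 (@lebesgue_measure R) (@lebesgue_measure R))
  setT (fun z => (pdf (Re z) * pdf (Im z))%:E) measurableT.
rewrite preimage_setT => H.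
apply: (@le_trans _ _ (\int[product_measure1 (@lebesgue_measure R) (@lebesgue_measure R)]_p
    (pdf p.1 * pdf p.2)%:E)%E).
  rewrite le_eqVlt; apply/orP; left; apply/eqP; apply: H.
    exact/measurable_EFinP.
  by move=> z _; rewrite lee_fin mulr_ge0 ?normal_pdf_ge0.
have mf : measurable_fun setT (fun p : measurableTypeR R * measurableTypeR R => (pdf p.1 * pdf p.2)%:E).
  apply/measurable_EFinP; apply: measurable_funM.
    exact: (measurableT_comp (measurable_normal_pdf 0 1) measurable_fst).
  exact: (measurableT_comp (measurable_normal_pdf 0 1) measurable_snd).
rewrite (fubini_tonelli1 _ mf); last first.
  by move=> p; rewrite lee_fin mulr_ge0 ?normal_pdf_ge0.
rewrite le_eqVlt; apply/orP; left; apply/eqP.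
rewrite -(@integral_normal_pdf R 0 1); apply: eq_integral => x _.
rewrite /fubini_F /=; under eq_integral do rewrite EFinM.
rewrite ge0_integralZl//.
- by rewrite integral_normal_pdf mule1.
- by apply/measurable_EFinP; exact: measurable_normal_pdf.
- by move=> y _; rewrite lee_fin normal_pdf_ge0.
- by rewrite lee_fin normal_pdf_ge0.
Qed.

Lemma measurable_normc_gt (t : R) : measurable [set z : C | (t < normc z)%R].
Proof.
have mn : measurable_fun setT (fun z : C => normc z) by apply: measurable_fun_normc.
rewrite -[X in measurable X]setTI (_ : [set z | _] = normc @^-1` `]t, +oo[).
  by apply: mn => //; exact: measurable_itv.
by apply/seteqP; split=> z /=; rewrite in_itv/= andbT.
Qed.

(** Half of the exponent gives the tail bound, the other half is the density of
    an integrable Gaussian. *)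
Lemma gauss_tail : exists2 c : R, 0 <= c & forall t : R, 0 <= t ->
  (nu [set z | (t < normc z)%R] <= (c * expR (- (t ^+ 2 / 2)))%:E)%E.
Proof.
have p0 : 0 < normal_peak 1 :> R by rewrite normal_peak_gt0// oner_neq0.
pose c : R := pi^-1 / normal_peak 1 ^+ 2.
have c0 : 0 <= c by rewrite divr_ge0 ?invr_ge0 ?pi_ge0 ?exprn_ge0// ltW.
exists c => // t t0; rewrite nuE; last exact: measurable_normc_gt.
have pdfE x : pdf x = normal_peak 1 * expR (- (x ^+ 2 / 2)).
  rewrite /pdf normal_pdfE ?oner_neq0//; congr (_ * expR _).
  by rewrite subr0 expr1n mulNr.
have densE z : gauss_density z = c * expR (- (normc z ^+ 2 / 2)) * (pdf (Re z) * pdf (Im z)).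
  rewrite !pdfE.
  transitivity (c * normal_peak 1 ^+ 2 * (expR (- (normc z ^+ 2 / 2)) *
    (expR (- (Re z ^+ 2 / 2)) * expR (- (Im z ^+ 2 / 2))))); last by ring.
  rewrite -!expRD /c divfK ?gt_eqF ?exprn_gt0//; congr (_ * expR _).
  case: z => x y /=; rewrite sqr_sqrtr ?addr_ge0 ?sqr_ge0//.
  by field.
have mP := measurable_pdf2.
apply: (@le_trans _ _ (\int[lebC]_(z in [set z | (t < normc z)%R])
    ((c * expR (- (t ^+ 2 / 2)))%:E * (pdf (Re z) * pdf (Im z))%:E))%E).
  apply: ge0_le_integral => //.
  - exact: measurable_normc_gt.
  - by move=> z _; rewrite lee_fin gauss_density_ge0.
  - by apply/measurable_EFinP; apply: measurable_funTS; exact: measurable_gauss_density.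
  - by apply: emeasurable_funM => //; apply/measurable_EFinP; exact: measurable_funTS.
  - move=> z /= tz; rewrite -EFinM lee_fin densE; apply: ler_wpM2r.
      by rewrite mulr_ge0 ?normal_pdf_ge0.
    apply: ler_wpM2l => //; rewrite ler_expR lerN2 ler_pM2r//.
    by apply: lerXn2r; rewrite ?nnegrE ?normc_ge0// ltW.
rewrite ge0_integralZl//; last 4 first.
- exact: measurable_normc_gt.
- by apply/measurable_EFinP; exact: measurable_funTS.
- by move=> z _; rewrite lee_fin mulr_ge0 ?normal_pdf_ge0.
- by rewrite lee_fin mulr_ge0 ?expR_ge0.
rewrite -[leRHS]mule1; apply: lee_wpmul2l; first by rewrite lee_fin mulr_ge0 ?expR_ge0.
apply: le_trans integral_pdf2; apply: ge0_subset_integral => //.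
- exact: measurable_normc_gt.
- exact/measurable_EFinP.
- by move=> z _; rewrite lee_fin mulr_ge0 ?normal_pdf_ge0.
Qed.

Lemma gaussian_seq_coord n (B : set C) : measurable B ->
  gam [set a : cseq | B (a n)] = nu B.
Proof.
move=> mB; have -> : [set a : cseq | B (a n)] = cylinder (rcons (nseq n setT) B).
  elim: n => [|n IHn] /=; first by apply/seteqP; split=> a //= [].
  rewrite -IHn; apply/seteqP; split=> a /=; last by case.
  by split.
rewrite gamE; last first.
  by move=> X; rewrite mem_rcons inE => /orP[/eqP ->//|/nseqP[-> _]]; exact: measurableT.
elim: n => [|n IHn] /=; first by rewrite big_seq1.
by rewrite big_cons IHn probability_setT mul1e.
Qed.

(** Borel-Cantelli: the tail bound of [a n] at height proportional to [n] is
    summable. *)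
Lemma gaussian_seq_good : gam (~` [set a | good a]) = 0%E.
Proof.
have [c c0 cT] := gauss_tail.
have mE M n : measurable [set a : cseq | (M%:R * n.+1%:R < normc (a n))%R].
  have mn : measurable_fun setT (fun a : cseq => normc (a n)).
    by apply: measurable_fun_normc; exact: measurable_coord.
  rewrite -[X in measurable X]setTI.
  rewrite (_ : [set a : cseq | _] = (fun a : cseq => normc (a n)) @^-1` `]M%:R * n.+1%:R, +oo[).
    by apply: mn => //; exact: measurable_itv.
  by apply/seteqP; split=> a /=; rewrite in_itv/= andbT.
have mG := measurableC (@measurable_good R).
apply/eqP; rewrite -measure_le0; apply/lee_addgt0Pr => e e0; rewrite add0e.
(* the union bound over n for growth rate M is at most c times 2 / M *)
have bound (M : nat) : (2 <= M)%N -> (gam (~` [set a | good a]) <= (2 * c * (2 / M%:R))%:E)%E.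
  move=> M2; have M0 : 0 < M%:R :> R by rewrite ltr0n (leq_trans _ M2).
  pose q : R := expR (- (M%:R / 2)).
  have q0 : 0 <= q by exact: expR_ge0.
  have qM : q <= 2 / M%:R.
    rewrite /q expRN -[2 / _]invrK invf_div lef_pV2 ?posrE ?expR_gt0 ?divr_gt0//.
    by apply: le_trans (expR_ge1Dx _); rewrite lerDr.
  have q2 : q <= 2^-1.
    rewrite /q expRN lef_pV2 ?posrE ?expR_gt0//; apply: le_trans (expR_ge1Dx _).
    have : (2 : R) <= M%:R by rewrite ler_nat.
    by lra.
  apply: (@le_trans _ _ (\sum_(0 <= n <oo) gam [set a : cseq | (M%:R * n.+1%:R < normc (a n))%R])%E).
    apply: measure_sigma_subadditive => // a /= ga; apply: contrapT => H.
    by apply: ga; exists M => n; rewrite leNgt; apply/negP => Hn; apply: H; exists n.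
  apply: (@le_trans _ _ (\sum_(0 <= n <oo) (2 * c * q / (2 ^ n.+1)%:R)%:E)%E).
    apply: lee_nneseries => // n _.
    rewrite (@gaussian_seq_coord n [set z | (M%:R * n.+1%:R < normc z)%R]); last first.
      exact: measurable_normc_gt.
    apply: le_trans (cT _ _) _; rewrite ?mulr_ge0// lee_fin.
    rewrite (_ : 2 * c * q / _ = c * (2 * q / (2 ^ n.+1)%:R)); last by ring.
    apply: ler_wpM2l => //.
    apply: (@le_trans _ _ (q ^+ n.+1)).
      rewrite /q -expRM_natl ler_expR mulrN lerN2 mulrA ler_pM2r//.
      have t1 : 1 <= M%:R * n.+1%:R :> R.
        by rewrite -natrM ler1n muln_gt0 (leq_trans _ M2).
      by rewrite [n.+1%:R * _]mulrC expr2 ler_peMr// (le_trans ler01).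
    rewrite exprS [(2 ^ n.+1)%N]expnS natrM invfM mulrACA mulfV// mul1r.
    apply: ler_wpM2l => //; rewrite natrX -exprVn.
    by apply: lerXn2r; rewrite ?nnegrE// invr_ge0.
  apply: le_trans; first by apply: epsilon_trick0; rewrite !mulr_ge0.
  by rewrite lee_fin ler_wpM2l// mulr_ge0.
pose M := (Num.truncn (4 * c / e)).+2.
apply: le_trans (bound M isT) _; rewrite lee_fin.
have -> : 2 * c * (2 / M%:R) = 4 * c / M%:R by ring.
have HM : 4 * c / e <= M%:R.
  by apply: ltW; apply: lt_le_trans (truncnS_gt (4 * c / e)) _; rewrite /M ler_nat.
by rewrite ler_pdivrMr ?ltr0n// [leRHS]mulrC -ler_pdivrMr.
Qed.

End gaussian_growth.

(** * The first coefficient as a function of a zero *)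

Section zero_map.
Context (R : realType).
Local Notation C := (R[i]).
Local Notation cseq := (cseq R).
Local Notation lebC := (@lebesgue_complex R).
Local Notation normc := (@Normc.normc R).
Implicit Types (a b : cseq) (u : C).

(** The head that makes [u] a zero of the power series with tail [b]. *)
Definition zero_head b u : C := - u * power_series b u.

Let opp_shift b : cseq := ccons 0 (fun n => - b n).

Lemma good_opp_shift b : good b -> good (opp_shift b).
Proof. by move=> [M bM]; apply: good_ccons; exists M => n; rewrite normcN. Qed.

Let power_series_opp b u : good b -> normc u < 1 ->
  power_series (fun n => - b n) u = - power_series b u.
Proof.
move=> gb u1; have gn : good (fun n => - b n).
  by case: gb => M bM; exists M => n; rewrite normcN.
apply: sums_unique (sums_power gn u1) _.
have := sumsN (sums_power gb u1); congr sums.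
by apply/funext => n; exact/esym/mulNr.
Qed.

Lemma zero_headE b u : good b -> normc u < 1 ->
  zero_head b u = power_series (opp_shift b) u.
Proof.
move=> gb u1; rewrite (power_series_ctail (good_opp_shift gb) u1) add0r.
by rewrite /zero_head mulNr -mulrN -power_series_opp.
Qed.

(** The derivative of [zero_head b] at [u]. *)
Definition zero_head_deriv b u : C := series_quot (opp_shift b) u u.

(** Countably many dyadic cells cover [X] by pieces with negligible image. *)
Lemma negligible_local (X : set C) (f : C -> C) :
  (forall x, X x -> exists2 e, 0 < e &
    forall Y, Y `<=` X -> (forall y, Y y -> normc (y - x) < e) ->
      lebC.-negligible (f @` Y)) ->
  lebC.-negligible (f @` X).
Proof.
move=> loc.
pose cellX n ij := X `&` dyadic_cell n ij.
pose F (p : nat) : set C := if pickle_inv p is Some (n, ij) then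
  if `[< lebC.-negligible (f @` cellX n ij) >] then cellX n ij else set0 else set0.
apply: (@negligibleS _ _ _ _ (\bigcup_p f @` F p)); last first.
  apply: negligible_bigcup => p; rewrite /F; case: (pickle_inv p) => [[n ij]|].
    by case: asboolP => // _; rewrite image_set0; exact: negligible_set0.
  by rewrite image_set0; exact: negligible_set0.
move=> _ [x Xx <-]; have [e e0 eN] := loc x Xx.
have [n ne] : exists n, 2 * (2 ^+ n)^-1 < e.
  exists (Num.truncn (2 / e)).+1; rewrite ltr_pdivrMr ?exprn_gt0// mulrC -ltr_pdivrMr//.
  by rewrite (lt_trans (truncnS_gt _))// -natrX ltr_nat ltn_expl.
have [p Ep] : exists p, pickle_inv p = Some (n, dyadic_index n x).
  by eexists; exact: pickleK_inv.
exists p => //; exists x => //; rewrite /F Ep; case: asboolP => // H; exfalso; apply: H.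
apply: eN => // [y [//]|y [_ yx]].
by apply: le_lt_trans ne; apply: dyadic_index_dist.
Qed.

Let radius u : normc u < 1 -> exists2 r, 0 < r < 1 & exists2 e, 0 < e &
  forall v, normc (v - u) < e -> normc v <= r.
Proof.
move=> u1; have u0 := normc_ge0 u; exists ((1 + normc u) / 2); first by apply/andP; split; lra.
exists ((1 - normc u) / 2) => [|v vu]; first by lra.
have := ler_normcD (v - u) u; rewrite subrK; lra.
Qed.

Lemma negligible_image_zero_head b (X : set C) : good b ->
  (forall u, X u -> normc u < 1) -> lebC.-negligible X ->
  lebC.-negligible (zero_head b @` X).
Proof.
move=> gb X1 nX; apply: negligible_local => x Xx.
have [r r01 [e e0 er]] := radius (X1 _ Xx); exists e => // Y YX Ye.
have [K K0 Kq] := sums_series_quot (good_opp_shift gb) r01.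
apply: (@lipschitz_null R C Y (zero_head b) id K) => //.
  by rewrite image_id; exact: negligibleS nX.
move=> u v Yu Yv; rewrite !zero_headE//; [|exact/X1/YX|exact/X1/YX].
rewrite power_series_diff; [|exact: good_opp_shift|exact/X1/YX|exact/X1/YX].
rewrite Normc.normcM mulrC; apply: ler_wpM2r; first exact: normc_ge0.
by have [_] := Kq u v (er _ (Ye _ Yu)) (er _ (Ye _ Yv)).
Qed.

(** Near a point where its derivative does not vanish, [zero_head b] does not
    contract distances too much. *)
Lemma negligible_preimage_zero_head b (X : set C) (N : set C) : good b ->
  (forall u, X u -> [/\ normc u < 1, N (zero_head b u) & zero_head_deriv b u <> 0]) ->
  lebC.-negligible N -> lebC.-negligible X.
Proof.
move=> gb XP nN; rewrite -[X]image_id; apply: negligible_local => x Xx.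
have [x1 Nx dx] := XP _ Xx.
have [r r01 [e e0 er]] := radius x1.
have [K K0 Kq] := series_quot_cont (good_opp_shift gb) r01.
pose m := normc (zero_head_deriv b x).
have m0 : 0 < m.
  rewrite lt_neqAle normc_ge0 andbT eq_sym; apply/eqP => /Normc.eq0_normc; exact: dx.
pose e' := Num.min e (m / (2 * (K + 1))).
have K1 : 0 < 2 * (K + 1) by rewrite mulr_gt0// ltr_wpDl.
have e'0 : 0 < e' by rewrite lt_min e0 divr_gt0.
exists e' => // Y YX Ye.
apply: (@lipschitz_null R C Y id (zero_head b) (2 / m)).
- by apply: negligibleS nN => _ [y Yy <-]; have [] := XP _ (YX _ Yy).
- by rewrite divr_ge0// ltW.
move=> u v Yu Yv.
have [u1 _ _] := XP _ (YX _ Yu); have [v1 _ _] := XP _ (YX _ Yv).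
rewrite !zero_headE// power_series_diff//; last exact: good_opp_shift.
have xe : normc (x - x) < e.
  by rewrite subrr (_ : normc _ = 0)//; exact: Normc.normc0.
have near y : Y y -> normc y <= r /\ normc (y - x) <= m / (2 * (K + 1)).
  by move=> /Ye; rewrite lt_min => /andP[/er ? /ltW].
have [ur ux] := near u Yu; have [vr vx] := near v Yv.
have := Kq u v x _ ur vr (er _ xe) ux vx; rewrite -/(zero_head_deriv b x) => dq.
have qm : m / 2 <= normc (series_quot (opp_shift b) u v).
  have : m <= normc (series_quot (opp_shift b) u v) +
              normc (series_quot (opp_shift b) u v - zero_head_deriv b x).
    rewrite normc_distC; apply: le_trans (ler_normcD _ _).
    by rewrite addrC subrK.
  have : K * (m / (2 * (K + 1))) <= m / 2.
    rewrite mulrA ler_pdivrMr// (_ : m / 2 * _ = m * (K + 1)); last by field.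
    by rewrite mulrC ler_pM2l// lerDl.
  move: dq; set s := normc (_ - _); set t := normc (series_quot _ _ _).
  by move=> ? ? ?; lra.
rewrite Normc.normcM mulrCA -[leLHS]mulr1; apply: ler_wpM2l; first exact: normc_ge0.
by rewrite mulrAC ler_pdivlMr// mul1r; lra.
Qed.

Lemma zero_head_deriv_unique (c c' : C) b u : good b -> normc u < 1 ->
  zero_head_deriv (ccons c b) u = 0 -> zero_head_deriv (ccons c' b) u = 0 -> c = c'.
Proof.
move=> gb u1 d0 d0'; have [r r01 [e e0 er]] := radius u1.
have uu : normc u <= r.
  by apply: er; rewrite subrr (_ : normc _ = 0)//; exact: Normc.normc0.
have S x : zero_head_deriv (ccons x b) u = 0 ->
    sums (fun n => opp_shift (ccons x b) n.+2 * power_quot n.+2 u u) x.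
  move=> x0; have [K _ /(_ u u uu uu)[+ _]] := sums_series_quot (good_opp_shift (good_ccons x gb)) r01.
  rewrite -/(zero_head_deriv _ _) x0 => /sums_shift/sums_shift.
  by rewrite /= !(mulr0, oppr0, add0r, expr0, mulr1, opprK).
exact: sums_unique (S c d0) (S c' d0').
Qed.

End zero_map.

(** * Adding and removing a zero of a Gaussian power series *)

Section zero_surgery.
Context (R : realType).
Local Notation C := (R[i]).
Local Notation cseq := (cseq R).
Local Notation lebC := (@lebesgue_complex R).
Local Notation normc := (@Normc.normc R).
Implicit Types (a b : cseq) (u : C).

Definition szego (u : C) : R := Num.sqrt (1 - normc u ^+ 2).

Local Notation K u := ((szego u)%:C)%C.

Lemma szego_gt0 u : normc u < 1 -> 0 < szego u.
Proof.
by move=> u1; rewrite sqrtr_gt0 subr_gt0 expr_lt1// normc_ge0.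
Qed.

Lemma szegoE u : normc u < 1 -> szego u ^+ 2 + normc u ^+ 2 = 1.
Proof.
by move=> u1; rewrite sqr_sqrtr ?subrK// subr_ge0 expr_le1 ?normc_ge0// ltW.
Qed.

(** Coefficients of the product with the Blaschke factor at [u]. *)
Definition add_zero u a : cseq :=
  ccons (- u * a 0%N) (filter_out (K u) u (K u * a 0%N) (ctail a)).

Lemma blaschke_add_zero u a : normc u < 1 -> blaschke u a (add_zero u a).
Proof.
move=> u1; have := blaschke_filter (szegoE u1) (a 0%N) (ctail a).
by rewrite ccons_tail.
Qed.

Lemma measurable_add_zero u : measurable_fun setT (add_zero u).
Proof.
have mc (c : C) : measurable_fun setT (fun a : cseq => c * a 0%N).
  by apply: measurable_fun_mulc => //; exact: measurable_coord.
apply: measurable_ccons; first exact: mc.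
by apply: measurable_filter_out => //; exact: measurable_ctail.
Qed.

Lemma good_add_zero u a : normc u < 1 -> good a -> good (add_zero u a).
Proof.
move=> u1 ga; apply: good_ccons; apply: good_filter_out; last exact: good_ctail.
- exact: szego_gt0.
- exact: szegoE.
Qed.

Variables (nu : probability C R) (gam : probability cseq R).
Hypothesis nuE : forall A : set C, measurable A ->
  nu A = (\int[lebC]_(z in A) (gauss_density z)%:E)%E.
Hypothesis gamE : forall l, measurable_seq l ->
  gam (cylinder l) = (\prod_(B <- l) nu B)%E.

Let mgood := @measurable_good R.

Let good_ae : gam.-negligible (~` [set a | good a]).
Proof. by apply/negligibleP; [exact: measurableC|exact: gaussian_seq_good nuE gamE]. Qed.

(** Given the tail, at most one value of the head is left, and points are null. *)
Lemma null_head (A : set cseq) : measurable A ->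
  (forall b c c', good b -> A (ccons c b) -> A (ccons c' b) -> c = c') ->
  gam A = 0%E.
Proof.
move=> mA A1; apply/(gaussian_seq_null gamE mA).
apply: (@negligibleS _ _ _ _ _ _ _ good_ae) => b /=; apply: contra_not => gb.
have point z : nu [set z] = 0%E.
  apply/(gauss_null nuE (measurable_complex1 z)).
  rewrite (_ : [set z] = [set w : C | [set complex.Re z] (complex.Re w) /\
                                 [set complex.Im z] (complex.Im w)]).
    by rewrite lebesgue_complex_rect ?lebesgue_measure_set1 ?mul0e//; exact: measurable_set1.
  by apply/seteqP; split=> [w ->//|]; case: z => x y [s t] /= [-> ->].
have [[c Ac]|noA] := pselect (exists c, A (ccons c b)).
  rewrite (_ : [set c | _] = [set c]) ?point//.
  by apply/seteqP; split=> [c' Ac'|c' ->//]; exact: A1 Ac' Ac.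
rewrite (_ : [set c | _] = set0) ?measure0//.
by apply/seteqP; split=> // c Ac; apply: noA; exists c.
Qed.

Let measurable_disc_good :
  measurable [set p : C * cseq | normc p.1 < 1 /\ good p.2].
Proof.
rewrite (_ : [set p | _] = [set z : C | ~ (1 <= normc z)] `*` [set b : cseq | good b]).
  apply: measurableX => //.
  rewrite -[X in measurable X]setTI (_ : [set z | _] = normc @^-1` `]-oo, 1[).
    have mn : measurable_fun setT (fun z : C => normc z) by apply: measurable_fun_normc.
    by apply: mn => //; exact: measurable_itv.
  by apply/seteqP; split=> z /=; rewrite in_itv/= ltNge => /negP.
by apply/seteqP; split=> -[z b] /= [+ ?]; rewrite ltNge => /negP.
Qed.

Local Notation DG := [set p : C * cseq | normc p.1 < 1 /\ good p.2].

Let mfst : measurable_fun DG (fun p : C * cseq => p.1).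
Proof. by apply: measurable_funTS; exact: measurable_fst. Qed.

Let msnd : measurable_fun DG (fun p : C * cseq => p.2).
Proof. by apply: measurable_funTS; exact: measurable_snd. Qed.

Let xsectionE (A : set (C * cseq)) u : xsection A u = [set b | A (u, b)].
Proof. by apply/seteqP; split=> b; rewrite /xsection/= inE. Qed.

Let ysectionE (A : set (C * cseq)) b : ysection A b = [set u | A (u, b)].
Proof. by apply/seteqP; split=> u; rewrite /ysection/= inE. Qed.

Let measurable_filter_head (S : set cseq) u : measurable S ->
  measurable [set a : cseq | S (filter_out (K u) u (a 0%N) (ctail a))].
Proof.
move=> mS; rewrite -[X in measurable X]setTI; apply: measurable_filter_out => //.
- exact: measurable_coord.
- exact: measurable_ctail.
Qed.

(** At a given point the derivative of [zero_head b] is [- b 0] plus a function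
    of the tail of [b], hence almost surely nonzero; Fubini exchanges the roles
    of the point and of [b]. *)
Let deriv_ae : {ae gam, forall b,
  lebC.-negligible [set u | [/\ normc u < 1, good b & zero_head_deriv b u = 0]]}.
Proof.
pose Z := DG `&` [set p | zero_head_deriv p.2 p.1 = 0].
have mZ : measurable Z.
  apply: measurable_fun_eq0c => //.
  apply: measurable_series_quot => // [|p [_ gp]|p []//]; last exact: good_opp_shift.
  apply: measurable_ccons; first exact: measurable_cst.
  apply: measurable_fun_cseq => n; apply: measurable_fun_oppc.
  exact: (measurableT_comp (@measurable_coord R n) msnd).
have Z0 : (product_measure1 lebC gam) Z = 0%E.
  apply/(null_xsection lebC gam mZ); apply: aeW => u.
  apply: null_head; first exact: measurable_xsection.
  rewrite xsectionE => b c c' gb [[/= u1 _] d0] [_ /= d0'].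
  exact: zero_head_deriv_unique gb u1 d0 d0'.
have /(null_ysection lebC gam mZ) := Z0.
apply: filterS => b Zb; apply: (@negligibleS _ _ _ _ (ysection Z b)).
  by rewrite ysectionE => u [u1 gb d0].
by apply/negligibleP => //; exact: measurable_ysection.
Qed.

(** For almost every tail [b], only a null set of points [u] has a head
    [zero_head b u] that completes [b] to an element of [A]. Hence for almost
    every [u] the tails [b] that are so completed form a null event, and the tail
    of [add_zero u a] is the output of the filter. *)
Lemma core_insertion (A : set cseq) : measurable A -> gam A = 0%E ->
  lebC.-negligible [set u | normc u < 1 /\ gam [set a | A (add_zero u a)] <> 0%E].
Proof.
move=> mA A0.
pose M := DG `&` [set p | A (ccons (zero_head p.2 p.1) p.2)].
have mM : measurable M.
  have mc : measurable_fun DG (fun p : C * cseq => ccons (zero_head p.2 p.1) p.2).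
    apply: measurable_ccons => //; apply: measurable_fun_mulc.
      exact: measurable_fun_oppc.
    by apply: measurable_power_series => // p [].
  exact: mc.
have M0 : (product_measure1 lebC gam) M = 0%E.
  apply/(null_ysection lebC gam mM).
  have /(gaussian_seq_null gamE mA) := A0.
  apply: filterS2 deriv_ae => b db Ab.
  rewrite ysectionE; apply/negligibleP; first by rewrite -ysectionE; exact: measurable_ysection.
  have mAb : measurable [set c | A (ccons c b)].
    by rewrite -[X in measurable X]setTI; apply: measurable_ccons.
  have [gb|ngb] := pselect (good b); last first.
    by apply: (@negligibleS _ _ _ _ set0); [move=> u [[_]]|exact: negligible_set0].
  apply: (@negligibleS _ _ _ _ ([set u | [/\ normc u < 1, good b & zero_head_deriv b u = 0]] `|`
    [set u | [/\ normc u < 1, A (ccons (zero_head b u) b) & zero_head_deriv b u <> 0]])).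
    move=> u [[u1 _] Au].
    by have [d0|d0] := pselect (zero_head_deriv b u = 0); [left|right].
  apply: negligibleU => //.
  apply: (@negligible_preimage_zero_head _ b _ [set c | A (ccons c b)]) => //.
  by apply/negligibleP => //; apply/(gauss_null nuE mAb).
have /(null_xsection lebC gam mM) := M0.
apply: negligibleS => u [u1 Au] /= Mu; apply: Au.
have k0 := szego_gt0 u1; have ku := szegoE u1.
have K0 : K u != 0.
  by apply/eqP => /(congr1 (@complex.Re R)) /= k00; move: k0; rewrite k00 ltxx.
pose S := xsection M u; have mS : measurable S by exact: measurable_xsection.
pose S' := [set a : cseq | S (filter_out (K u) u (a 0%N) (ctail a))].
have mS' : measurable S' by exact: measurable_filter_head.
have S'0 : gam S' = 0%E by rewrite (filter_out_law nuE gamE (ltW k0) ku mS).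
have T0 := scale_head_null nuE gamE K0 mS' S'0.
have mT : measurable [set a : cseq | S' (ccons (K u * a 0%N) (ctail a))].
  rewrite -[X in measurable X]setTI; apply: measurable_ccons => //; last exact: measurable_ctail.
  by apply: measurable_fun_mulc; [exact: measurable_cst|exact: measurable_coord].
apply/negligibleP.
  by rewrite -[X in measurable X]setTI; exact: measurable_add_zero.
apply: (@negligibleS _ _ _ _ (~` [set a | good a] `|`
    [set a : cseq | S' (ccons (K u * a 0%N) (ctail a))])); last first.
  by apply: negligibleU => //; apply/negligibleP.
move=> a Aa; have [ga|] := pselect (good a); [right|by left].
have gt := good_ctail ga.
have gW : good (filter_out (K u) u (K u * a 0%N) (ctail a)) by exact: good_filter_out.
rewrite /S' /S xsectionE /=; split => //=.
rewrite /zero_head (power_series_filter_out k0 ku _ gt).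
by rewrite mulrAC divff// mul1r.
Qed.

(** For a given [u], the quotient [blaschke_quot u b] of a Gaussian tail [b] has
    a law with the null sets of [gam] ([blaschke_quot_filter]), so that for almost
    every [b] it is in [A], or vanishes at [u], only for a null set of points [u].
    The heads of the elements of [E] with tail [b] are in the image of this set
    under [zero_head b]. *)
Lemma core_deletion (A E : set cseq) : measurable A -> gam A = 0%E ->
  measurable E ->
  (forall a, E a -> good a -> exists u, [/\ normc u < 1, power_series a u = 0 &
     A (blaschke_quot u (ctail a)) \/ power_series (blaschke_quot u (ctail a)) u = 0]) ->
  gam E = 0%E.
Proof.
move=> mA A0 mE EP.
pose bad u h := A h \/ power_series h u = 0.
pose M := DG `&` [set p | bad p.1 (blaschke_quot p.1 p.2)].
have mq : measurable_fun DG (fun p : C * cseq => blaschke_quot p.1 p.2).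
  by apply: measurable_blaschke_quot => // p [].
have mM : measurable M.
  rewrite (_ : M = (DG `&` (fun p : C * cseq => blaschke_quot p.1 p.2) @^-1` A) `|`
      (DG `&` [set p | power_series (blaschke_quot p.1 p.2) p.1 = 0])).
    apply: measurableU; first exact: mq.
    apply: measurable_fun_eq0c => //; apply: measurable_power_series => // p [u1 gp] //.
    exact: good_blaschke_quot.
  by rewrite -setIUr.
have M0 : (product_measure1 lebC gam) M = 0%E.
  apply/(null_xsection lebC gam mM); apply: aeW => u.
  have [u1|u1] := pselect (normc u < 1); last first.
    by rewrite xsectionE (_ : [set b | _] = set0) ?measure0//; apply/seteqP; split=> // b [[]].
  have k0 := szego_gt0 u1; have ku := szegoE u1.
  have K0 : K u != 0.
    by apply/eqP => /(congr1 (@complex.Re R)) /= k00; move: k0; rewrite k00 ltxx.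
  have mS : measurable (xsection M u) by exact: measurable_xsection.
  apply: (etrans (esym (filter_out_law nuE gamE (ltW k0) ku mS))).
  pose G := [set h : cseq | good h].
  have mps : measurable_fun G (fun h : cseq => power_series h u).
    have := @measurable_power_series R _ _ G (fun h : cseq => h) (fun=> u).
    by apply=> //; exact: measurable_id.
  pose A' := A `|` (G `&` [set h | power_series h u = 0]).
  have mZ : measurable (G `&` [set h : cseq | power_series h u = 0]).
    exact: measurable_fun_eq0c.
  have Z0 : gam (G `&` [set h : cseq | power_series h u = 0]) = 0%E.
    apply: null_head => // b c c' gb [gc /= c0] [gc' /= c0'].
    move: c0 c0'; rewrite (power_series_ctail gc u1) (power_series_ctail gc' u1).
    by move=> /= /eqP; rewrite addr_eq0 => /eqP -> /eqP; rewrite addr_eq0 => /eqP ->.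
  have mA' : measurable A' by exact: measurableU.
  have A'0 : gam A' = 0%E.
    by apply/negligibleP => //; apply: negligibleU; apply/negligibleP.
  have Ki0 : (K u)^-1 != 0 by rewrite invr_eq0.
  have T0 := scale_head_null nuE gamE Ki0 mA' A'0.
  have mT : measurable [set a : cseq | A' (ccons ((K u)^-1 * a 0%N) (ctail a))].
    rewrite -[X in measurable X]setTI; apply: measurable_ccons => //; last exact: measurable_ctail.
    by apply: measurable_fun_mulc; [exact: measurable_cst|exact: measurable_coord].
  apply/negligibleP; first exact: measurable_filter_head.
  apply: (@negligibleS _ _ _ _ (~` [set a | good a] `|`
      [set a : cseq | A' (ccons ((K u)^-1 * a 0%N) (ctail a))])); last first.
    by apply: negligibleU => //; apply/negligibleP.
  move=> a; rewrite xsectionE /= => -[_ /= ba].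
  have [ga|] := pselect (good a); [right|by left].
  have gt := good_ctail ga.
  have := blaschke_quot_filter k0 ku (a 0%N) gt; rewrite mulrC => qE.
  move: ba; rewrite qE => -[Ah|h0]; [by left|right; split => //].
  exact: good_ccons.
have /(null_ysection lebC gam mM) := M0; move=> Mb.
apply/(gaussian_seq_null gamE mE).
have gae : {ae gam, forall b, good b} by [].
apply: filterS2 gae Mb => b gb Mb.
have mEb : measurable [set c | E (ccons c b)].
  by rewrite -[X in measurable X]setTI; apply: measurable_ccons.
apply/(gauss_null nuE mEb); apply/negligibleP => //.
apply: (@negligibleS _ _ _ _ (zero_head b @` ysection M b)).
  move=> c Ec; have [u [u1 cu0 ub]] := EP _ Ec (good_ccons c gb).
  exists u; first by rewrite ysectionE.
  move: cu0; rewrite power_series_ctail//; last exact: good_ccons.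
  by move=> /eqP; rewrite addr_eq0 => /eqP /= ->; rewrite /zero_head mulNr.
apply: negligible_image_zero_head => //; first by move=> u; rewrite ysectionE => -[[]].
by apply/negligibleP => //; exact: measurable_ysection.
Qed.

End zero_surgery.

(** * The zero set as a measurable function of the coefficients *)

Section disc_topology.
Context (R : realType).
Local Notation C := (R[i]).
Local Notation normc := (@Normc.normc R).
Local Notation Re := (@complex.Re R).
Local Notation Im := (@complex.Im R).

Definition contraction (f : C -> R) : Prop :=
  forall z w, `|f z - f w| <= normc (z - w).

Lemma contraction_Re : contraction Re.
Proof.
by move=> z w; apply: le_trans (normr_Re_le (z - w)); case: z w => [? ?] [].
Qed.

Lemma contraction_Im : contraction Im.
Proof.
by move=> z w; apply: le_trans (normr_Im_le (z - w)); case: z w => [? ?] [].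
Qed.

Lemma contractionN f : contraction f -> contraction (\- f).
Proof. by move=> fC z w; rewrite /= -opprD normrN. Qed.

Lemma contraction_dist q : contraction (fun z => normc (z - q)).
Proof.
have H x y : normc (x - q) - normc (y - q) <= normc (x - y).
  rewrite lerBlDr; apply: le_trans (ler_normcD _ _).
  by rewrite addrA subrK.
move=> z w; rewrite ler_norml; apply/andP; split; last exact: H.
by rewrite lerNl opprB [leRHS]normc_distC; exact: H.
Qed.

Lemma contraction_normc : contraction normc.
Proof.
by have := contraction_dist 0; congr contraction; apply/funext => z; rewrite subr0.
Qed.

Let near_normc (z : C) (e : R) : 0 < e ->
  \forall w \near (z : C^o), normc (z - w) < e.
Proof.
move=> e0; apply/(@nbhs_normP _ C^o).
exists (e%:C)%C; first by rewrite /= -[X in X < _]/((0 : R)%:C)%C ltcR.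
by move=> w; rewrite /ball_/= normcE ltcR.
Qed.

Lemma closed_contraction f (s : R) : contraction f ->
  closed [set z : C^o | f z <= s].
Proof.
move=> fC; rewrite -[X in closed X]setCK; apply: open_closedC.
rewrite openE => z /= /negP; rewrite -ltNge => sz.
have e0 : 0 < f z - s by rewrite subr_gt0.
have : nbhs (z : C^o) [set w | normc (z - w) < f z - s] by exact: near_normc.
apply: filterS => w /= zw; apply/negP; rewrite -ltNge.
by have := le_lt_trans (fC z w) zw; rewrite ltr_norml => /andP[_]; lra.
Qed.

Lemma continuous_of_Re_Im : continuous (@of_Re_Im R : R^o * R^o -> C^o).
Proof.
move=> [x y]; apply/cvgrPdist_lt => -[e e']; rewrite ltcE/= => /andP[/eqP e'0 e0].
have e20 : 0 < e / 2 by rewrite divr_gt0.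
rewrite (_ : Complex e e' = (e%:C)%C); last by rewrite e'0.
near=> p; rewrite normcE ltcR.
apply: le_lt_trans (normc_le _) _; rewrite /of_Re_Im/= [ltRHS]splitr; apply: ltrD.
- near: p; apply: (@cvgr_dist_lt _ R^o _ _ _ fst x) => //; exact: cvg_fst.
- near: p; apply: (@cvgr_dist_lt _ R^o _ _ _ snd y) => //; exact: cvg_snd.
Unshelve. all: by end_near. Qed.

Lemma compact_disc (r : R) : compact [set z : C^o | normc z <= r].
Proof.
pose I : set R^o := `[- r, r]%classic.
have cI : compact (I `*` I) by apply: compact_setX; exact: segment_compact.
have cB := @continuous_compact _ _ (@of_Re_Im R : R^o * R^o -> C^o) _
  (continuous_subspaceT continuous_of_Re_Im) cI.
apply: subclosed_compact cB _.
  by apply: closed_contraction; exact: contraction_normc.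
move=> z /= zr; exists (Re z, Im z); last by case: z {zr}.
have := le_trans (normr_Re_le z) zr; have := le_trans (normr_Im_le z) zr.
by rewrite /I !ler_norml /= !in_itv.
Qed.

Definition disc_cpt (L : set C) : Prop :=
  [/\ compact (L : set C^o), measurable L & L `<=` [set z | normc z < 1]].

Lemma measurable_contraction_le f (s : R) : contraction f -> measurable_fun setT f ->
  measurable [set z : C | f z <= s].
Proof.
move=> fC mf; rewrite -[X in measurable X]setTI (_ : [set z | _] = f @^-1` `]-oo, s]).
  by apply: mf => //; exact: measurable_itv.
by apply/seteqP; split=> z /=; rewrite in_itv.
Qed.

Lemma disc_cptI L f (s : R) : contraction f -> measurable_fun setT f -> disc_cpt L ->
  disc_cpt (L `&` [set z | f z <= s]).
Proof.
move=> fC mf [cL mL L1]; split.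
- by apply: compact_closedI => //; exact: closed_contraction.
- by apply: measurableI => //; exact: measurable_contraction_le.
- by move=> z [/L1].
Qed.

Lemma disc_cpt_ball (r : R) : r < 1 -> disc_cpt [set z | normc z <= r].
Proof.
move=> r1; split; first exact: compact_disc.
  by apply: measurable_contraction_le; [exact: contraction_normc|exact: measurable_fun_normc].
by move=> z /= /le_lt_trans; apply.
Qed.

Lemma compact_cluster (L : set C) (x : nat -> C) : compact (L : set C^o) ->
  (forall n, L (x n)) ->
  exists2 p, L p & forall (e : R) N, 0 < e ->
    exists2 n, (N <= n)%N & normc (x n - p) < e.
Proof.
move=> cL Lx.
have [|p [Lp clp]] := cL ((x : nat -> C^o) @ \oo) _; first by exists 0%N => // n _; exact: Lx.
exists p => // e N e0.
have nA : ((x : nat -> C^o) @ \oo) [set y | exists2 n, (N <= n)%N & y = x n].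
  by exists N => // n /= Nn; exists n.
have nB : nbhs (p : C^o) [set y | normc (y - p) < e].
  near=> w; rewrite /= normc_distC; near: w; exact: near_normc.
by have [_ [[n Nn ->] xe]] := clp _ _ nA nB; exists n.
Unshelve. all: by end_near. Qed.

Lemma rational_dense (z : C) (e : R) : 0 < e ->
  exists2 q : rat * rat, True & normc (Complex (ratr q.1) (ratr q.2) - z) < e.
Proof.
have rat_near (x d : R) : 0 < d -> exists q : rat, `|ratr q - x| < d.
  move=> d0; have [|q] := @rat_in_itvoo R (x - d) (x + d); first by lra.
  by rewrite in_itv/= => /andP[? ?]; exists q; rewrite ltr_norml; apply/andP; split; lra.
case: z => x y e0; have [|p px] := rat_near x (e / 2); first by rewrite divr_gt0.
have [|q qy] := rat_near y (e / 2); first by rewrite divr_gt0.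
exists (p, q) => //; apply: le_lt_trans (normc_le _) _.
by rewrite [ltRHS]splitr; exact: ltrD.
Qed.

Lemma disc_val_lt1 (z : disc R) : normc (disc_val z) < 1.
Proof. by have := svalP z; rewrite normcE -[1]/((1 : R)%:C)%C ltcR. Qed.

Lemma disc_of (z : C) : normc z < 1 -> exists w : disc R, disc_val w = z.
Proof.
move=> z1; have z1' : `|z| < 1 by rewrite normcE -[1]/((1 : R)%:C)%C ltcR.
by exists (exist _ z z1').
Qed.

Lemma disc_val_inj : injective (@disc_val R).
Proof. by move=> x y xy; apply: val_inj. Qed.

Lemma measurable_disc_val : measurable_fun setT (@disc_val R).
Proof. by move=> _ B mB; exists B. Qed.

Definition inner_disc (m : nat) : set C := [set z | normc z <= 1 - m.+1%:R^-1].

Lemma disc_cpt_inner m : disc_cpt (inner_disc m).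
Proof. by apply: disc_cpt_ball; rewrite ltrBlDr ltrDl invr_gt0. Qed.

Lemma inner_disc_exhaust (x : disc R) : exists m, inner_disc m (disc_val x).
Proof.
have x1 : 0 < 1 - normc (disc_val x) by rewrite subr_gt0; exact: disc_val_lt1.
have [m _ /(_ m (leqnn _)) mx] := near_infty_natSinv_lt (PosNum x1).
by exists m => //; rewrite /inner_disc /= lerBrDl -lerBrDr ltW.
Qed.

Lemma disc_cpt_compact L : disc_cpt L -> disc_compact (@disc_val R @^-1` L).
Proof.
move=> [cL _ L1]; rewrite /disc_compact (_ : _ @` _ = L)//.
apply/seteqP; split=> [_ [z zL <-]//|z Lz].
by have [w wz] := disc_of (L1 z Lz); exists w => //=; rewrite wz.
Qed.

End disc_topology.

Lemma countable_bigcup_measurable d (T : measurableType d) (I : countType)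
    (P : set I) (F : I -> set T) : (forall i, P i -> measurable (F i)) ->
  measurable (\bigcup_(i in P) F i).
Proof.
move=> mF; rewrite bigcup_mkcond; apply: countable_bigcupT_measurable => // i.
by case: ifPn => // /set_mem; exact: mF.
Qed.

Section point_measures.
Context (R : realType).
Local Notation C := (R[i]).
Local Notation normc := (@Normc.normc R).
Implicit Types (mu : point_measure R) (x : disc R) (B : set (disc R)).

Lemma point_measureE mu :
  (forall K, disc_compact K -> finite_set (point_support mu `&` K)) /\
  (forall B, measurable B -> mu B = counting (point_support mu `&` B)).
Proof.
have [S [Sfin SE]] := point_measureP mu.
suff -> : point_support mu = S by [].
apply/seteqP; split=> x; rewrite /point_support/= SE; try exact: measurable_disc1.
  by move=> /counting1I.
by move=> Sx; exact/counting1I.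
Qed.

Lemma point_support1 mu x : point_support mu x -> mu [set x] = 1%E.
Proof. by []. Qed.

Lemma eq_point_measure mu B D : measurable B -> measurable D ->
  point_support mu `&` B = point_support mu `&` D -> mu B = mu D.
Proof. by move=> mB mD; have [_ muE] := point_measureE mu; rewrite !muE// => ->. Qed.

Lemma measurable_preimage_disc (L : set C) : measurable L ->
  measurable (@disc_val R @^-1` L).
Proof. by move=> mL; rewrite -[X in measurable X]setTI; exact: measurable_disc_val. Qed.

Lemma point_measure_nat mu (L : set C) : disc_cpt L ->
  exists n : nat, mu (@disc_val R @^-1` L) = (n%:R)%:E.
Proof.
move=> cL; have [fin muE] := point_measureE mu; have [_ mL _] := cL.
rewrite muE; last exact: measurable_preimage_disc.
rewrite /counting asboolT; last exact/fin/disc_cpt_compact.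
by eexists.
Qed.

Lemma point_measure_ge1 mu B x : measurable B -> B x -> point_support mu x ->
  (1 <= mu B)%E.
Proof.
move=> mB Bx mux; rewrite -(point_support1 mux).
apply: le_measure; rewrite ?inE//; first exact: measurable_disc1.
by move=> _ ->.
Qed.

(** [L] contains finitely many points of the configuration, hence a nearest one
    among those other than [p]. *)
Lemma point_support_isolated mu (L : set C) (p : C) : disc_cpt L ->
  exists2 e, 0 < e & forall x, point_support mu x -> L (disc_val x) ->
    disc_val x <> p -> e <= normc (disc_val x - p).
Proof.
move=> cL; have [fin _] := point_measureE mu.
have /finite_seqP[s sE] := fin _ (disc_cpt_compact cL).
suff [e e0 es] : exists2 e, 0 < e & forall x, x \in s -> disc_val x <> p ->
    e <= normc (disc_val x - p).
  by exists e => // x mux Lx; apply: es; have : [set` s] x by rewrite -sE.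
elim: s {sE} => [|y s [e e0 es]]; first by exists 1.
have [yp|yp] := pselect (disc_val y = p).
  by exists e => // x; rewrite inE => /orP[/eqP ->//|]; exact: es.
exists (Num.min e (normc (disc_val y - p))).
  rewrite lt_min e0 lt_neqAle normc_ge0 andbT eq_sym.
  by apply/eqP => /Normc.eq0_normc/eqP; rewrite subr_eq0 => /eqP.
move=> x; rewrite inE ge_min => /orP[/eqP ->|xs xp]; first by rewrite lexx orbT.
by rewrite es.
Qed.

End point_measures.

Section detectable.
Context (R : realType).
Local Notation C := (R[i]).
Local Notation cseq := (cseq R).
Local Notation normc := (@Normc.normc R).
Local Notation pm := (point_measure R).
Implicit Types (mu : pm) (a : cseq) (A : set pm).

Definition zeros a : set (disc R) := [set z | power_series a (disc_val z) = 0].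

(** Events on configurations that, on zero sets of power series with good
    coefficients, are measurable events on the coefficients. *)
Definition detectable A : Prop := exists2 E' : set cseq, measurable E' &
  forall a mu, good a -> point_support mu = zeros a -> A mu <-> E' a.

Lemma detectable0 : detectable set0.
Proof. by exists set0. Qed.

Lemma detectableC A : detectable A -> detectable (~` A).
Proof.
move=> [E' mE' AE']; exists (~` E'); first exact: measurableC.
by move=> a mu ga muE /=; rewrite (AE' a mu).
Qed.

Lemma detectable_bigcup (F : (set pm)^nat) : (forall n, detectable (F n)) ->
  detectable (\bigcup_n F n).
Proof.
move=> dF; have /choice[F' FF'] : forall n, exists E', measurable E' /\
    forall a mu, good a -> point_support mu = zeros a -> F n mu <-> E' a.
  by move=> n; have [E' mE' AE'] := dF n; exists E'.
exists (\bigcup_n F' n).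
  by apply: bigcup_measurable => n _; have [] := FF' n.
move=> a mu ga muE; split=> -[n _ Fn]; exists n => //; have [_ H] := FF' n.
  by apply/(H a mu).
by apply/(H a mu).
Qed.

Lemma sigma_algebra_detectable : sigma_algebra setT detectable.
Proof.
split; first exact: detectable0.
- by move=> A dA; rewrite setTD; exact: detectableC.
- exact: detectable_bigcup.
Qed.

Lemma detectableI A B : detectable A -> detectable B -> detectable (A `&` B).
Proof.
move=> [E' mE' AE'] [B' mB' BB']; exists (E' `&` B'); first exact: measurableI.
move=> a mu ga muE; split=> -[? ?]; split;
  by [apply/(AE' a mu)|apply/(BB' a mu)].
Qed.

Lemma detectable_countable (T : countType) (P : set T) (F : T -> set pm) :
  (forall t, P t -> detectable (F t)) -> detectable (\bigcup_(t in P) F t).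
Proof.
move=> dF; pose G n := if pickle_inv n is Some t then
  if `[< P t >] then F t else set0 else set0.
have -> : \bigcup_(t in P) F t = \bigcup_n G n.
  apply/seteqP; split=> [mu [t Pt Ft]|mu [n _]].
    have [n En] : exists n, pickle_inv n = Some t by eexists; exact: pickleK_inv.
    by exists n => //; rewrite /G En asboolT.
  by rewrite /G; case: (pickle_inv n) => // t; case: asboolP => // Pt Ft; exists t.
apply: detectable_bigcup => n; rewrite /G; case: (pickle_inv n) => [t|].
  by case: asboolP => [/dF//|_]; exact: detectable0.
exact: detectable0.
Qed.

Definition ratc (q : rat * rat) : C := Complex (ratr q.1) (ratr q.2).

Lemma near_power_series a (x : C) (e : R) : good a -> normc x < 1 -> 0 < e ->
  exists2 d, 0 < d & forall y, normc (y - x) < d -> normc y < 1 /\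
    normc (power_series a y - power_series a x) < e.
Proof.
move=> ga x1 e0; have x0 := normc_ge0 x; pose r := (1 + normc x) / 2.
have r01 : 0 < r < 1 by rewrite /r; apply/andP; split; lra.
have [K K0 Kq] := sums_series_quot ga r01.
have K1 : 0 < K + 1 by rewrite ltr_wpDl.
exists (Num.min ((1 - normc x) / 2) (e / (K + 1))) => [|y].
  by rewrite lt_min divr_gt0// ?divr_gt0// subr_gt0.
rewrite lt_min => /andP[yx ye].
have yr : normc y <= r.
  by have := ler_normcD (y - x) x; rewrite subrK /r; lra.
have xr : normc x <= r by rewrite /r; lra.
have y1 : normc y < 1 by case/andP: r01 => _; exact: le_lt_trans.
split=> //; rewrite power_series_diff// Normc.normcM.
have [_ qK] := Kq _ _ yr xr.
apply: (@le_lt_trans _ _ (normc (y - x) * (K + 1))).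
  by apply: ler_wpM2l; rewrite ?normc_ge0// (le_trans qK)// lerDl.
by rewrite -ltr_pdivlMr.
Qed.

(** A power series vanishes somewhere on a compact set exactly when it takes
    arbitrarily small values at rational points arbitrarily close to it. *)
Lemma detectable_hit (L : set C) : disc_cpt L ->
  detectable [set mu | exists2 x, point_support mu x & L (disc_val x)].
Proof.
move=> cL; have [kL _ L1] := cL.
pose near n (q : rat * rat) := normc (ratc q) < 1 /\
  exists2 x, L x & normc (ratc q - x) < n.+1%:R^-1.
pose small n (q : rat * rat) := [set a : cseq | good a] `&`
  [set a | normc (power_series a (ratc q)) < n.+1%:R^-1].
pose E' := \bigcap_n \bigcup_(q in near n) small n q.
have mE' : measurable E'.
  apply: bigcap_measurable => [|n _]; first by exists 0%N.
  apply: countable_bigcup_measurable => q [q1 _].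
  have mq : measurable_fun [set a : cseq | good a] (fun a => normc (power_series a (ratc q))).
    apply: measurable_fun_normc.
    have := @measurable_power_series R _ _ [set a : cseq | good a] (fun h => h) (fun=> ratc q).
    by apply => //; exact: measurable_id.
  rewrite /small (_ : [set a | _ < _] =
      (fun a => normc (power_series a (ratc q))) @^-1` `]-oo, n.+1%:R^-1[).
    by apply: mq; [exact: measurable_good|exact: measurable_itv].
  by apply/seteqP; split=> a /=; rewrite in_itv.
exists E' => // a mu ga muE; split=> [[x mux Lx] n _|aE'].
  have ax : power_series a (disc_val x) = 0 by move: mux; rewrite muE.
  have n0 : 0 < n.+1%:R^-1 :> R by rewrite invr_gt0 ltr0n.
  have [e e0 eP] := near_power_series ga (disc_val_lt1 x) n0.
  have en0 : 0 < Num.min e n.+1%:R^-1 by rewrite lt_min e0.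
  have [q _] := rational_dense (disc_val x) en0.
  rewrite lt_min => /andP[/eP[q1 qe] qn]; exists q; first by split=> //; exists (disc_val x).
  by split=> //=; move: qe; rewrite ax subr0.
have /choice[q qP] : forall n, exists q, near n q /\ small n q a.
  by move=> n; have [q ? ?] := aE' n I; exists q.
have /choice[x xP] : forall n, exists x, L x /\ normc (ratc (q n) - x) < n.+1%:R^-1.
  by move=> n; have [[_ [x Lx qx]] _] := qP n; exists x.
have [|p Lp clp] := compact_cluster kL (x := x); first by move=> n; have [] := xP n.
have [w wp] := disc_of (L1 _ Lp).
exists w; last by rewrite wp.
rewrite muE /zeros /= wp; apply: Normc.eq0_normc; apply/eqP.
rewrite eq_le normc_ge0 andbT; apply/ler_addgt0Pr => e e0; rewrite add0r.
have e20 : 0 < e / 2 by rewrite divr_gt0.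
have [d d0 dP] := near_power_series ga (L1 _ Lp) e20.
have m0 : 0 < Num.min (d / 2) (e / 2) by rewrite lt_min !divr_gt0.
have [N _ /(_ _ _)/= NP] := near_infty_natSinv_lt (PosNum m0).
have d20 : 0 < d / 2 by rewrite divr_gt0.
have [n Nn xnp] := clp (d / 2) N d20.
have := NP n Nn; rewrite lt_min => /andP[nd ne].
have [_ xqn] := xP n; have [_ [_ /= qn]] := qP n.
have qp : normc (ratc (q n) - p) < d.
  rewrite -(subrK (x n) (ratc (q n))) -addrA; apply: le_lt_trans (ler_normcD _ _) _.
  by rewrite [ltRHS]splitr; apply: ltrD => //; exact: lt_trans xqn nd.
have [_ gqp] := dP _ qp.
rewrite -(subrK (power_series a (ratc (q n))) (power_series a p)).
apply: le_trans (ler_normcD _ _) _; rewrite [leRHS]splitr; apply: lerD.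
  by rewrite normc_distC ltW.
by apply: ltW; exact: lt_trans qn ne.
Qed.

End detectable.

Section detectable_events.
Context (R : realType).
Local Notation C := (R[i]).
Local Notation cseq := (cseq R).
Local Notation normc := (@Normc.normc R).
Local Notation Re := (@complex.Re R).
Local Notation Im := (@complex.Im R).
Local Notation pm := (point_measure R).
Local Notation dpre L := (@disc_val R @^-1` L).
Implicit Types (mu : pm) (A : set pm).

Let measurable_dist (q : C) : measurable_fun setT (fun z : C => normc (z - q)).
Proof.
by apply: measurable_fun_normc; apply: measurable_fun_subc.
Qed.

(** A compact set carries at least [k + 1] points exactly when some small disc
    with rational data carries a point and the part of the set that is well
    separated from this disc carries at least [k] points. *)
Lemma detectable_count_ge (k : nat) (L : set C) : disc_cpt L ->
  detectable [set mu : pm | ((k%:R)%:E <= mu (dpre L))%E].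
Proof.
elim: k L => [|k IHk] L cL.
  rewrite (_ : [set mu | _] = ~` set0); first exact/detectableC/detectable0.
  rewrite setC0; apply/seteqP; split=> mu // _.
  exact: measure_ge0.
pose near (t : (rat * rat) * rat) := [set z : C | normc (z - ratc R t.1) <= ratr t.2].
pose far (t : (rat * rat) * rat) :=
  [set z : C | - normc (z - ratc R t.1) <= - (2 * ratr t.2)].
have cnear t : disc_cpt (L `&` near t).
  by apply: disc_cptI => //; exact: contraction_dist.
have cfar t : disc_cpt (L `&` far t).
  apply: (@disc_cptI _ _ (\- (fun z => normc (z - ratc R t.1)))) => //.
    exact/contractionN/contraction_dist.
  exact: measurable_funN.
rewrite (_ : [set mu | _] = \bigcup_(t in [set t : (rat * rat) * rat | 0 < t.2])
    ([set mu | exists2 x, point_support mu x & (L `&` near t) (disc_val x)] `&`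
     [set mu : pm | ((k%:R)%:E <= mu (dpre (L `&` far t)))%E])).
  apply: detectable_countable => t t0; apply: detectableI; first exact: detectable_hit.
  exact: IHk.
have mpre (K : set C) : disc_cpt K -> measurable (dpre K).
  by move=> [_ mK _]; exact: measurable_preimage_disc.
apply/seteqP; split=> mu /=; last first.
  move=> [t /= t0] [[x mux xL] kmu].
  apply: (@le_trans _ _ (mu (dpre (L `&` near t) `|` dpre (L `&` far t)))); last first.
    apply: le_measure; rewrite ?inE; first by apply: measurableU; exact: mpre.
      exact: mpre.
    by move=> y [[]|[]].
  rewrite measureU; [|exact: mpre|exact: mpre|].
    rewrite -natr1 EFinD addeC; apply: leeD => //.
    by apply: (point_measure_ge1 (x := x)) => //; exact: mpre.
  apply/seteqP; split=> // y [[_ yn] [_ yf]]; move: yf; rewrite /far /= lerN2 => /le_trans /(_ yn).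
  by rewrite mulrDl !mul1r gerDl leNgt ltr0q t0.
move=> kmu; have [_ muE] := point_measureE mu.
have [p [mup Lp]] : exists p, point_support mu p /\ L (disc_val p).
  apply: contrapT => /forallNP nop.
  have : mu (dpre L) = 0%E.
    rewrite -(measure0 mu); apply: eq_point_measure; [exact: mpre|exact: measurable0|].
    by rewrite setI0; apply/seteqP; split=> // x [mux Lx]; apply: (nop x).
  by move=> mu0; move: kmu; rewrite mu0 lee_fin lern0.
have [e e0 ep] := point_support_isolated mu (disc_val p) cL.
have e4 : 0 < e / 4 by rewrite divr_gt0.
have [r] := @rat_in_itvoo R 0 (e / 4) e4.
rewrite in_itv/= => /andP[r0 re].
have [q _ qp] := rational_dense (disc_val p) r0.
exists (q, r); first by rewrite /= -(ltr0q R).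
split; first by exists p => //; split=> //; rewrite /near /= normc_distC ltW.
have pfar x : point_support mu x -> L (disc_val x) -> x <> p -> far (q, r) (disc_val x).
  move=> mux Lx xp; have := ep x mux Lx; have dxp : disc_val x <> disc_val p.
    by move=> /disc_val_inj.
  move=> /(_ dxp) exp; rewrite /far /= lerN2.
  have := ler_normcD (disc_val x - ratc R q) (ratc R q - disc_val p).
  rewrite addrA subrK => H; move: qp; rewrite -/(ratc R q) => qp; lra.
have : mu (dpre L) = (1 + mu (dpre L `\` [set p]))%E.
  rewrite -(point_support1 mup) -measureU; last 3 first.
  - exact: measurable_disc1.
  - by apply: measurableD; [exact: mpre|exact: measurable_disc1].
  - by apply/seteqP; split=> // x [/= -> []].
  congr (mu _); apply/seteqP; split=> [x Lx|x [->//|[]//]].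
  by have [->|xp] := pselect (x = p); [left|right].
have -> : mu (dpre L `\` [set p]) = mu (dpre (L `&` far (q, r)) `\` [set p]).
  have mD (K : set C) : disc_cpt K -> measurable (dpre K `\` [set p]).
    by move=> cK; apply: measurableD; [exact: mpre|exact: measurable_disc1].
  apply: eq_point_measure; [exact: mD|exact: mD|].
  apply/seteqP; split=> x [mux [xL xp]]; split=> //; split=> //.
    by split=> //; exact: pfar.
  by case: xL.
move=> muS; move: kmu; rewrite muS -natr1 EFinD addeC leeD2lE//.
move=> /le_trans; apply; apply: le_measure; rewrite ?inE; last by move=> x [].
  by apply: measurableD; [exact: mpre|exact: measurable_disc1].
exact: mpre.
Qed.

Local Notation dT := (g_sigma_algebraType (@detectable R)).

Let detectable_measurable (A : set dT) : measurable A <-> detectable A.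
Proof.
have E : @measurable _ dT = @detectable R.
  by apply: measurable_g_measurableTypeE; exact: sigma_algebra_detectable.
by rewrite E.
Qed.

Let count (B : set (disc R)) : dT -> \bar R := fun mu => (mu : pm) B.

Let measurable_count_cpt (L : set C) : disc_cpt L ->
  measurable_fun setT (count (dpre L)).
Proof.
move=> cL _ Y mY; rewrite setTI; apply/detectable_measurable.
rewrite (_ : _ @^-1` Y = \bigcup_(k in [set k : nat | Y (k%:R)%:E])
   ([set mu : pm | ((k%:R)%:E <= mu (dpre L))%E] `&`
    ~` [set mu : pm | ((k.+1%:R)%:E <= mu (dpre L))%E])).
  apply: detectable_countable => k _; apply: detectableI; first exact: detectable_count_ge.
  exact/detectableC/detectable_count_ge.
apply/seteqP; split=> mu; rewrite /count /=.
  move=> Ymu; have [k kE] := point_measure_nat mu cL.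
  exists k; rewrite /= -?kE//; split=> //.
  by rewrite kE lee_fin ler_nat ltnn.
move=> [k /= Yk [k1 k2]]; have [n nE] := point_measure_nat mu cL.
move: k1 k2; rewrite nE !lee_fin !ler_nat => k1 /negP; rewrite -ltnNge ltnS => k2.
by rewrite (_ : n = k)//; apply/eqP; rewrite eqn_leq k1 k2.
Qed.

Let quadrant (s t : R) : set C := [set z | s <= Re z /\ t <= Im z].

Let quadrants : set (set (disc R)) :=
  [set B | exists s t, B = dpre (quadrant s t)].

Let measurable_discE : @measurable _ (disc R) = <<s quadrants >>.
Proof.
have mq s t : measurable (quadrant s t).
  rewrite (_ : quadrant s t = [set z | `[s, +oo[%classic (Re z) /\ `[t, +oo[%classic (Im z)]).
    by apply: measurable_rect; exact: measurable_itv.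
  by apply/seteqP; split=> z /=; rewrite !in_itv/= !andbT.
apply/seteqP; split; last first.
  apply: smallest_sub; first exact: sigma_algebra_measurable.
  by move=> _ [s [t ->]]; exact: measurable_preimage_disc.
have sigma (T : pointedType) (h : disc R -> T) (G : set (set T)) :
    (forall B, G B -> <<s quadrants >> (h @^-1` B)) ->
    forall B, <<s G >> B -> <<s quadrants >> (h @^-1` B).
  move=> hG; apply: smallest_sub => //; split.
  - by rewrite /= preimage_set0; exact: sigma_algebra0.
  - by move=> B rB; rewrite setTD /= preimage_setC; exact: sigma_algebraC.
  - by move=> F rF; rewrite /= preimage_bigcup; exact: sigma_algebra_bigcup.
have ray (f : disc R -> R) : (forall s, <<s quadrants >> [set x | s <= f x]) ->
    forall B : set R, measurable B -> <<s quadrants >> (f @^-1` B).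
  move=> fs B mB; have {}mB : (@RGenCInfty.G R).-sigma.-measurable B.
    by rewrite -RGenCInfty.measurableE.
  apply: (@sigma R f (@RGenCInfty.G R)) => // _ [s ->].
  rewrite (_ : _ @^-1` _ = [set x | s <= f x])//.
  by apply/seteqP; split=> x /=; rewrite in_itv/= andbT.
have low (x : R) : exists n : nat, - n%:R <= x.
  exists (Num.truncn (- x)).+1; rewrite lerNl ltW//; exact: truncnS_gt.
have rayRe s : <<s quadrants >> [set x : disc R | s <= Re (disc_val x)].
  rewrite (_ : [set x | _] = \bigcup_n dpre (quadrant s (- n%:R))).
    by apply: sigma_algebra_bigcup => n; apply: sub_sigma_algebra; exists s, (- n%:R).
  apply/seteqP; split=> x /= => [sx|[n _ []//]].
  by have [n xn] := low (Im (disc_val x)); exists n.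
have rayIm t : <<s quadrants >> [set x : disc R | t <= Im (disc_val x)].
  rewrite (_ : [set x | _] = \bigcup_n dpre (quadrant (- n%:R) t)).
    by apply: sigma_algebra_bigcup => n; apply: sub_sigma_algebra; exists (- n%:R), t.
  apply/seteqP; split=> x /= => [sx|[n _ []//]].
  by have [n xn] := low (Re (disc_val x)); exists n.
move=> _ [_ [B mB <-] <-]; rewrite !setTI.
apply: (@sigma (R * R)%type (fun x => Re_Im (disc_val x)) _ _ B mB) => _ [|] [D mD <-]; rewrite setTI.
  exact: (ray (fun x => Re (disc_val x)) rayRe D mD).
exact: (ray (fun x => Im (disc_val x)) rayIm D mD).
Qed.

Let quadrants_setI : setI_closed quadrants.
Proof.
move=> _ _ [s [t ->]] [s' [t' ->]]; exists (Num.max s s'), (Num.max t t').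
apply/seteqP; split=> x; rewrite /quadrant/= !ge_max.
  by move=> [[-> ->] [-> ->]].
by move=> [/andP[-> ->] /andP[-> ->]].
Qed.

Let measurable_count_ball (m : nat) (B : set (disc R)) : measurable B ->
  measurable_fun setT (count (B `&` dpre (inner_disc m))).
Proof.
have mb : measurable (dpre (inner_disc m)).
  by have [_ mbm _] := @disc_cpt_inner R m; exact: measurable_preimage_disc.
have bfin (mu : pm) : mu (dpre (inner_disc m)) \is a fin_num.
  by have [n ->] := point_measure_nat mu (@disc_cpt_inner R m).
rewrite measurable_discE; move: B; apply: dynkin_induction.
- exact: measurable_discE.
- exact: quadrants_setI.
- by rewrite setTI; exact: measurable_count_cpt (@disc_cpt_inner R m).
- move=> _ [s [t ->]].
  rewrite (_ : _ `&` _ = dpre ((inner_disc m `&` [set z | (\- Re) z <= - s]) `&`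
      [set z | (\- Im) z <= - t])).
    apply: measurable_count_cpt; apply: (disc_cptI (f := \- Im)).
    + exact/contractionN/contraction_Im.
    + by apply: measurable_funN; exact: measurable_Im.
    apply: (disc_cptI (f := \- Re)); first exact/contractionN/contraction_Re.
      by apply: measurable_funN; exact: measurable_Re.
    exact: disc_cpt_inner.
  by apply/seteqP; split=> x; rewrite /quadrant/= !lerN2; [move=> [[]]|move=> [[]]].
- move=> B mB cB.
  rewrite (_ : count _ = fun mu => (count (dpre (inner_disc m)) mu - count (B `&` dpre (inner_disc m)) mu)%E).
    by apply: emeasurable_funB => //; exact: measurable_count_cpt (@disc_cpt_inner R m).
  apply/funext => mu; rewrite /count.
  have mI : measurable (B `&` dpre (inner_disc m)) by exact: measurableI.
  rewrite (_ : ~` B `&` _ = dpre (inner_disc m) `\` (B `&` dpre (inner_disc m))); last first.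
    apply/seteqP; split=> x /=; first by move=> [nB bx]; split=> // -[].
    by move=> [bx nB]; split=> // Bx; apply: nB.
  rewrite measureD//; first by congr (_ - mu _)%E; rewrite setICA setIid.
  by rewrite ltey_eq bfin.
- move=> F mF tF cF.
  rewrite (_ : count _ = fun mu => (\sum_(0 <= k <oo) count (F k `&` dpre (inner_disc m)) mu)%E).
    by apply: ge0_emeasurable_sum => // k mu _ _; exact: measure_ge0.
  apply/funext => mu; rewrite /count setI_bigcupl measure_semi_bigcup//.
  + by move=> k; exact: measurableI.
  + exact: trivIset_setIr.
  + by apply: bigcup_measurable => k _; exact: measurableI.
Qed.

(** Counts in compact sets are detectable by [detectable_count_ge]. Quadrants cut
    with a compact disc are compact and generate the Borel sets, which an
    exhaustion by compact discs then recovers. *)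
Lemma detectable_event A : measurable A -> detectable A.
Proof.
apply: smallest_sub; first exact: sigma_algebra_detectable.
move=> _ [B mB [Y mY <-]]; apply/detectable_measurable; rewrite setTI.
suff mB' : measurable_fun setT (count B) by rewrite -[X in measurable X]setTI; exact: mB'.
apply: (emeasurable_fun_cvg (fun m => count (B `&` dpre (inner_disc m)))).
  by move=> m; exact: measurable_count_ball.
move=> mu _; rewrite /count.
have BE : B = \bigcup_m (B `&` dpre (inner_disc m)).
  rewrite -setI_bigcupr; apply/seteqP; split=> [x Bx|x []//]; split=> //.
  by have [m xm] := inner_disc_exhaust x; exists m.
have mBm m : measurable (B `&` dpre (inner_disc m)).
  by apply: measurableI => //; have [_ ? _] := @disc_cpt_inner R m; exact: measurable_preimage_disc.
rewrite {2}BE; apply: nondecreasing_cvg_mu => //; first by rewrite -BE.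
move=> m n mn; apply/subsetPset => x [Bx /= xm]; split=> //=.
by apply: le_trans xm _; rewrite lerD2l lerN2 lef_pV2 ?posrE// ler_nat.
Qed.

End detectable_events.

(** * Configurations of points in the disc *)

Section configurations.
Context (R : realType).
Local Notation C := (R[i]).
Local Notation cseq := (cseq R).
Local Notation normc := (@Normc.normc R).
Local Notation pm := (point_measure R).
Local Notation dpre L := (@disc_val R @^-1` L).
Implicit Types (mu : pm) (x z : disc R) (A : set pm) (B D Q : set (disc R)).

(** Events only depend on the values at Borel sets, which the support
    determines. *)
Lemma eq_support_event mu mu' A : measurable A ->
  point_support mu = point_support mu' -> A mu <-> A mu'.
Proof.
move=> mA E; have [_ muE] := point_measureE mu; have [_ muE'] := point_measureE mu'.
suff H : measurable `<=` [set A | A mu <-> A mu'] by exact: H.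
apply: smallest_sub.
  split=> // [A1 A1E|F FE]; first by rewrite setTD; split=> nA /A1E.
  by split=> -[n _ Fn]; exists n => //; apply/(FE n).
by move=> _ [B mB [Y mY <-]]; rewrite setTI /= muE// muE'// E.
Qed.

Lemma measurable_fun_pm d (T : measurableType d) (D : set T) (f : T -> pm) :
  (forall B, measurable B -> measurable_fun D (fun t => f t B)) -> measurable_fun D f.
Proof.
move=> mf mD; apply: (@measurability _ _ _ _ D f
  (\bigcup_(B in @measurable _ (disc R))
     preimage_set_system setT (fun mu : pm => mu B) measurable)) (mD) => //.
by move=> _ [_ [B mB [Y mY <-]] <-]; rewrite setTI; exact: mf.
Qed.

Lemma measurable_eval B : measurable B -> measurable_fun setT (fun mu : pm => mu B).
Proof.
move=> mB _ Y mY; rewrite setTI; apply: sub_sigma_algebra; exists B => //.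
by exists Y => //; rewrite setTI.
Qed.

Lemma is_point_measure_restrict mu D (mD : measurable D) :
  is_point_measure (mrestr mu mD).
Proof.
have [fin muE] := point_measureE mu; exists (point_support mu `&` D); split.
  by move=> K cK; apply: sub_finite_set (fin _ cK) => y [[]].
move=> A mA; transitivity (mu (A `&` D)); first by [].
by rewrite muE; [rewrite setIAC -setIA|exact: measurableI].
Qed.

Definition restrict_points mu D (mD : measurable D) : pm :=
  PointMeasure (is_point_measure_restrict mu mD).

Let support_restr mu mu' D : (forall x, mu' [set x] = mu ([set x] `&` D)) ->
  point_support mu' = point_support mu `&` D.
Proof.
move=> H; apply/seteqP; split=> x; rewrite /point_support/= H.
  have [Dx|nDx] := pselect (D x).
    by rewrite (_ : [set x] `&` D = [set x])//; apply/seteqP; split=> y /= => [[]|->].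
  rewrite (_ : [set x] `&` D = set0).
    by rewrite measure0 => /eqP; rewrite eqe eq_sym oner_eq0.
  by apply/seteqP; split=> y //= [->].
move=> [mux Dx]; rewrite -mux; congr (_ _).
by apply/seteqP; split=> y /= => [[]|->].
Qed.

Lemma support_restrict mu D (mD : measurable D) :
  point_support (restrict_points mu mD) = point_support mu `&` D.
Proof. exact: support_restr. Qed.

Lemma support_remove mu z :
  point_support (remove_point mu z) = point_support mu `&` ~` [set z].
Proof. exact: support_restr. Qed.

Lemma support_add mu z : point_support (add_point mu z) = z |` point_support mu.
Proof.
have [muz|nmuz] := pselect (point_support mu z).
  rewrite /add_point; case: pselect => // _; apply/seteqP; split=> x; first by right.
  by move=> [->|].
have [_ muE] := point_measureE mu.
have muz0 : mu [set z] = 0%E.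
  rewrite muE; last exact: measurable_disc1.
  rewrite (_ : _ `&` _ = set0) ?measure0//.
  by apply/seteqP; split=> x //= [mux xz]; apply: nmuz; rewrite -xz.
have E x : point_support (add_point mu z) x = (mu [set x] + \d_z [set x] = 1)%E.
  by rewrite -(add_pointE [set x] nmuz).
apply/seteqP; split=> x; rewrite E.
  have [->|xz] := pselect (x = z); first by left.
  by rewrite diracE memNset ?adde0; [right|move=> /= /esym].
move=> [->|mux]; first by rewrite muz0 add0e diracE mem_set.
by rewrite diracE memNset ?adde0// => /= zx; apply: nmuz; rewrite zx.
Qed.

Lemma measurable_restrict D (mD : measurable D) :
  measurable_fun setT (fun mu => restrict_points mu mD).
Proof.
apply: measurable_fun_pm => B mB.
by apply: measurable_eval; exact: measurableI.
Qed.

(** Forgetting the points in [Q] first makes the added point a new one, so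
    that the result depends measurably on the configuration and the point. *)
Lemma measurable_insert Q (mQ : measurable Q) :
  measurable_fun (setT `*` Q)
    (fun p : pm * disc R => add_point (restrict_points p.1 (measurableC mQ)) p.2).
Proof.
apply: measurable_fun_pm => B mB.
apply: (@eq_measurable_fun _ _ _ _ _
  (fun p : pm * disc R => p.1 (B `&` ~` Q) + (\1_B p.2)%:E)%E).
  move=> [mu x]; rewrite inE => -[_ /= Qx].
  have mux : ~ point_support (restrict_points mu (measurableC mQ)) x.
    by rewrite support_restrict => -[].
  by rewrite (add_pointE B mux) diracE indicE.
apply: emeasurable_funD; apply: measurable_funTS.
  have mBQ : measurable (B `&` ~` Q) by apply: measurableI => //; exact: measurableC.
  exact: (measurableT_comp (measurable_eval mBQ) measurable_fst).
apply/measurable_EFinP.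
have m1 : measurable_fun setT (\1_B : disc R -> R) by exact: measurable_indic.
exact: (measurableT_comp m1 measurable_snd).
Qed.

(** A countable family of sets, fine enough to separate a point of the disc
    from the other points of a locally finite configuration. *)
Definition separator (t : ((rat * rat) * rat) * nat) : set C :=
  inner_disc t.2 `&` [set z | normc (z - ratc R t.1.1) <= ratr t.1.2].

Lemma measurable_separator t : measurable (dpre (separator t)).
Proof.
apply: measurable_preimage_disc.
suff [_ mt _] : disc_cpt (separator t) by exact: mt.
apply: disc_cptI; [exact: contraction_dist| |exact: disc_cpt_inner].
by apply: measurable_fun_normc; apply: measurable_fun_subc.
Qed.

Lemma separatorP mu x : exists t, separator t (disc_val x) /\
  forall y, point_support mu y -> separator t (disc_val y) -> y = x.
Proof.
have [m xm] := inner_disc_exhaust x.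
have [e e0 ep] := point_support_isolated mu (disc_val x) (@disc_cpt_inner R m).
have e2 : 0 < e / 2 by rewrite divr_gt0.
have [r] := @rat_in_itvoo R 0 (e / 2) e2.
rewrite in_itv/= => /andP[r0 re].
have [q _ qx] := rational_dense (disc_val x) r0.
exists ((q, r), m); split; first by split=> //=; rewrite normc_distC ltW.
move=> y muy [/= ym yq]; apply: contrapT => yx.
have := ep y muy ym; move=> /(_ (fun E => yx (disc_val_inj E))) exy.
have := ler_normcD (disc_val y - ratc R q) (ratc R q - disc_val x).
by rewrite addrA subrK => H; move: qx yq; rewrite -/(ratc R q) => qx yq; lra.
Qed.

(** A zero at [u] fixes the first coefficient of [a], and makes [a] the product
    of the quotient and of the Blaschke factor at [u]. *)
Lemma zeros_quot (a : cseq) (u : C) (z : C) : good a -> normc u < 1 ->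
  power_series a u = 0 -> normc z < 1 ->
  power_series a z = 0 <-> z = u \/ power_series (blaschke_quot u (ctail a)) z = 0.
Proof.
move=> ga u1 au z1; have gt := good_ctail ga.
apply: (blaschke_zero (u := u)) => //; last exact: good_blaschke_quot.
suff {2}<- : ccons (- u * power_series (ctail a) u) (ctail a) = a by exact: blaschke_quotP.
rewrite -[RHS]ccons_tail; congr ccons.
by move: au; rewrite power_series_ctail// => /eqP; rewrite addr_eq0 => /eqP ->; rewrite mulNr.
Qed.

Lemma power_series_zero_closed (a : cseq) (p : C) : good a -> normc p < 1 ->
  (forall e, 0 < e -> exists2 y, normc (y - p) < e & power_series a y = 0) ->
  power_series a p = 0.
Proof.
move=> ga p1 ap; apply: Normc.eq0_normc; apply/eqP.
rewrite eq_le normc_ge0 andbT; apply/ler_addgt0Pr => e e0; rewrite add0r.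
have [d d0 dP] := near_power_series ga p1 e0; have [y yd ay] := ap d d0.
by have [_] := dP y yd; rewrite ay sub0r normcN => /ltW.
Qed.

(** If the zeros accumulate at [u], then by continuity [u] is still a zero
    after division by the Blaschke factor at [u]. *)
Lemma simple_or_double (a : cseq) : good a ->
  (exists mu, point_support mu = zeros a) \/
  exists u, [/\ normc u < 1, power_series a u = 0 &
    power_series (blaschke_quot u (ctail a)) u = 0].
Proof.
move=> ga.
have [fin|] := pselect (forall K, disc_compact K -> finite_set (zeros a `&` K)).
  left; have mS : measurable (zeros a).
    apply: countable_measurable; first exact: measurable_disc1.
    rewrite (_ : zeros a = \bigcup_m (zeros a `&` dpre (inner_disc m))).
      apply: bigcup_countable => // m _; apply: finite_set_countable.
      exact/fin/disc_cpt_compact/disc_cpt_inner.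
    rewrite -setI_bigcupr; apply/seteqP; split=> [x ax|x []//]; split=> //.
    by have [m xm] := inner_disc_exhaust x; exists m.
  have H : is_point_measure (mrestr (@counting (disc R) R) mS).
    by exists (zeros a); split=> // A mA; rewrite setIC.
  exists (PointMeasure H); apply/seteqP; split=> x; rewrite /point_support/= /mrestr setIC.
    by move/counting1I.
  by move=> ax; apply/counting1I.
move=> /existsNP[K /not_implyP[cK]] /infiniteP/pcard_leP[f]; right.
have fK n : (zeros a `&` K) (f n) by apply: funS.
have [n|_ [w Kw <-] wP] := compact_cluster cK (x := fun n => disc_val (f n)).
  by exists (f n) => //; have [] := fK n.
have w1 := disc_val_lt1 w.
have acc e : 0 < e -> exists n, normc (disc_val (f n) - disc_val w) < e /\
    disc_val (f n) <> disc_val w.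
  move=> e0; have [n _ ne] := wP e 0%N e0.
  have [nw|] := pselect (disc_val (f n) = disc_val w); last by exists n.
  have [m nm me] := wP e n.+1 e0; exists m; split=> // mw.
  move: nm; suff -> : m = n by rewrite ltnn.
  apply: (@inj _ _ _ f); rewrite ?inE//.
  by apply: disc_val_inj; rewrite mw nw.
have aw : power_series a (disc_val w) = 0.
  apply: power_series_zero_closed => // e /acc[n [ne _]].
  by exists (disc_val (f n)) => //; have [] := fK n.
exists (disc_val w); split=> //.
apply: power_series_zero_closed => //; first exact/good_blaschke_quot/w1/good_ctail.
move=> e /acc[n [ne nw]]; exists (disc_val (f n)) => //.
have [an _] := fK n.
by have [//|] := (zeros_quot ga w1 aw (disc_val_lt1 _)).1 an.
Qed.

End configurations.

(** * Insertion and deletion of a zero *)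

Lemma negligible_countable d (T : measurableType d) (R : realType)
    (m : {measure set T -> \bar R}) (I : countType) (F : I -> set T) :
  (forall i, m.-negligible (F i)) -> m.-negligible (\bigcup_i F i).
Proof.
move=> mF; pose G n := if pickle_inv n is Some i then F i else set0.
apply: (@negligibleS _ _ _ _ (\bigcup_n G n)).
  move=> x [i _ Fi]; have [n En] : exists n, pickle_inv n = Some i.
    by eexists; exact: pickleK_inv.
  by exists n => //; rewrite /G En.
apply: negligible_bigcup => n; rewrite /G; case: (pickle_inv n) => // .
exact: negligible_set0.
Qed.

Section zero_process.
Context (R : realType).
Local Notation C := (R[i]).
Local Notation cseq := (cseq R).
Local Notation lebC := (@lebesgue_complex R).
Local Notation normc := (@Normc.normc R).
Local Notation pm := (point_measure R).
Local Notation dpre L := (@disc_val R @^-1` L).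
Local Notation sep t := (dpre (@separator R t)).
Implicit Types (A : set pm) (t : ((rat * rat) * rat) * nat).

Let msep t : measurable (sep t) := measurable_separator R t.

(** The deletion of the point that a separator isolates, as an event on the
    configuration alone. *)
Definition removable t A : set pm :=
  [set mu : pm | mu (sep t) = 1%E /\ A (restrict_points mu (measurableC (msep t)))].

(** The insertion of a point that a separator certifies to be new. *)
Definition insertable t A : set (pm * disc R) :=
  [set p : pm * disc R | p.1 (sep t) = 0%E /\ (sep t p.2 /\
           A (add_point (restrict_points p.1 (measurableC (msep t))) p.2))].

Lemma measurable_removable t A : measurable A -> measurable (removable t A).
Proof.
move=> mA; rewrite (_ : removable t A = [set mu : pm | mu (sep t) = 1%E] `&`
   (fun mu => restrict_points mu (measurableC (msep t))) @^-1` A)//.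
apply: measurableI; rewrite -[X in measurable X]setTI.
  exact: (measurable_eval (msep t) measurableT (emeasurable_set1 1%E)).
exact: measurable_restrict.
Qed.

Lemma measurable_insertable t A : measurable A -> measurable (insertable t A).
Proof.
move=> mA; rewrite (_ : insertable t A =
   (fun p : pm * disc R => p.1 (sep t)) @^-1` [set 0%E] `&` ((setT `*` sep t) `&`
   (fun p => add_point (restrict_points p.1 (measurableC (msep t))) p.2) @^-1` A)).
  apply: measurableI.
    rewrite -[X in measurable X]setTI.
    exact: (measurableT_comp (measurable_eval (msep t)) measurable_fst
      measurableT (emeasurable_set1 0%E)).
  by apply: measurable_insert => //; exact: measurableX.
by apply/seteqP; split=> -[mu z] /=; [move=> [? [? ?]]|move=> [? [[_ ?] ?]]].
Qed.

Variables (nu : probability C R) (gam : probability cseq R).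
Hypothesis nuE : forall B : set C, measurable B ->
  nu B = (\int[lebC]_(z in B) (gauss_density z)%:E)%E.
Hypothesis gamE : forall l, measurable_seq l ->
  gam (cylinder l) = (\prod_(B <- l) nu B)%E.
Context d (Omega : measurableType d) (P : probability Omega R).
Variables (Upsilon : {RV P >-> pm}) (X : {RV P >-> cseq}).
Hypothesis XE : forall E, measurable E -> P (X @^-1` E) = gam E.
Hypothesis zerosX : {ae P, forall w, point_support (Upsilon w) = zeros (X w)}.

Let good_zeros : P.-negligible
  (~` [set w | good (X w) /\ point_support (Upsilon w) = zeros (X w)]).
Proof.
apply: (@negligibleS _ _ _ _ ((X @^-1` (~` [set a | good a])) `|`
    ~` [set w | point_support (Upsilon w) = zeros (X w)])).
  by move=> w /not_andP[?|?]; [left|right].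
apply: negligibleU => //.
have mG := measurableC (@measurable_good R).
apply/negligibleP; first exact: measurable_funPTI.
exact: etrans (XE mG) (gaussian_seq_good nuE gamE).
Qed.

Let null_transfer (F : set Omega) (E : set cseq) : measurable F -> measurable E ->
  gam E = 0%E ->
  (forall w, good (X w) -> point_support (Upsilon w) = zeros (X w) -> F w -> E (X w)) ->
  P F = 0%E.
Proof.
move=> mF mE E0 FE; apply/negligibleP => //.
apply: (@negligibleS _ _ _ _ (X @^-1` E `|`
  ~` [set w | good (X w) /\ point_support (Upsilon w) = zeros (X w)])).
  move=> w Fw.
  have [[gw zw]|nw] := pselect (good (X w) /\ point_support (Upsilon w) = zeros (X w)).
    by left; exact: FE.
  by right.
apply: negligibleU => //; apply/negligibleP; first exact: measurable_funPTI.
exact: etrans (XE mE) E0.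
Qed.

Let null_event A (E : set cseq) : measurable A -> measurable E ->
  (forall a mu, good a -> point_support mu = zeros a -> A mu <-> E a) ->
  P (Upsilon @^-1` A) = 0%E -> gam E = 0%E.
Proof.
move=> mA mE AE A0; apply: (etrans (esym (XE mE))); apply/negligibleP; first exact: measurable_funPTI.
apply: (@negligibleS _ _ _ _ (Upsilon @^-1` A `|`
  ~` [set w | good (X w) /\ point_support (Upsilon w) = zeros (X w)])).
  move=> w Ew.
  have [[gw zw]|nw] := pselect (good (X w) /\ point_support (Upsilon w) = zeros (X w)).
    by left; apply/(AE (X w)).
  by right.
apply: negligibleU => //; apply/negligibleP => //; exact: measurable_funPTI.
Qed.

(** On coefficients, the deletion is the division by the Blaschke factor at the
    only zero in the separator, unless this zero is multiple: these are the
    alternatives of [core_deletion], which also covers accumulation points of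
    zeros, by [simple_or_double]. *)
Lemma removable_null t A : measurable A -> P (Upsilon @^-1` A) = 0%E ->
  P (Upsilon @^-1` removable t A) = 0%E.
Proof.
move=> mA A0; have mR := measurable_removable t mA.
have [E mE AE] := detectable_event mA; have [F mF RF] := detectable_event mR.
apply: (null_transfer (E := F)) => //; first exact: measurable_funPTI.
  apply: (core_deletion nuE gamE mE (null_event mA mE AE A0) mF) => a Fa ga.
  have [[mu muE]|[u [u1 au hu]]] := simple_or_double ga; last first.
    by exists u; split=> //; right.
  have [mu1 Amu] := (RF a mu ga muE).2 Fa.
  have [z muz Qz] : exists2 z, point_support mu z & sep t z.
    apply: contrapT => noz; have : mu (sep t) = mu set0.
      apply: eq_point_measure => //; rewrite setI0; apply/seteqP; split=> // z [muz Qz].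
      by apply: noz; exists z.
    by rewrite mu1 measure0 => /eqP; rewrite eqe oner_eq0.
  have uniq_z x : point_support mu x -> sep t x -> x = z.
    move=> mux Qx; apply: contrapT => xz.
    have mz := measurable_disc1 z.
    have mD : measurable (sep t `\` [set z]) by exact: measurableD.
    have : mu (sep t) = (mu [set z] + mu (sep t `\` [set z]))%E.
      rewrite -measureU//; last by apply/seteqP; split=> // y [/= -> []].
      congr (mu _); apply/seteqP; split=> [y Qy|y [->//|[]//]].
      by have [->|yz] := pselect (y = z); [left|right].
    have xD : (sep t `\` [set z]) x by [].
    have := point_measure_ge1 mD xD mux.
    rewrite mu1 (point_support1 muz) => le1 eq1.
    have : (1 + 1 <= 1 :> \bar R)%E by rewrite {3}eq1 leeD2l.
    by rewrite -EFinD lee_fin gerDl ler10.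
  have az : power_series a (disc_val z) = 0 by move: muz; rewrite muE.
  have z1 := disc_val_lt1 z.
  exists (disc_val z); split=> //; set h := blaschke_quot _ _.
  have [hz|hz] := pselect (power_series h (disc_val z) = 0); first by right.
  left; have gh : good h by apply: good_blaschke_quot => //; exact: good_ctail.
  apply/(AE h (restrict_points mu (measurableC (msep t)))) => //.
  rewrite support_restrict; apply/seteqP; split=> x.
    move=> [mux nQx]; move: (mux); rewrite muE => ax.
    have [xz|//] := (zeros_quot ga z1 az (disc_val_lt1 x)).1 ax.
    by exfalso; apply: nQx; rewrite (disc_val_inj xz).
  move=> hx; have mux : point_support mu x.
    by rewrite muE; apply/(zeros_quot ga z1 az (disc_val_lt1 x)); right.
  by split=> // Qx; apply: hz; rewrite -(uniq_z x mux Qx).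
by move=> w gw zw Rw; apply/(RF (X w) (Upsilon w)).
Qed.

(** If no zero of [a] is in the separator, the points of the configuration with
    [z] inserted are the zeros of [add_zero z a]. *)
Lemma insertable_null t A : measurable A -> P (Upsilon @^-1` A) = 0%E ->
  lebC.-negligible [set u | exists2 z, disc_val z = u &
    P (Upsilon @^-1` ysection (insertable t A) z) <> 0%E].
Proof.
move=> mA A0; have [E mE AE] := detectable_event mA.
apply: negligibleS (core_insertion nuE gamE mE (null_event mA mE AE A0)).
move=> _ [z <- Pz]; split=> [|Ez]; first exact: disc_val_lt1.
have mI := measurable_ysection z (measurable_insertable t mA).
have z1 := disc_val_lt1 z.
apply: Pz; apply: (null_transfer (E := [set a | E (add_zero (disc_val z) a)])) => //.
- exact: measurable_funPTI.
- by rewrite -[X in measurable X]setTI; exact: measurable_add_zero.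
move=> w gw zw; rewrite /ysection /= inE /= => -[mu0 [Qz Aw]].
have gz := good_add_zero z1 gw.
apply: (AE _ _ gz _).1 Aw.
rewrite support_add support_restrict zw; apply/seteqP; split=> x.
  move=> xz; apply/(blaschke_zero (blaschke_add_zero (X w) z1) gw gz z1 (disc_val_lt1 x)).
  by case: xz => [->|[]]; [left|right].
move=> /(blaschke_zero (blaschke_add_zero (X w) z1) gw gz z1 (disc_val_lt1 x)).
move=> [/disc_val_inj|ax]; [by left|right; split=> // Qx].
have mux : point_support (Upsilon w) x by rewrite zw.
by have := point_measure_ge1 (msep t) Qx mux; rewrite mu0 lee_fin ler10.
Qed.

(** Since one of countably many separators isolates the deleted point, it
    suffices that each event [removable t A] is null. *)
Lemma zeros_deletion_tolerant : deletion_tolerant Upsilon.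
Proof.
move=> d' Omega' P' Pi' Z law' Zae A mA A0.
apply: (@negligibleS _ _ _ _ (~` [set w | point_support (Pi' w) (Z w)] `|`
    \bigcup_t (Pi' @^-1` removable t A))).
  move=> w Aw; have [Zw|] := pselect (point_support (Pi' w) (Z w)); [right|by left].
  have [t [tZ tP]] := separatorP (Pi' w) (Z w); exists t => //.
  have sE : point_support (Pi' w) `&` sep t = [set Z w].
    by apply/seteqP; split=> x /=; [move=> [? ?]; exact: tP|move=> ->].
  split.
    rewrite -(point_support1 Zw); apply: eq_point_measure => //; first exact: measurable_disc1.
    by rewrite sE; apply/seteqP; split=> x /=; [move=> ->|move=> []].
  apply: (eq_support_event mA _).1 Aw; rewrite support_remove support_restrict.
  apply/seteqP; split=> x [mux nx]; split=> // ?; apply: nx; first exact: tP.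
  by have -> : x = Z w by [].
apply: negligibleU => //; apply: negligible_countable => t.
have mR := measurable_removable t mA.
apply/negligibleP; first exact: measurable_funPTI.
by apply: (etrans (law' _ mR)); exact: removable_null.
Qed.

(** The law of the inserted point charges no Lebesgue null set. *)
Lemma hyperbolic_null (S : set (disc R)) (N : set C) : measurable S ->
  measurable N -> lebC N = 0%E -> hyperbolic_measure (dpre N `&` S) = 0%E.
Proof.
move=> [S' mS' SE] mN N0; rewrite /hyperbolic_measure.
have mB : measurable [set z : C | normc z < 1].
  rewrite -[X in measurable X]setTI (_ : [set z | _] = normc @^-1` `]-oo, 1[%classic).
    by apply: measurable_fun_normc => //; exact: measurable_itv.
  by apply/seteqP; split=> z /=; rewrite in_itv.
rewrite (_ : _ @` _ = N `&` (S' `&` [set z | normc z < 1])); last first.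
  rewrite -SE setTI; apply/seteqP; split=> [_ [z [Nz Sz] <-]|z [Nz [Sz z1]]].
    by split=> //; split=> //; exact: disc_val_lt1.
  by have [w wz] := disc_of z1; exists w => //; split; rewrite /= wz.
have mI : measurable (N `&` (S' `&` [set z : C | normc z < 1])).
  by apply: measurableI => //; exact: measurableI.
apply: null_set_integral => //; last by apply: (subset_measure0 _ _ _ N0) => // z [].
apply/measurable_EFinP.
apply: (@eq_measurable_fun _ _ _ _ _ (fun z : C => (1 - normc z ^+ 2) `^ (- 2%:R))).
  move=> z; rewrite inE => -[_ [_ /= z1]]; rewrite powR_invn// subr_ge0.
  by rewrite expr_le1 ?normc_ge0// ltW.
apply: measurable_funTS; apply: (measurableT_comp (measurable_powR _)).
by apply: measurable_funB => //; apply: measurable_funX; exact: measurable_fun_normc.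
Qed.

(** If the inserted point is already in the configuration, nothing changes;
    otherwise some separator certifies it to be new, and by independence Fubini
    reduces the claim to almost every fixed value of the point. *)
Lemma zeros_insertion_tolerant : insertion_tolerant Upsilon.
Proof.
move=> S mS _ _ d' Omega' P' Pi' U law' lawU indep A mA A0.
apply: (@negligibleS _ _ _ _ (Pi' @^-1` A `|`
    \bigcup_t ((fun w => (Pi' w, U w)) @^-1` insertable t A))).
  move=> w Aw; have [Uw|nUw] := pselect (point_support (Pi' w) (U w)); [left|right].
    apply: (eq_support_event mA _).1 Aw; rewrite support_add.
    by apply/seteqP; split=> x; [move=> [->|]|right].
  have [t [tU tP]] := separatorP (Pi' w) (U w); exists t => //.
  have nsep x : point_support (Pi' w) x -> ~ sep t x.
    by move=> mux tx; apply: nUw; rewrite -(tP x).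
  split=> /=.
    rewrite -(measure0 (Pi' w)); apply: eq_point_measure => //; rewrite setI0.
    by apply/seteqP; split=> // x [/nsep].
  split=> //; apply: (eq_support_event mA _).1 Aw; rewrite !support_add support_restrict.
  apply/seteqP; split=> x [xU|]; [by left| |by left|by case; right].
  by move=> mux; right; split=> //; exact: nsep.
apply: negligibleU.
  by apply/negligibleP; [exact: measurable_funPTI|exact: etrans (law' _ mA) A0].
apply: negligible_countable => t; have mI := measurable_insertable t mA.
have mp : measurable_fun setT (fun w => (Pi' w, U w)).
  by apply: measurable_fun_pair; exact: measurable_funP.
apply/negligibleP; first by rewrite -[X in measurable X]setTI; exact: mp.
pose PU : {mfun Omega' >-> (pm * disc R)%type} := HB.pack (fun w => (Pi' w, U w))
  (isMeasurableFun.Build _ _ _ _ _ mp).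
have := @product_measure_unique _ _ _ _ R (distribution P' Pi') (distribution P' U)
  (distribution P' PU) _ _ mI.
move=> prodE; apply: etrans (esym (prodE _)) _; first by move=> B D mB mD; exact: indep.
apply/(null_ysection _ _ mI); have [N [mN N0 sN]] := insertable_null t mA A0.
exists (dpre N); split; first exact: measurable_preimage_disc.
  apply: etrans (lawU _ (measurable_preimage_disc mN)) _.
  by rewrite hyperbolic_null// mul0e.
move=> z Pz; apply: (sN (disc_val z)); exists z => // PzE; apply: Pz => /=.
exact: etrans (law' _ (measurable_ysection z mI)) PzE.
Qed.

End zero_process.

Section gaussian_law.
Context (R : realType) d (Omega : measurableType d) (P : probability Omega R).
Local Notation C := (R[i]).
Local Notation cseq := (cseq R).
Variables (a : nat -> {RV P >-> C}).
Hypothesis a_gaussian : forall n, standard_complex_gaussian (a n).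
Hypothesis a_indep : mutually_independent a.

Lemma law_cylinder (X : {RV P >-> cseq}) : (forall w n, X w n = a n w) ->
  forall l, measurable_seq l ->
  distribution P X (cylinder l) = (\prod_(B <- l) distribution P (a 0%N) B)%E.
Proof.
move=> Xa l ml; pose B n := nth setT l n; pose J := [fset n in iota 0 (size l)]%fset.
have mB n : measurable (B n).
  have [ln|ln] := ltnP n (size l); first exact/ml/mem_nth.
  by rewrite /B nth_default.
have cylE : X @^-1` cylinder l = \bigcap_(n in [set` J]) (a n @^-1` B n).
  have H b : cylinder l b <-> forall n, (n < size l)%N -> B n (b n).
    rewrite /B; elim: l b {ml B J mB} => [|D l IHl] b /=; first by split.
    split=> [[Db /IHl lb] [|n]//=|lb]; first exact: lb.
    by split; [exact: (lb 0%N)|apply/IHl => n nl; exact: (lb n.+1)].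
  apply/seteqP; split=> w /=.
    by move=> /H lw n /=; rewrite !inE mem_iota /= -Xa => /lw.
  by move=> lw; apply/H => n nl; rewrite Xa; apply: lw; rewrite /= !inE mem_iota.
apply: etrans (congr1 P cylE) _; apply: etrans (a_indep _) _ => //.
have JE : perm_eq (enum_fset J) (iota 0 (size l)).
  by apply: uniq_perm; rewrite ?fset_uniq ?iota_uniq// => n; rewrite inE.
rewrite (perm_big _ JE) /= [RHS](big_nth setT) /index_iota subn0.
rewrite big_seq [RHS]big_seq; apply: eq_bigr => n _.
by apply: etrans (a_gaussian n (mB n)) (esym (a_gaussian 0%N (mB n))).
Qed.

End gaussian_law.

Unset Implicit Arguments.

Theorem proposition13 (R : realType) (d : measure_display)
    (Omega : measurableType d) (P : probability Omega R)
    (a : nat -> {RV P >-> R[i]})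
    (a_gaussian : forall n, standard_complex_gaussian (a n))
    (a_indep : mutually_independent a)
    (Upsilon : {RV P >-> point_measure R})
    (Upsilon_zeros : {ae P, forall w,
       point_support (Upsilon w) =
       [set z : disc R | power_series (fun n => a n w) (disc_val z) = 0]}) :
  insertion_tolerant Upsilon /\ deletion_tolerant Upsilon.
Proof.
have mX : measurable_fun setT (fun w => (fun n => a n w) : cseq R).
  by apply: measurable_fun_cseq => n; exact: measurable_funP.
pose X : {RV P >-> cseq R} := HB.pack (fun w => (fun n => a n w) : cseq R)
  (isMeasurableFun.Build _ _ _ _ _ mX).
have gamE := law_cylinder a_gaussian a_indep (X := X) (fun _ _ => erefl).
split.
- exact: (zeros_insertion_tolerant (a_gaussian 0%N) gamE (X := X)).
- exact: (zeros_deletion_tolerant (a_gaussian 0%N) gamE (X := X)).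
Qed.
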